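(* Let $\lambda>0$, $m_0\ne 0$, let the diffusion coefficient be of the form $\sigma(t,x)=\varsigma(t)\sigma(x)$, and let $$\phi(t)=1-\lambda\int_0^tK(t-s)\Big(\frac{\mu(s)}{\lambda m_0}-1\Big)ds,\qquad t\ge0 .$$ Let $X_0\in L^2(\mathbb P)$ and let $(X_t)_{t\ge0}$ be a solution, starting from $X_0$, of $$X_t = X_0\phi(t)+\int_0^t K(t-s)\big(\mu(s)-\lambda X_s\big)\,ds+\int_0^t K(t-s)\varsigma(s)\sigma(X_s)\,dW_s,\qquad t\ge0 .$$ A necessary condition for the identities $$\forall t\ge0,\quad \mathbb E[X_t]=m_0,\qquad \mathrm{Var}(X_t)=v_0\ge0,\qquad \mathbb E[\sigma^2(X_t)]=\bar\sigma_0^2\ge0$$ to hold is that $\mathbb E[X_0]=m_0\ne0$ and that the triplet $(v_0,\bar\sigma_0^2,\varsigma)$ satisfies the functional equation $$\forall t\ge0,\qquad c\lambda^2\Big(1-\Big(1-\frac{(f_\lambda*\mu)(t)}{\lambda m_0}\Big)^2\Big)=(f_\lambda^2*\varsigma^2)(t)\qquad\text{with } c=\frac{v_0}{\bar\sigma_0^2}.$$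
   Context: $W$ is a real standard Brownian motion on a filtered probability space $(\Omega,\mathcal F,(\mathcal F_t)_{t\ge0},\mathbb P)$ satisfying the usual conditions; $X_0$ is a real $\mathcal F_0$-measurable random variable independent of $W$. A solution is an $(\mathcal F_t)$-adapted pathwise continuous process. $\mu:\mathbb R_+\to\mathbb R$ is Borel and locally square integrable. $\sigma:\mathbb R\to(0,+\infty)$ is Lipschitz continuous; $\varsigma:\mathbb R_+\to(0,+\infty)$ is Borel with $\varsigma^2\in L^1_{loc}(\mathbb R_+)$ and bounded at infinity. $K:\mathbb R_+\to\mathbb R_+$, $K\in L^2_{loc}(\mathbb R_+)$, has a finite Laplace transform on $(0,+\infty)$, and for every $T>0$: (i) there are $\widehat\kappa_T<+\infty$, $\widehat\theta\in(0,1]$ with $\sup_{t\in[0,T]}\big[\int_{(t-\delta)^+}^t K(t-u)^2du\big]^{1/2}\le\widehat\kappa_T\delta^{\widehat\theta}$ for all $\delta\in(0,T]$; (ii) there are $\kappa_T<+\infty$, $\theta>0$ with $\sup_{t\in[0,T]}\big[\int_0^t|K(s+\delta)-K(s)|^2ds\big]^{1/2}\le\kappa_T\delta^\theta$ for all $\delta\in(0,T]$. The $\lambda$-resolvent $R_\lambda$ of $K$ is the solution of $R_\lambda(t)+\lambda\int_0^tK(t-s)R_\lambda(s)ds=1$, $t\ge0$, and $f_\lambda:=-R_\lambda'$ on $(0,+\infty)$. Standing assumption $(\mathcal R_\lambda)$: $R_\lambda$ is well defined and differentiable on $(0,+\infty)$, $R_\lambda(0)=1$, $\lim_{t\to+\infty}R_\lambda(t)=a\in[0,1)$,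 $f_\lambda\in L^2(\mathbb R_+)$ and $f_\lambda(t)\ne0$ for Lebesgue-a.e. $t$. Convolution: $(g*h)(t)=\int_0^tg(t-s)h(s)ds$. *)

(* Defs.v *)
From HB Require Import structures.
From mathcomp Require Import all_boot all_order all_algebra.
From mathcomp Require Import all_classical all_reals all_analysis.

Set Implicit Arguments.
Unset Strict Implicit.
Unset Printing Implicit Defensive.
Import Order.TTheory GRing.Theory Num.Theory.
Import numFieldNormedType.Exports.

Local Open Scope classical_set_scope.
Local Open Scope ring_scope.

(* Functions on R_+ are represented by functions on R of which only the values
   on [0, +oo[ are constrained; time-indexed families likewise. *)

Section deterministic.
Context {R : realType}.
Implicit Types (f g h K mu sigma varsigma Rl : R -> R).
Local Notation leb := (@lebesgue_measure R).

Definition square_integrable (D : set R) f :=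
  measurable_fun D f /\ leb.-integrable D (fun t => (f t ^+ 2)%:E).

Definition loc_square_integrable f :=
  measurable_fun (`[0, +oo[ : set R) f /\
  forall T : R, 0 < T -> leb.-integrable `[0, T] (fun t => (f t ^+ 2)%:E).

Definition convol g h (t : R) : R :=
  \int[leb]_(s in `[0, t]) (g (t - s) * h s).

(* Convolution of nonnegative functions, with values in [0, +oo]. *)
Definition econvol g h (t : R) : \bar R :=
  (\int[leb]_(s in `[0%R, t]) (g (t - s) * h s)%:E)%E.

Definition sigma_assumption sigma :=
  (forall x, 0 < sigma x) /\ lipschitz sigma.

Definition varsigma_assumption varsigma :=
  [/\ forall t, 0 <= t -> 0 < varsigma t,
      loc_square_integrable varsigma &
      exists M, \forall t \near +oo, varsigma t <= M].

Record kernel_assumption K : Prop := KernelAssumption {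
  kernel_ge0 : forall t, 0 <= t -> 0 <= K t ;
  kernel_L2loc : loc_square_integrable K ;
  kernel_laplace : forall z : R, 0 < z ->
    (\int[leb]_(t in `[0%R, +oo[) (expR (- (z * t)) * K t)%:E < +oo)%E ;
  kernel_small : forall T : R, 0 < T ->
    exists kappa theta : R, 0 < theta <= 1 /\
    forall delta t : R, 0 < delta <= T -> 0 <= t <= T ->
    (sqrte (\int[leb]_(u in `[Num.max (t - delta)%R 0%R, t]) (K (t - u) ^+ 2)%:E)
      <= (kappa * delta `^ theta)%:E)%E ;
  kernel_shift : forall T : R, 0 < T ->
    exists kappa theta : R, 0 < theta /\
    forall delta t : R, 0 < delta <= T -> 0 <= t <= T ->
    (sqrte (\int[leb]_(s in `[0%R, t]) (`|K (s + delta) - K s| ^+ 2)%:E)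
      <= (kappa * delta `^ theta)%:E)%E }.

(* The integrability requirement excludes the default value of the
   real-valued integral. *)
Definition is_resolvent K (lambda : R) Rl :=
  forall t, 0 <= t ->
  leb.-integrable `[0, t] (fun s => (K (t - s) * Rl s)%:E) /\
  Rl t + lambda * convol K Rl t = 1.

(* f_lambda; only its values on ]0, +oo[ are meaningful. *)
Definition resolvent_density Rl (t : R) : R := - derive1 Rl t.

Record resolvent_assumption K (lambda : R) Rl : Prop := ResolventAssumption {
  resolventP : is_resolvent K lambda Rl ;
  resolvent_derivable : forall t, 0 < t -> derivable Rl t 1 ;
  resolvent0 : Rl 0 = 1 ;
  resolvent_lim : exists a : R, 0 <= a < 1 /\ Rl t @[t --> +oo] --> a ;
  resolvent_density_L2 : square_integrable `]0, +oo[ (resolvent_density Rl) ;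
  resolvent_density_neq0 :
    {ae leb, forall t, 0 < t -> resolvent_density Rl t != 0} }.

Definition volterra_phi K mu (lambda m0 t : R) : R :=
  1 - lambda * convol K (fun s => mu s / (lambda * m0) - 1) t.

End deterministic.

Section stochastic.
Context {d : measure_display} {Omega : measurableType d} {R : realType}.
Variable P : probability Omega R.
Local Notation leb := (@lebesgue_measure R).
Implicit Types (F : R -> set (set Omega)) (X W H : R -> Omega -> R).

Definition measurable_wrt (G : set (set Omega)) (Y : Omega -> R) :=
  measurable_fun [set: g_sigma_algebraType G]
    (Y : g_sigma_algebraType G -> R).

Definition independent (G H : set (set Omega)) :=
  forall A B, G A -> H B -> P (A `&` B) = (P A * P B)%E.

Definition sigma_rv (Y : Omega -> R) : set (set Omega) :=
  preimage_set_system [set: Omega] Y measurable.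

Definition sigma_process X : set (set Omega) :=
  <<s \bigcup_(t in `[0, +oo[) sigma_rv (X t) >>.

Record usual_filtration F : Prop := UsualFiltration {
  filtration_sigma : forall t, 0 <= t -> sigma_algebra [set: Omega] (F t) ;
  filtration_sub : forall t, 0 <= t -> F t `<=` measurable ;
  filtration_le : forall s t, 0 <= s -> s <= t -> F s `<=` F t ;
  filtration_right : forall t, 0 <= t -> \bigcap_(s in `]t, +oo[) F s `<=` F t ;
  filtration_complete : forall N, P.-negligible N -> F 0 N }.

Definition adapted F X := forall t, 0 <= t -> measurable_wrt (F t) (X t).

Record brownian_motion F W : Prop := BrownianMotion {
  brownian_adapted : adapted F W ;
  brownian0 : {ae P, forall w, W 0 w = 0} ;
  brownian_continuous :
    {ae P, forall w, {within `[0, +oo[, continuous (W ^~ w)}} ;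
  brownian_indep : forall s t, 0 <= s -> s < t ->
    independent (F s) (sigma_rv (W t \- W s)) ;
  brownian_normal : forall s t, 0 <= s -> s < t ->
    forall B : set R, measurable B ->
    P ((W t \- W s) @^-1` B) = normal_prob 0 (Num.sqrt (t - s)) B }.

(* The process sum_(i < n) xi_i 1_(]t_i, t_(i+1)]), with xi_i bounded and
   F_(t_i)-measurable. *)
Record simple_process F := SimpleProcess {
  simple_size : nat ;
  simple_time : nat -> R ;
  simple_coef : nat -> Omega -> R ;
  simple_time0 : 0 <= simple_time 0 ;
  simple_time_le : {homo simple_time : i j / (i <= j)%N >-> i <= j} ;
  simple_measurable :
    forall i, measurable_wrt (F (simple_time i)) (simple_coef i) ;
  simple_bounded : forall i, exists M, forall w, `|simple_coef i w| <= M }.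

Definition simple_value F (S : simple_process F) (s : R) (w : Omega) : R :=
  \sum_(i < simple_size S) simple_coef S i w *
    \1_(`]simple_time S i, simple_time S i.+1]) s.

Definition simple_integral F W (S : simple_process F) (t : R) (w : Omega) : R :=
  \sum_(i < simple_size S) simple_coef S i w *
    (W (Num.min (simple_time S i.+1) t) w - W (Num.min (simple_time S i) t) w).

Definition progressive F H (t : R) :=
  forall u, 0 <= u <= t ->
  measurable_fun ((`[0, u] : set R) `*` [set: g_sigma_algebraType (F u)])
    (fun p : R * g_sigma_algebraType (F u) => H p.1 (p.2 : Omega)).

Definition cvg_in_prob0 (Z : nat -> Omega -> \bar R) :=
  forall eps : R, 0 < eps ->
  P [set w | (eps%:E < `|Z n w|)%E] @[n --> \oo] --> 0%E.

(* I is (a version of) the Ito integral of H over [0, t]: the limit in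
   probability of the integrals of simple processes S_n for which the integral
   of |S_n - H|^2 over [0, t] tends to 0 in probability.  Such S_n exist exactly
   when the integral of H^2 over [0, t] is almost surely finite. *)
Definition ito_integral F W H (t : R) (I : Omega -> R) :=
  [/\ progressive F H t,
      measurable_fun [set: Omega] I &
      exists S : nat -> simple_process F,
        cvg_in_prob0 (fun n w =>
          \int[leb]_(s in `[0%R, t]) ((simple_value (S n) s w - H s w) ^+ 2)%:E)%E
        /\
        cvg_in_prob0 (fun n w => (simple_integral W (S n) t w - I w)%:E)].

(* (F_t)-adapted pathwise continuous solution of
   X_t = X_0 phi(t) + int_0^t K(t-s) (mu(s) - lambda X_s) ds
         + int_0^t K(t-s) varsigma(s) sigma(X_s) dW_s. *)
Record volterra_solution F W (K phi mu varsigma sigma : R -> R) (lambda : R)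
    (X0 : Omega -> R) X : Prop := VolterraSolution {
  solution_adapted : adapted F X ;
  solution_continuous : forall w, {within `[0, +oo[, continuous (X ^~ w)} ;
  solution_start : {ae P, forall w, X 0 w = X0 w} ;
  solution_eq : forall t, 0 <= t ->
    exists I : Omega -> R,
      ito_integral F W
        (fun s w => K (t - s) * varsigma s * sigma (X s w)) t I /\
      {ae P, forall w, X t w =
        X0 w * phi t + convol K (fun s => mu s - lambda * X s w) t + I w} }.

End stochastic.

(* Main.v *)
(* Write [Y = X - m0], let [J_t] be the stochastic integral in the equation of [X_t],
   and put [psi = 1 - (f * mu) / (lambda m0)].  For a square integrable variable [Z],
   the function [p t = E[Y_t Z]] is bounded and solves the deterministic equation
   [p + lambda K * p = phi p(0) + E[J_t Z]].  If [E[J_t Z] = (K * nu)(t)], the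
   resolvent identity [f + lambda K * f = lambda K] turns this into
   [p = p(0) psi + (f * nu) / lambda].  By the Ito isometry and [E[Y_0 J_t] = 0],
   this applies successively to [Z = Y_0], to [Z = J_r] and to [Z = Y_T]; the last
   case, taken at time [T], reads
   [v0 = v0 psi(T)^2 + sbar2 / lambda^2 (f^2 * varsigma^2)(T)]. *)

Require Import Defs.
From HB Require Import structures.
From mathcomp Require Import all_boot all_order all_algebra.
From mathcomp Require Import all_classical all_reals all_analysis.
From mathcomp Require Import measurable_realfun ring lra.
Set Implicit Arguments.
Unset Strict Implicit.
Unset Printing Implicit Defensive.
Import Order.TTheory GRing.Theory Num.Theory.
Import numFieldNormedType.Exports.
Local Open Scope classical_set_scope.
Local Open Scope ring_scope.

(** * Real-valued integrals *)

(** The Ito integral is given only as a limit in probability, so its square integrability, its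
    orthogonality to [F 0] and the isometry have to be proved; they follow once the integrand is
    square integrable on [Omega * R]. Local square integrability of [K] and [varsigma] does not make
    [K (t - s) * varsigma s] square integrable in [s]. Finiteness for each [t] is read off from the
    existence of the integral. A bound uniform in [t], on which Fubini for [f * (K * nu)] rests,
    comes from the equation itself: the bounded variance of [X_t] forces a bound on [E[J_t^2]]. On
    the deterministic side [f] is a pointwise derivative on the open half-line, and continuity of
    the resolvent at 0 has to be extracted from the resolvent equation. The resolvent identity is
    obtained almost everywhere, which suffices under integrals. Functions are cut to [[0, T]], where
    convolution over the whole line agrees with the causal one. The last choice of [Z] rests on the
    other two: [E[Y_0 Y_T]] is its initial value and [E[J_t Y_T]] its source. *)

Lemma eq_implies_le {d : Order.disp_t} {T : porderType d} (x y : T) : x = y -> (x <= y)%O.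
Proof. by move=> ->. Qed.

Section real_integrable.
Context {d : measure_display} {T : measurableType d} {R : realType}.
Variable mu : {measure set T -> \bar R}.
Implicit Types f g h : T -> R.

Definition Rintegrable f := mu.-integrable [set: T] (EFin \o f).

Lemma Rintegrable_measurable f : Rintegrable f -> measurable_fun [set: T] f.
Proof. by move=> /integrableP[/measurable_EFinP]. Qed.

Lemma le_Rintegrable f g : measurable_fun [set: T] f ->
  (forall x, `|f x| <= g x) -> Rintegrable g -> Rintegrable f.
Proof.
move=> mf fg; apply: le_integrable => //; first exact/measurable_EFinP.
by move=> x _; rewrite /= lee_fin (le_trans (fg x))// ler_norm.
Qed.

Lemma Rintegrable_norm f : Rintegrable f -> Rintegrable (fun x => `|f x|).
Proof. exact: integrable_norm. Qed.

Lemma RintegrableD f g : Rintegrable f -> Rintegrable g ->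
  Rintegrable (fun x => f x + g x).
Proof. by move=> If Ig; apply: (integrableD _ If Ig). Qed.

Lemma RintegrableB f g : Rintegrable f -> Rintegrable g ->
  Rintegrable (fun x => f x - g x).
Proof. by move=> If Ig; apply: (integrableB _ If Ig). Qed.

Lemma RintegrableZ k f : Rintegrable f -> Rintegrable (fun x => k * f x).
Proof. by move=> If; apply: (integrableZl _ k If). Qed.

Lemma Rintegrable0 : Rintegrable (fun=> 0).
Proof. exact: integrable0. Qed.

Lemma Rintegrable_sum (I : Type) (s : seq I) (F : I -> T -> R) :
  (forall i, Rintegrable (F i)) -> Rintegrable (fun x => \sum_(i <- s) F i x).
Proof.
move=> IF; elim: s => [|i s IHs].
  by under [X in Rintegrable X]eq_fun do rewrite big_nil; exact: Rintegrable0.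
by under [X in Rintegrable X]eq_fun do rewrite big_cons; exact: RintegrableD.
Qed.

Lemma RintegralTD f g : Rintegrable f -> Rintegrable g ->
  \int[mu]_x (f x + g x) = \int[mu]_x f x + \int[mu]_x g x.
Proof. by move=> If Ig; rewrite RintegralD. Qed.

Lemma RintegralTB f g : Rintegrable f -> Rintegrable g ->
  \int[mu]_x (f x - g x) = \int[mu]_x f x - \int[mu]_x g x.
Proof. by move=> If Ig; rewrite RintegralB. Qed.

Lemma RintegralTZ k f : Rintegrable f ->
  \int[mu]_x (k * f x) = k * \int[mu]_x f x.
Proof. by move=> If; rewrite RintegralZl. Qed.

Lemma Rintegral_sum (I : Type) (s : seq I) (F : I -> T -> R) :
  (forall i, Rintegrable (F i)) ->
  \int[mu]_x (\sum_(i <- s) F i x) = \sum_(i <- s) \int[mu]_x F i x.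
Proof.
move=> IF; elim: s => [|i s IHs].
  rewrite big_nil /Rintegral; under eq_integral do rewrite big_nil.
  by rewrite integral0.
rewrite big_cons -IHs -RintegralTD//; last exact: Rintegrable_sum.
by apply: eq_Rintegral => x _; rewrite big_cons.
Qed.

Lemma le_RintegralT f g : Rintegrable f -> Rintegrable g ->
  (forall x, f x <= g x) -> \int[mu]_x f x <= \int[mu]_x g x.
Proof. by move=> If Ig fg; apply: le_Rintegral => // x _. Qed.

Lemma Rintegral_EFin f : Rintegrable f ->
  (\int[mu]_x (f x)%:E)%E = (\int[mu]_x f x)%:E.
Proof. by move=> If; rewrite /Rintegral fineK//; exact: integrable_fin_num. Qed.

Lemma Rintegrable_lty f : measurable_fun [set: T] f -> (forall x, 0 <= f x) ->
  (\int[mu]_x (f x)%:E < +oo)%E -> Rintegrable f.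
Proof.
move=> mf f0 fy; apply/integrableP; split; first exact/measurable_EFinP.
by under eq_integral do rewrite /= ger0_norm//.
Qed.

(** Measurability of [g] is a separate premise because the sigma-algebra need not be complete. *)
Lemma ae_eq_Rintegrable f g : measurable_fun [set: T] g ->
  {ae mu, forall x, f x = g x} -> Rintegrable f -> Rintegrable g.
Proof.
move=> mg fg If; apply/integrableP; split; first exact/measurable_EFinP.
have /integrableP[mf] := If; apply: le_lt_trans.
rewrite (@ae_eq_integral _ _ _ mu setT (fun x => `|(EFin \o f) x|%E))//.
- by apply: measurableT_comp => //; exact/measurable_EFinP.
- by apply: measurableT_comp.
- by apply: filterS fg => x /= -> _.
Qed.

Lemma ae_eq_Rintegral f g : measurable_fun [set: T] f ->
  measurable_fun [set: T] g ->
  {ae mu, forall x, f x = g x} -> \int[mu]_x f x = \int[mu]_x g x.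
Proof.
move=> mf mg fg; rewrite /Rintegral; congr fine.
apply: ae_eq_integral => //; [exact/measurable_EFinP|exact/measurable_EFinP|].
by apply: filterS fg => x /= -> _.
Qed.

(** Domination by [f^2 + g^2], from [(|f| - |g|)^2 >= 0], plays the part of the Cauchy-Schwarz
    inequality. *)
Lemma RintegrableM f g : measurable_fun [set: T] f -> measurable_fun [set: T] g ->
  Rintegrable (fun x => f x ^+ 2) -> Rintegrable (fun x => g x ^+ 2) ->
  Rintegrable (fun x => f x * g x).
Proof.
move=> mf mg If Ig; apply: le_Rintegrable (RintegrableD If Ig).
  exact: measurable_funM.
move=> x; rewrite normrM.
have := sqr_ge0 (`|f x| - `|g x|); rewrite -(real_normK (num_real (f x))).
rewrite -(real_normK (num_real (g x))).
have := normr_ge0 (f x); have := normr_ge0 (g x); nra.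
Qed.

Lemma Rintegrable_mkcond (D : set T) f : measurable D ->
  mu.-integrable D (EFin \o f) <-> Rintegrable (f \_ D).
Proof.
move=> mD; rewrite /Rintegrable integrable_mkcond//.
by rewrite restrict_EFin.
Qed.

Lemma RintegrableS (D : set T) f : measurable D -> Rintegrable f ->
  mu.-integrable D (EFin \o f).
Proof. by move=> mD; apply: integrableS. Qed.

Lemma Rintegrable_patch (D : set T) f : measurable D ->
  mu.-integrable D (EFin \o f) -> Rintegrable (f \_ D).
Proof. by move=> mD /Rintegrable_mkcond; exact. Qed.

End real_integrable.

(** * Fubini and Tonelli theorems for real-valued integrals *)

Section fubini_real.
Context {d1 d2 : measure_display} {T1 : measurableType d1}
  {T2 : measurableType d2} {R : realType}.
Variables (m1 : {sigma_finite_measure set T1 -> \bar R})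
  (m2 : {sigma_finite_measure set T2 -> \bar R}).
Variable f : T1 * T2 -> R.

Lemma Rintegrable_prod1 : measurable_fun [set: T1 * T2] f ->
  (\int[m1]_x \int[m2]_y (`|f (x, y)|)%:E < +oo)%E ->
  Rintegrable (m1 \x m2)%E f.
Proof.
move=> mf h; apply/integrable12ltyP; first exact/measurable_EFinP.
by move: h; under eq_integral do under eq_integral do rewrite -abse_EFin.
Qed.

Lemma Rintegrable_prod2 : measurable_fun [set: T1 * T2] f ->
  (\int[m2]_y \int[m1]_x (`|f (x, y)|)%:E < +oo)%E ->
  Rintegrable (m1 \x m2)%E f.
Proof.
move=> mf h; apply/integrable21ltyP; first exact/measurable_EFinP.
by move: h; under eq_integral do under eq_integral do rewrite -abse_EFin.
Qed.

End fubini_real.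

(** The integral is [fine] of a difference of two Tonelli integrals, each measurable in [x]. This
    covers also the points [x] whose section is not integrable, where [fine] returns a default
    value. *)
Lemma measurable_fun_Rintegral {d1 d2 : measure_display} {T1 : measurableType d1}
    {T2 : measurableType d2} {R : realType}
    (m2 : {sigma_finite_measure set T2 -> \bar R}) (f : T1 * T2 -> R) :
  measurable_fun [set: T1 * T2] f ->
  measurable_fun [set: T1] (fun x => \int[m2]_y f (x, y)).
Proof.
move=> /measurable_EFinP mf.
apply: (measurableT_comp (@fine_measurable R setT measurableT)).
under eq_fun do rewrite integralE.
apply: emeasurable_funB.
  rewrite (_ : (fun _ => _) = fubini_F m2 (EFin \o f)^\+%E).
    apply: measurable_fun_fubini_tonelli_F => //; exact: measurable_funepos.
  by apply/funext => x; apply: eq_integral => y _; rewrite !funeposE.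
rewrite (_ : (fun _ => _) = fubini_F m2 (EFin \o f)^\-%E).
  apply: measurable_fun_fubini_tonelli_F => //; exact: measurable_funeneg.
by apply/funext => x; apply: eq_integral => y _; rewrite !funenegE.
Qed.

(** The real integral is [fine] of the extended one, and [|fine a| <= |a|] for every [a]; hence the
    default values on the null set of bad sections do not spoil the domination. *)
Lemma Rintegrable_fubini1 {d1 d2 : measure_display} {T1 : measurableType d1}
    {T2 : measurableType d2} {R : realType}
    (m1 : {sigma_finite_measure set T1 -> \bar R})
    (m2 : {sigma_finite_measure set T2 -> \bar R}) (f : T1 * T2 -> R) :
  Rintegrable (m1 \x m2)%E f -> Rintegrable m1 (fun x => \int[m2]_y f (x, y)).
Proof.
move=> If; have h := integrable_fubini_F If.
apply/integrableP; split.
  apply/measurable_EFinP.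
  by apply: (measurableT_comp (@fine_measurable R setT measurableT)); exact: measurable_int h.
have /integrableP[_] := h; apply: le_lt_trans.
apply: ge0_le_integral => //.
- do 2 apply: measurableT_comp => //.
  by apply: (measurableT_comp (@fine_measurable R setT measurableT)); exact: measurable_int h.
- by apply: measurableT_comp => //; exact: measurable_int h.
- by move=> x _; rewrite /= /Rintegral /fubini_F /=; case: integral => //=; rewrite normr0 leey.
Qed.

Section fubini_real.
Context {d1 d2 : measure_display} {T1 : measurableType d1}
  {T2 : measurableType d2} {R : realType}.
Variables (m1 : {sigma_finite_measure set T1 -> \bar R})
  (m2 : {sigma_finite_measure set T2 -> \bar R}).
Variable f : T1 * T2 -> R.
Hypothesis If : Rintegrable (m1 \x m2)%E f.

Lemma Rintegrable_swap : Rintegrable (m2 \x m1)%E (fun z => f (z.2, z.1)).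
Proof.
have mf := Rintegrable_measurable If.
apply: Rintegrable_prod1; first exact: (measurableT_comp mf (@measurable_swap _ _ _ _)).
move: If => /integrable21ltyP => /(_ (measurable_int _ If)) /=.
by under eq_integral do under eq_integral do rewrite /=.
Qed.

Lemma Rintegrable_fubini2 : Rintegrable m2 (fun y => \int[m1]_x f (x, y)).
Proof. exact: (Rintegrable_fubini1 Rintegrable_swap). Qed.

Lemma Rfubini1 : \int[m1]_x \int[m2]_y f (x, y) = \int[(m1 \x m2)%E]_z f z.
Proof.
rewrite /Rintegral; congr fine.
rewrite -(integral12_prod_meas1 If); apply: ae_eq_integral => //.
- apply/measurable_EFinP.
  exact: (Rintegrable_measurable (Rintegrable_fubini1 If)).
- exact: (measurable_fubini_F If).
- have := integrable_ae measurableT (integrable_fubini_F If).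
  by apply: filterS => x /= h _; rewrite fineK// h.
Qed.

Lemma Rfubini2 : \int[m2]_y \int[m1]_x f (x, y) = \int[(m1 \x m2)%E]_z f z.
Proof.
rewrite /Rintegral; congr fine.
rewrite -(integral21_prod_meas1 If); apply: ae_eq_integral => //.
- apply/measurable_EFinP.
  exact: (Rintegrable_measurable Rintegrable_fubini2).
- exact: (measurable_fubini_G If).
- have := integrable_ae measurableT (integrable_fubini_F Rintegrable_swap).
  by apply: filterS => x /= h _; rewrite fineK// h.
Qed.

Lemma Rfubini : \int[m1]_x \int[m2]_y f (x, y) = \int[m2]_y \int[m1]_x f (x, y).
Proof. by rewrite Rfubini1 Rfubini2. Qed.

Lemma Rintegrable_ae1 : {ae m1, forall x, Rintegrable m2 (fun y => f (x, y))}.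
Proof. by have := ae_integrable1 If; exact: filterS. Qed.

Lemma Rintegrable_ae2 : {ae m2, forall y, Rintegrable m1 (fun x => f (x, y))}.
Proof. by have := ae_integrable2 If; exact: filterS. Qed.

End fubini_real.

Section tensor.
Context {d1 d2 : measure_display} {T1 : measurableType d1}
  {T2 : measurableType d2} {R : realType}.
Variables (m1 : {sigma_finite_measure set T1 -> \bar R})
  (m2 : {sigma_finite_measure set T2 -> \bar R}).
Variables (g : T1 -> R) (h : T2 -> R).
Hypotheses (Ig : Rintegrable m1 g) (Ih : Rintegrable m2 h).

Lemma Rintegrable_tensor : Rintegrable (m1 \x m2)%E (fun z => g z.1 * h z.2).
Proof.
have mg := Rintegrable_measurable Ig; have mh := Rintegrable_measurable Ih.
have Ig' := Rintegrable_norm Ig; have Ih' := Rintegrable_norm Ih.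
apply: Rintegrable_prod1.
  by apply: measurable_funM; [exact: measurableT_comp mg _|exact: measurableT_comp mh _].
have e x : (\int[m2]_y (`|g x * h y|)%:E)%E = ((\int[m2]_y `|h y|) * `|g x|)%:E.
  under eq_integral do rewrite normrM.
  by rewrite (Rintegral_EFin (RintegrableZ `|g x| Ih')) RintegralTZ// mulrC.
under eq_integral do rewrite /= e.
by rewrite (Rintegral_EFin (RintegrableZ _ Ig')) ltry.
Qed.

Lemma Rintegral_tensor : \int[(m1 \x m2)%E]_z (g z.1 * h z.2) =
  (\int[m1]_x g x) * (\int[m2]_y h y).
Proof.
rewrite -(Rfubini1 Rintegrable_tensor)/= mulrC -RintegralTZ//.
by apply: eq_Rintegral => x _; rewrite RintegralTZ// mulrC.
Qed.

End tensor.

(** * Integration of derivatives *)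

Section cousin.
Context {R : realType}.

(* Sup argument: the points [t] such that [P a t] form an initial segment which
   contains its supremum and cannot stop before [b]. *)
Lemma cousin (P : R -> R -> Prop) (a b : R) : a <= b ->
  (forall u v w, a <= u -> u <= v -> v <= w -> w <= b ->
    P u v -> P v w -> P u w) ->
  (forall x, a <= x <= b -> exists2 e : R, 0 < e & forall u v,
    a <= u -> u <= x -> x <= v -> v <= b -> x - e < u -> v < x + e -> P u v) ->
  P a b.
Proof.
move=> ab Padd Ploc.
pose S := [set t | a <= t <= b /\ P a t].
have aa : P a a.
  have [|e e0 H] := Ploc a; first by rewrite lexx ab.
  by apply: H => //; rewrite ?ltrDl// gtrDl oppr_lt0.
have Sa : S a by split => //; rewrite lexx ab.
have hS : has_sup S by split; [exists a|exists b => t [/andP[]]].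
have ubS t : S t -> t <= sup S by move=> St; exact: ub_le_sup (hS.2) _ St.
have ac : a <= sup S by exact: ubS.
have cb : sup S <= b by apply: ge_sup => //; [exists a|move=> t [/andP[]]].
have [|e e0 H] := Ploc (sup S); first by rewrite ac cb.
have [s Ss cs] := sup_adherent e0 hS.
have [/andP[as_ sb] Pas] := Ss.
have sc := ubS _ Ss.
have Pat t : sup S <= t -> t <= b -> t < sup S + e -> P a t.
  move=> ct tb te; have [sc'|sc'] := leP s (sup S); last by rewrite leNgt sc' in sc.
  apply: (Padd a s t) => //; first exact: le_trans ct.
  exact: H.
have [cb'|cb'] := ltP (sup S) b; last first.
  by apply: Pat => //; rewrite (le_lt_trans cb')// ltrDl.
pose t := Num.min b (sup S + e / 2).
have ct : sup S < t by rewrite lt_min cb' ltrDl divr_gt0.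
have tb : t <= b by rewrite ge_min lexx.
have te : t < sup S + e.
  by rewrite gt_min; apply/orP; right; rewrite ltrD2l ltr_pdivrMr// ltr_pMr// ltr1n.
have : S t by split; [rewrite (le_trans ac (ltW ct)) tb|exact: Pat (ltW ct) tb te].
by move=> /ubS; rewrite leNgt ct.
Qed.

End cousin.

Section ftc.
Context {R : realType}.
Local Notation leb := (@lebesgue_measure R).
Implicit Types (F g : R -> R).

Lemma Rintegral_itvD g (u v w : R) : Rintegrable leb g -> u <= v -> v <= w ->
  \int[leb]_(t in `]u, w]) g t =
  \int[leb]_(t in `]u, v]) g t + \int[leb]_(t in `]v, w]) g t.
Proof.
move=> Ig uv vw.
have := @Rintegral_itvB R g (BRight u) (BRight w) v.
move=> <-; rewrite ?bnd_simp//; last by exact: RintegrableS.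
by rewrite addrC subrK.
Qed.

Lemma derivable_slope F (x l : R) (e : R) : is_derive x 1 F l -> 0 < e ->
  exists2 d : R, 0 < d & forall y, `|y - x| < d ->
    `|F y - F x - l * (y - x)| <= e * `|y - x|.
Proof.
move=> /is_derive1_caratheodory[h [hE hc hx]] e0.
have /cvgrPdist_le/(_ e e0) := hc.
move=> /nbhs_ballP[d /= d0 H]; exists d => // y yx.
rewrite hE -mulrBl normrM ler_wpM2r//.
by have := H y; rewrite /ball/= distrC hx => /(_ yx); rewrite distrC.
Qed.

(* Let [Phi] be the primitive of [g] and [N] the null set where [Phi' = g] fails.
   Off [N], [F - Phi] has zero derivative.  At a point [x] of [N], an increment of
   [F - Phi] is at most the integral of [m * (1 + |g|)] with [m > |g x| + 1], which
   is absorbed by covering [N] with open sets [U k] on which [1 + |g|] has integral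
   at most [e / 2 ^ k]. *)
Lemma derivable_FTC F g (a b : R) : a <= b -> Rintegrable leb g ->
  (forall x, a <= x <= b -> is_derive x 1 F (g x)) ->
  F b - F a = \int[leb]_(t in `]a, b]) g t.
Proof.
move=> ab Ig dF.
pose Phi x := \int[leb]_(t in `]-oo, x]) g t.
have PhiB u v : u <= v -> Phi v - Phi u = \int[leb]_(t in `]u, v]) g t.
  by move=> uv; rewrite /Phi Rintegral_itvB ?bnd_simp//; exact: RintegrableS.
have [N [mN N0 NS]] : {ae leb, forall x, derivable Phi x 1 /\ derive1 Phi x = g x}.
  apply: FTC1Ny; first by move=> y; exact: RintegrableS.
  apply: open_integrable_locally => //; exact: openT.
pose w x := (1 + `|g x|) * \1_(`[a, b]) x.
have Iw : Rintegrable leb w.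
  have I1 : Rintegrable leb (\1_(`[a, b]) : R -> R).
    by apply: integrable_indic_itv.
  apply: le_Rintegrable (RintegrableD I1 (Rintegrable_norm Ig)).
    apply: measurable_funM => //; apply: measurable_funD => //.
    by apply: measurableT_comp => //; exact: Rintegrable_measurable Ig.
  move=> x; rewrite /w indicE; case: (_ \in _) => /=.
    by rewrite mulr1 ger0_norm// addr_ge0.
  by rewrite mulr0 normr0 add0r.
have w0 x : 0 <= w x by rewrite mulr_ge0// addr_ge0.
(* The term [b - a] comes from the points off [N], where slopes agree up to [e]; the term [2] is the
   sum of the [2 ^- k] over the covering sets. *)
have key e : 0 < e -> `|(F b - F a) - \int[leb]_(t in `]a, b]) g t| <= e * (b - a + 2).
  move=> e0.
  have HU k : exists U : set R, [/\ open U, N `<=` U &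
      \int[leb]_(x in U) w x <= e / 2 ^+ k].
    have ek0 : 0 < e / 2 ^+ k by rewrite divr_gt0// exprn_gt0.
    (* Outer regularity gives an open set of small measure; absolute continuity of the integral of
       [w] turns this into a small integral. *)
    have [d [d0 Hd]] := integral_normr_continuous Iw ek0.
    have leN : (leb N < +oo)%E by rewrite N0 ltry.
    have [U [oU NU UN]] := lebesgue_regularity_outer mN leN d0.
    exists U; split => //; apply: ltW.
    under eq_Rintegral do rewrite -(ger0_norm (w0 _)).
    apply: Hd; first exact: open_measurable.
    apply: le_lt_trans UN; rewrite -[in leLHS](setDUK NU) measureU//=.
    - by rewrite [X in (X + _)%E]N0 add0e.
    - by apply: measurableD => //; exact: open_measurable.
    - by rewrite setDE setICA setICr setI0.
  pose U k := projT1 (cid (HU k)).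
  have oU k : open (U k) by rewrite /U; case: cid => V [].
  have NU k : N `<=` U k by rewrite /U; case: cid => V [].
  have wU k : \int[leb]_(x in U k) w x <= e / 2 ^+ k by rewrite /U; case: cid => V [].
  have mU k : measurable (U k) by exact: open_measurable.
  pose wk k x := w x * \1_(U k) x.
  have Iwk k : Rintegrable leb (wk k).
    apply: (le_Rintegrable _ _ Iw).
      apply: measurable_funM; first exact: Rintegrable_measurable Iw.
      apply: measurable_indic; exact: mU.
    move=> x; rewrite /wk indicE; case: (_ \in _) => /=; first by rewrite mulr1 ger0_norm.
    by rewrite mulr0 normr0.
  have wk0 k x : 0 <= wk k x by rewrite mulr_ge0.
  pose beta n u v := \int[leb]_(t in `]u, v]) (\sum_(k < n) wk k t).
  have Ib n : Rintegrable leb (fun t => \sum_(k < n) wk k t).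
    by apply: Rintegrable_sum.
  have betaD n u v z : u <= v -> v <= z -> beta n u z = beta n u v + beta n v z.
    by move=> uv vz; exact: Rintegral_itvD.
  have beta0 n u v : 0 <= beta n u v.
    by apply: Rintegral_ge0 => x _; apply: sumr_ge0.
  have beta_le n m u v : (n <= m)%N -> beta n u v <= beta m u v.
    move=> nm; apply: le_Rintegral => //; [exact: RintegrableS|exact: RintegrableS|].
    move=> x _; rewrite (big_ord_widen m (fun k => wk k x))//.
    by rewrite [leRHS](bigID (fun i : 'I_m => (i < n)%N))/= lerDl sumr_ge0.
  have betaab n : beta n a b <= 2 * e.
    apply: (@le_trans _ _ (\sum_(k < n) \int[leb]_x wk k x)).
      rewrite -Rintegral_sum// /beta Rintegral_mkcond; apply: le_RintegralT => //.
        by apply: Rintegrable_patch => //; exact: (RintegrableS _ (Ib n)).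
      by move=> x; rewrite patchE; case: ifP => // _; apply: sumr_ge0.
    apply: (@le_trans _ _ (\sum_(k < n) e / 2 ^+ k)).
      apply: ler_sum => k _; apply: le_trans (wU k).
      rewrite [leRHS]Rintegral_mkcond; apply: eq_implies_le.
      apply: eq_Rintegral => x _; rewrite patchE /wk indicE.
      by case: (x \in U k); rewrite ?mulr1 ?mulr0.
    have -> : \sum_(k < n) e / 2 ^+ k = 2 * e - 2 * e / 2 ^+ n.
      elim: n => [|n IHn]; first by rewrite big_ord0 expr0 divr1 subrr.
      rewrite big_ord_recr/= IHn exprS; field.
      by rewrite expf_neq0// pnatr_eq0.
    by rewrite gerBl divr_ge0// ?mulr_ge0// ?exprn_ge0// ltW.
  (* The number [n] of covering sets depends on the point. Since [beta] grows with [n], two adjacent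
     intervals are glued at the larger of their numbers. *)
  pose P u v := exists n, `|(F v - F u) - (Phi v - Phi u)| <= e * (v - u) + beta n u v.
  suff [n Pab] : P a b.
    rewrite -PhiB//; apply: (le_trans Pab).
    by have := betaab n; rewrite mulrDr; lra.
  apply: cousin => //.
    move=> u v z au uv vz zb [n Pn] [m Pm]; exists (maxn n m).
    have -> : F z - F u - (Phi z - Phi u) =
      (F v - F u - (Phi v - Phi u)) + (F z - F v - (Phi z - Phi v)) by ring.
    rewrite (betaD _ u v z)//; apply: (le_trans (ler_normD _ _)).
    have := beta_le n (maxn n m) u v (leq_maxl _ _).
    have := beta_le m (maxn n m) v z (leq_maxr _ _).
    by move: Pn Pm; nra.
  move=> x xab; have dFx := dF _ xab.
  have [xN|xN] := pselect (N x); last first.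
    have [dP Px] : derivable Phi x 1 /\ derive1 Phi x = g x.
      by apply: contrapT => h; apply: xN; exact: NS.
    have isP : is_derive x 1 Phi (g x) by rewrite -Px derive1E; exact/derivableP.
    have e2 : 0 < e / 2 by rewrite divr_gt0.
    have [d1 d10 H1] := derivable_slope dFx e2.
    have [d2 d20 H2] := derivable_slope isP e2.
    exists (Num.min d1 d2); first by rewrite lt_min d10.
    move=> u v _ ux xv _; rewrite ltrBlDr -ltrBlDl lt_min => /andP[u1 u2].
    rewrite -ltrBlDl lt_min => /andP[v1 v2]; exists 0%N.
    rewrite /beta; under eq_Rintegral do rewrite big_ord0.
    rewrite Rintegral_cst// mul0r addr0.
    have nu : `|u - x| = x - u by rewrite distrC ger0_norm// subr_ge0.
    have nv : `|v - x| = v - x by rewrite ger0_norm// subr_ge0.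
    have := H1 u; have := H1 v; have := H2 u; have := H2 v.
    rewrite nu nv => /(_ v2) A1 /(_ u2) A2 /(_ v1) A3 /(_ u1) A4.
    move: A1 A2 A3 A4; rewrite !ler_norml => /andP[? ?] /andP[? ?] /andP[? ?] /andP[? ?].
    by apply/andP; split; lra.
  have [d1 d10 H1] := derivable_slope dFx ltr01.
  pose m := (Num.truncn (`|g x| + 1)).+1.
  have gm : `|g x| + 1 <= m%:R by apply: ltW; exact: truncnS_gt.
  have : \forall y \near x, forall k, (k < m)%N -> U k y.
    elim: m {gm} => [|n IHn]; first by near=> y => k; rewrite ltn0.
    have : nbhs x (U n) by apply: open_nbhs_nbhs; split => //; exact: NU.
    move=> Un; near=> y => k; rewrite ltnS leq_eqVlt => /predU1P[->|kn].
      by near: y.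
    by move: k kn; near: y.
  move=> /nbhs_ballP[d2 /= d20 H2].
  exists (Num.min d1 d2); first by rewrite lt_min d10.
  move=> u v au ux xv vb; rewrite ltrBlDr -ltrBlDl lt_min => /andP[u1 u2].
  rewrite -ltrBlDl lt_min => /andP[v1 v2]; exists m.
  have nu : `|u - x| = x - u by rewrite distrC ger0_norm// subr_ge0.
  have nv : `|v - x| = v - x by rewrite ger0_norm// subr_ge0.
  have uv := le_trans ux xv.
  have FF : `|F v - F u| <= m%:R * (v - u).
    have := H1 u; have := H1 v; rewrite nu nv => /(_ v1) A1 /(_ u1) A2.
    apply: (@le_trans _ _ ((`|g x| + 1) * (v - u))); last by rewrite ler_wpM2r// subr_ge0.
    have -> : F v - F u = (F v - F x - g x * (v - x)) - (F u - F x - g x * (u - x)) + g x * (v - u) by ring.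
    apply: (le_trans (ler_normD _ _)); rewrite normrM (ger0_norm (_ : 0 <= v - u)) ?subr_ge0//.
    have := ler_normB (F v - F x - g x * (v - x)) (F u - F x - g x * (u - x)).
    by move: A1 A2; lra.
  (* All of [U 0, ..., U (m - 1)] contain the interval, so [beta m] counts [1 + |g|] at least [m]
     times. The summand [m * (v - u)] pays for the increment of [F], the integral of [|g|] for that
     of [Phi]. *)
  have bm : m%:R * (v - u) + \int[leb]_(t in `]u, v]) `|g t| <= beta m u v.
    have Im : leb.-integrable `]u, v] (EFin \o (fun=> m%:R : R)).
      apply/integrableP; split; first exact: (@measurable_cst _ _ _ _ _ m%:R%:E).
      rewrite [X in (X < _)%E](_ : _ = \int[leb]_(x in `]u, v]) (cst `|m%:R : R|%:E) x)%E//.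
      rewrite integral_cst//= lebesgue_measure_itv/= lte_fin.
      by case: ifP => _; rewrite -?EFinB -?EFinM ?mule0 ltry.
    have -> : m%:R * (v - u) = \int[leb]_(t in `]u, v]) m%:R.
      rewrite Rintegral_cst//= lebesgue_measure_itv/= lte_fin; case: ltP => //= vu.
      have -> : v = u by apply/eqP; rewrite eq_le vu uv.
      by rewrite subrr.
    have Ing : leb.-integrable `]u, v] (EFin \o (fun t => `|g t|)).
      by apply: RintegrableS => //; exact: Rintegrable_norm.
    rewrite -RintegralD//.
    apply: le_Rintegral => //.
    - exact: (integrableD _ Im Ing).
    - exact: RintegrableS.
    move=> t /=; rewrite in_itv/= => /andP[ut tv].
    have Ut k : (k < m)%N -> t \in U k.
      move=> km; rewrite inE; apply: H2 => //.
      rewrite /ball/= ltr_norml; move: u2 v2 ut tv; lra.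
    apply: (@le_trans _ _ (\sum_(k < m) (1 + `|g t|))).
      by rewrite big_const_ord iter_addr addr0 mulrnDl lerD// mulrS lerDl mulrn_wge0.
    apply: ler_sum => k _; rewrite /wk /w !indicE Ut// mem_set ?mulr1//=.
    by rewrite in_itv/= (le_trans au (ltW ut)) (le_trans tv vb).
  apply: (le_trans (ler_normB _ _)); rewrite PhiB//.
  apply: (@le_trans _ _ (beta m u v)); last by rewrite lerDr mulr_ge0// ?subr_ge0// ltW.
  apply: le_trans bm; apply: lerD => //.
  by apply: le_normr_Rintegral => //; exact: RintegrableS.
apply/eqP; rewrite -subr_eq0 -normr_le0; apply/ler_addgt0Pl => e e0.
have h : 0 < b - a + 2 by rewrite ltr_wpDl// subr_ge0.
by rewrite addr0 (le_trans (key (e / (b - a + 2)) _))// ?divr_gt0// divfK// gt_eqF.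
Unshelve. all: by end_near. Qed.

End ftc.

(** * Convolution and Volterra equations *)

Section reflection.
Context {R : realType}.
Local Notation leb := (@lebesgue_measure R).
Implicit Types (f g h : R -> R) (t : R).

Lemma measurable_subr t : measurable_fun [set: R] (fun s => t - s).
Proof. exact: measurable_funB. Qed.

(** Reflection sends []a, b]] to an interval of the same length closed at the other end; uniqueness
    of Lebesgue measure on half-open intervals does the rest. *)
Lemma lebesgue_measure_subr t (A : set R) : measurable A ->
  pushforward leb (fun s : measurableTypeR R => t - s : measurableTypeR R) A = leb A.
Proof.
move=> mA.
pose h (s : measurableTypeR R) : measurableTypeR R := t - s.
have mh : measurable_fun setT h by exact: measurable_subr.
pose h_mixin := isMeasurableFun.Build _ _ _ _ _ mh.
pose hh : {mfun _ >-> _} := HB.pack h h_mixin.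
apply/esym.
apply: (@lebesgue_measure_unique R (pushforward leb hh)) => //= _ [[a b]] _ <-.
rewrite /pushforward.
have -> : h @^-1` `]a, b] = [set` `[t - b, t - a[].
  by apply/seteqP; split => x /=; rewrite /h !in_itv/= => /andP[? ?]; apply/andP; split; lra.
rewrite !lebesgue_measure_itv/= !lte_fin ltrD2l ltrN2.
by case: ifP => // _; rewrite -!EFinB; congr EFin; ring.
Qed.

Lemma ge0_integral_subr (f : R -> \bar R) t : measurable_fun [set: R] f ->
  (forall x, 0 <= f x)%E ->
  (\int[leb]_s f (t - s)%R = \int[leb]_s f s)%E.
Proof.
move=> mf f0; pose h (s : measurableTypeR R) : measurableTypeR R := t - s.
have mh : measurable_fun setT h by exact: measurable_subr.
rewrite -[LHS](@ge0_integral_pushforward _ _ _ _ R h mh leb setT f)//.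
by apply: eq_measure_integral => A mA _; exact: lebesgue_measure_subr.
Qed.

Lemma Rintegrable_subr f t : Rintegrable leb f -> Rintegrable leb (fun s => f (t - s)).
Proof.
move=> If; have mf := Rintegrable_measurable If.
apply/integrableP; split.
  by apply/measurable_EFinP; apply: (measurableT_comp mf); exact: measurable_subr.
have /integrableP[_] := If; apply: le_lt_trans.
rewrite -(@ge0_integral_subr (fun s => `|(EFin \o f) s|%E) t)//.
by apply: measurableT_comp => //; exact/measurable_EFinP.
Qed.

Lemma Rintegral_subr f t : Rintegrable leb f ->
  \int[leb]_s f (t - s) = \int[leb]_s f s.
Proof.
move=> If; pose h (s : measurableTypeR R) : measurableTypeR R := t - s.
have mh : measurable_fun setT h by exact: measurable_subr.
have mf := Rintegrable_measurable If.
rewrite /Rintegral; congr fine.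
rewrite -[LHS](@integral_pushforward _ _ _ _ R h mh leb setT (EFin \o f))//.
- by apply: eq_measure_integral => A mA _; exact: lebesgue_measure_subr.
- exact/measurable_EFinP.
- exact: (Rintegrable_subr t If).
Qed.

Lemma ae_subr (Q : R -> Prop) t : {ae leb, forall s, Q s} ->
  {ae leb, forall s, Q (t - s)}.
Proof.
move=> [N [mN N0 NQ]]; exists ((fun s => t - s) @^-1` N); split.
- by rewrite -[X in measurable X]setTI; exact: measurable_subr.
- by rewrite -N0; apply: lebesgue_measure_subr.
- by move=> s /= nQ; apply: NQ.
Qed.

(** A translation is the composite of two reflections. *)
Lemma Rintegrable_subl f t : Rintegrable leb f -> Rintegrable leb (fun s => f (s - t)).
Proof.
move=> /(Rintegrable_subr 0)/(Rintegrable_subr t).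
by apply: eq_integrable => // s _ /=; congr (f _)%:E; ring.
Qed.

Lemma Rintegral_subl f t : Rintegrable leb f ->
  \int[leb]_s f (s - t) = \int[leb]_s f s.
Proof.
move=> If; rewrite -(Rintegral_subr 0 If).
rewrite -(Rintegral_subr t (Rintegrable_subr 0 If)).
by apply: eq_Rintegral => s _; congr f; ring.
Qed.

(** By Lebesgue differentiation [f] is almost everywhere the derivative of its primitive, here the
    zero function. *)
Lemma ae_eq0_primitive f : Rintegrable leb f ->
  (forall t, \int[leb]_(s in `]-oo, t]) f s = 0) -> {ae leb, forall s, f s = 0}.
Proof.
move=> If f0.
pose Phi x := \int[leb]_(t in `]-oo, x]) f t.
have : {ae leb, forall x, derivable Phi x 1 /\ derive1 Phi x = f x}.
  apply: FTC1Ny; first by move=> y; exact: RintegrableS.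
  by apply: open_integrable_locally => //; exact: openT.
apply: filterS; first exact: (ae_filter_ringOfSetsType leb). move=> x [_ <-].
rewrite (_ : Phi = cst 0); first by rewrite derive1_cst.
by apply/funext => y; exact: f0.
Qed.

End reflection.

Section convolution.
Context {R : realType}.
Local Notation leb := (@lebesgue_measure R).
Implicit Types (a b c : R -> R) (t : R).

(** Integration is over the whole line: for functions cut to [[0, T]] this agrees with [convol] on
    [[0, T]], and associativity becomes Fubini without moving domains. *)
Definition conv a b t : R := \int[leb]_s (a (t - s) * b s).

Lemma measurable_fun_diff a : measurable_fun [set: R] a ->
  measurable_fun [set: R * R] (fun z : R * R => a (z.1 - z.2)).
Proof.
move=> ma; apply: (measurableT_comp ma).
by apply: measurable_funB.
Qed.

Lemma measurable_conv_integrand a b t : measurable_fun [set: R] a ->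
  measurable_fun [set: R] b -> measurable_fun [set: R] (fun s => a (t - s) * b s).
Proof.
move=> ma mb; apply: measurable_funM => //.
by apply: (measurableT_comp ma); exact: measurable_subr.
Qed.

Lemma convC a b t : Rintegrable leb (fun s => a (t - s) * b s) ->
  conv a b t = conv b a t.
Proof.
move=> Iab; rewrite [LHS]/conv -(Rintegral_subr t Iab); apply: eq_Rintegral => s _ /=.
by rewrite subKr mulrC.
Qed.

Lemma Rintegrable_convC a b t : Rintegrable leb (fun s => a (t - s) * b s) ->
  Rintegrable leb (fun s => b (t - s) * a s).
Proof.
move=> /(Rintegrable_subr t); apply: eq_integrable => // s _ /=.
by rewrite subKr mulrC.
Qed.

(** Integrability is asked of the product [k * a], which is what a Fubini section provides; for
    [k = 0] the integral of [a] may be a default value, but it is multiplied by 0. *)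
Lemma Rintegral_scale (mu : {measure set (measurableTypeR R) -> \bar R}) (k : R) a :
  Rintegrable mu (fun s => k * a s) ->
  \int[mu]_s (k * a s) = k * \int[mu]_s a s.
Proof.
move=> Ika; have [->|k0] := eqVneq k 0.
  rewrite mul0r /Rintegral; under eq_integral do rewrite mul0r.
  by rewrite integral0.
rewrite RintegralTZ//.
have := RintegrableZ k^-1 Ika; apply: eq_integrable => // s _ /=.
by rewrite mulKf.
Qed.

Lemma measurable_conv a b : measurable_fun [set: R] a -> measurable_fun [set: R] b ->
  measurable_fun [set: R] (conv a b).
Proof.
move=> ma mb.
apply: (@measurable_fun_Rintegral _ _ _ _ _ leb (fun z : R * R => a (z.1 - z.2) * b z.2)).
apply: measurable_funM; first exact: measurable_fun_diff.
exact: measurableT_comp.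
Qed.

Lemma conv3_inner a b c t u :
  Rintegrable leb (fun s => a (t - s) * (b (s - u) * c u)) ->
  \int[leb]_s (a (t - s) * (b (s - u) * c u)) = conv a b (t - u) * c u.
Proof.
have e s : a (t - s) * (b (s - u) * c u) = c u * (a (t - s) * b (s - u)) by ring.
under [X in Rintegrable _ X]eq_fun do rewrite e; under eq_Rintegral do rewrite e.
move=> Iu; rewrite Rintegral_scale// [RHS]mulrC.
have [->|c0] := eqVneq (c u) 0; first by rewrite !mul0r.
congr (_ * _).
have Iab : Rintegrable leb (fun s => a (t - s) * b (s - u)).
  by have := RintegrableZ (c u)^-1 Iu; apply: eq_integrable => // s _ /=; rewrite mulKf.
have Iba := Rintegrable_subr t Iab.
rewrite -(Rintegral_subr t Iab) -(Rintegral_subr (t - u) Iba).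
by apply: eq_Rintegral => s _; congr (a _ * b _); ring.
Qed.

Definition conv3_integrable a b c t :=
  Rintegrable (leb \x leb)%E (fun z : R * R => a (t - z.1) * (b (z.1 - z.2) * c z.2)).

(** Fubini on the triple product. Scalars can be pulled out of the inner integrals only where the
    sections are integrable, so both ends are almost everywhere identifications. *)
Lemma convA a b c t : measurable_fun [set: R] a ->
  measurable_fun [set: R] b -> measurable_fun [set: R] c ->
  conv3_integrable a b c t ->
  conv a (conv b c) t = conv (conv a b) c t.
Proof.
move=> ma mb mc Iabc; rewrite /conv.
transitivity (\int[leb]_s \int[leb]_u (a (t - s) * (b (s - u) * c u))).
  apply: ae_eq_Rintegral.
  - apply: measurable_funM; first by apply: (measurableT_comp ma); exact: measurable_subr.
    exact: measurable_conv.
  - exact: (Rintegrable_measurable (Rintegrable_fubini1 Iabc)).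
  - have := Rintegrable_ae1 Iabc; apply: filterS => s /= Is.
    by rewrite Rintegral_scale.
rewrite (Rfubini Iabc)/=.
apply: ae_eq_Rintegral.
- exact: (Rintegrable_measurable (Rintegrable_fubini2 Iabc)).
- by apply: (@measurable_conv_integrand (conv a b) c t) => //; exact: measurable_conv.
- by have := Rintegrable_ae2 Iabc; apply: filterS => u /= Iu; rewrite conv3_inner.
Qed.

(** Tonelli with the inner integral in [u]. The bound is asked only where [a (t - s)] is nonzero:
    for an [a] supported in [[0, T]] this confines [s] to the range where the equation is known. *)
Lemma conv3_integrable_bounded a b c t (C : R) : Rintegrable leb a ->
  measurable_fun [set: R] b -> measurable_fun [set: R] c ->
  (forall s, a (t - s) != 0 -> Rintegrable leb (fun u => b (s - u) * c u) /\
    \int[leb]_u `|b (s - u) * c u| <= C) ->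
  conv3_integrable a b c t.
Proof.
move=> Ia mb mc H; have ma := Rintegrable_measurable Ia.
apply: Rintegrable_prod1.
  apply: measurable_funM.
    apply: (measurableT_comp ma).
    exact: (measurableT_comp (measurable_subr t)).
  apply: measurable_funM; first exact: measurable_fun_diff.
  exact: measurableT_comp.
apply: (@le_lt_trans _ _ (\int[leb]_s (C * `|a (t - s)|)%:E)%E); last first.
  rewrite Rintegral_EFin ?ltry//; apply: RintegrableZ; apply: Rintegrable_norm.
  exact: Rintegrable_subr.
apply: ge0_le_integral => //.
- by move=> s _; apply: integral_ge0 => u _; rewrite lee_fin.
- apply: (@measurable_fun_fubini_tonelli_F _ _ _ _ _ leb
    (fun z : R * R => `|a (t - z.1) * (b (z.1 - z.2) * c z.2)|%:E)) => //.
    apply/measurable_EFinP; apply: measurableT_comp => //.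
    apply: measurable_funM.
      apply: (measurableT_comp ma).
      exact: (measurableT_comp (measurable_subr t)).
    apply: measurable_funM; first exact: measurable_fun_diff.
    exact: measurableT_comp.
- apply/measurable_EFinP; apply: measurable_funM => //; apply: measurableT_comp => //.
  by apply: (measurableT_comp ma); exact: measurable_subr.
- move=> s _ /=; have [as0|as0] := eqVneq (a (t - s)) 0.
    rewrite as0 normr0 mulr0; under eq_integral do rewrite mul0r normr0.
    by rewrite integral0.
  have [Ibc bC] := H s as0.
  under eq_integral do rewrite normrM EFinM.
  have Ibc' := Rintegrable_norm Ibc.
  rewrite (integralZl measurableT Ibc') (Rintegral_EFin Ibc').
  by rewrite -EFinM lee_fin mulrC ler_wpM2r.
Qed.

Lemma Rintegrable_conv_prod a b : Rintegrable leb a -> Rintegrable leb b ->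
  Rintegrable (leb \x leb)%E (fun z : R * R => a (z.1 - z.2) * b z.2).
Proof.
move=> Ia Ib; have ma := Rintegrable_measurable Ia; have mb := Rintegrable_measurable Ib.
apply: Rintegrable_prod2.
  apply: measurable_funM; first exact: measurable_fun_diff.
  exact: measurableT_comp.
have Ia' := Rintegrable_norm Ia.
rewrite [X in (X < _)%E](_ : _ = \int[leb]_u ((\int[leb]_s `|a s|) * `|b u|)%:E)%E; last first.
  apply: eq_integral => u _ /=; under eq_integral do rewrite normrM mulrC EFinM.
  rewrite (integralZl measurableT (Rintegrable_subl u Ia')) (Rintegral_EFin (Rintegrable_subl u Ia')).
  by rewrite (Rintegral_subl u Ia') -EFinM mulrC.
by rewrite Rintegral_EFin ?ltry//; apply: RintegrableZ; exact: Rintegrable_norm.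
Qed.

Lemma Rintegrable_conv a b : Rintegrable leb a -> Rintegrable leb b ->
  Rintegrable leb (conv a b).
Proof. by move=> Ia Ib; exact: (Rintegrable_fubini1 (Rintegrable_conv_prod Ia Ib)). Qed.

Lemma conv3_integrable_bounded2 a b c t (C : R) : measurable_fun [set: R] a ->
  (forall x, `|a x| <= C) -> Rintegrable leb b -> Rintegrable leb c ->
  conv3_integrable a b c t.
Proof.
move=> ma aC Ib Ic.
have Ibc := RintegrableZ C (Rintegrable_norm (Rintegrable_conv_prod Ib Ic)).
apply: le_Rintegrable Ibc.
  apply: measurable_funM.
    apply: (measurableT_comp ma).
    exact: (measurableT_comp (measurable_subr t)).
  exact: (Rintegrable_measurable (Rintegrable_conv_prod Ib Ic)).
by move=> z; rewrite normrM ler_wpM2r.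
Qed.

Lemma Rintegrable_bounded_conv a b t (C : R) : Rintegrable leb a ->
  measurable_fun [set: R] b -> (forall x, a (t - x) != 0 -> `|b x| <= C) ->
  Rintegrable leb (fun s => a (t - s) * b s).
Proof.
move=> Ia mb bC; have ma := Rintegrable_measurable Ia.
apply: (le_Rintegrable _ _ (RintegrableZ C (Rintegrable_norm (Rintegrable_subr t Ia)))).
  exact: measurable_conv_integrand.
move=> s; have [->|as0] := eqVneq (a (t - s)) 0; first by rewrite mul0r !normr0 mulr0.
by rewrite normrM mulrC ler_wpM2r// bC.
Qed.

End convolution.

(** * Linear Volterra equations solved by the resolvent density *)

Section volterra.
Context {R : realType}.
Local Notation leb := (@lebesgue_measure R).
Variables (T lambda : R) (k f : R -> R).
Hypotheses (T0 : 0 <= T) (l0 : lambda != 0).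
Hypotheses (Ik : Rintegrable leb k) (If : Rintegrable leb f).
Hypotheses (suppk : forall x, ~~ (0 <= x <= T) -> k x = 0)
  (suppf : forall x, ~~ (0 <= x <= T) -> f x = 0).
(** The unit step, cut at [T] to be integrable: convolution with it is integration from 0, so
    [1 - e * f] is the resolvent in terms of its density. *)
Let e : R -> R := \1_(`[0, T]).
Let mk : measurable_fun [set: R] k := Rintegrable_measurable Ik.
Let mf : measurable_fun [set: R] f := Rintegrable_measurable If.

Lemma conv_lt0 (a b : R -> R) t : (forall x, x < 0 -> a x = 0) ->
  (forall x, x < 0 -> b x = 0) -> t < 0 -> conv a b t = 0.
Proof.
move=> a0 b0 t0; rewrite /conv /Rintegral (eq_integral (cst 0%E)) ?integral0//.
move=> s _ /=; have [s0|s0] := ltP s 0; first by rewrite b0 ?mulr0.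
by rewrite a0 ?mul0r//; lra.
Qed.

Let k_lt0 x : x < 0 -> k x = 0.
Proof. by move=> x0; rewrite suppk// negb_and -!ltNge x0. Qed.
Let f_lt0 x : x < 0 -> f x = 0.
Proof. by move=> x0; rewrite suppf// negb_and -!ltNge x0. Qed.
Let e_lt0 x : x < 0 -> e x = 0.
Proof. by move=> x0; rewrite /e indicE memNset//= in_itv/= leNgt x0. Qed.
Let e_in x : 0 <= x <= T -> e x = 1.
Proof. by move=> x0; rewrite /e indicE mem_set//= in_itv. Qed.
Let me_ : measurable_fun [set: R] e.
Proof. exact: measurable_indic. Qed.
Let e_le1 x : `|e x| <= 1.
Proof. by rewrite /e indicE; case: (_ \in _); rewrite ?normr1 ?normr0. Qed.
Let Ie : Rintegrable leb e.
Proof. exact: integrable_indic_itv. Qed.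

Lemma conv_step_bounded t : `|conv e f t| <= \int[leb]_s `|f s|.
Proof.
have I1 : Rintegrable leb (fun s => e (t - s) * f s).
  apply: (le_Rintegrable _ _ (Rintegrable_norm If)); first exact: measurable_conv_integrand.
  by move=> s; rewrite normrM ler_piMl.
apply: (le_trans (le_normr_Rintegral _ I1)) => //.
apply: le_RintegralT; [exact: Rintegrable_norm|exact: Rintegrable_norm|].
by move=> s; rewrite normrM ler_piMl.
Qed.

(* Substituting [r = 1 - e * f] in the resolvent equation shows that both sides
   have the same primitive. *)
Lemma resolvent_density_eq (r : R -> R) :
  (forall t, 0 <= t <= T -> r t = 1 - conv e f t) ->
  (forall t, ~~ (0 <= t <= T) -> r t = 0) ->
  (forall t, 0 <= t <= T -> r t + lambda * conv k r t = 1) ->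
  {ae leb, forall s, s <= T -> f s = lambda * k s - lambda * conv f k s}.
Proof.
move=> rE r0 rV.
have Ifk := Rintegrable_conv If Ik.
pose G s := f s - (lambda * k s - lambda * conv f k s).
have IG : Rintegrable leb G.
  by apply: RintegrableB => //; apply: RintegrableB; exact: RintegrableZ.
have Iestep g t : Rintegrable leb g -> Rintegrable leb (fun s => e (t - s) * g s).
  move=> Ig; apply: (le_Rintegrable _ _ (Rintegrable_norm Ig)).
    by apply: measurable_conv_integrand => //; exact: Rintegrable_measurable Ig.
  by move=> s; rewrite normrM ler_piMl.
have key t : 0 <= t <= T -> conv e G t = 0.
  move=> tT.
  have -> : conv e G t = conv e f t - (lambda * conv e k t - lambda * conv e (conv f k) t).
    rewrite -!RintegralTZ; try exact: Iestep.
    rewrite -!RintegralTB; try by (try apply: RintegrableB); try apply: RintegrableZ; exact: Iestep.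
    by apply: eq_Rintegral => s _; rewrite /G; ring.
  have -> : conv e (conv f k) t = conv k (conv e f) t.
    rewrite convA//; last exact: conv3_integrable_bounded2.
    rewrite convC//; apply: Rintegrable_convC.
    apply: (Rintegrable_bounded_conv (C := \int[leb]_s `|f s|)) => //.
      exact: measurable_conv.
    by move=> x _; exact: conv_step_bounded.
  have -> : conv e k t = conv k e t by rewrite convC//; exact: Iestep.
  have Ike : Rintegrable leb (fun s => k (t - s) * e s).
    exact: (Rintegrable_bounded_conv (C := 1)).
  have Ikef : Rintegrable leb (fun s => k (t - s) * conv e f s).
    apply: (Rintegrable_bounded_conv (C := \int[leb]_s `|f s|)) => //.
      exact: measurable_conv.
    by move=> x _; exact: conv_step_bounded.
  have kr : conv k r t = conv k e t - conv k (conv e f) t.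
    rewrite -RintegralTB//; apply: eq_Rintegral => s _.
    rewrite -mulrBr; have [kt|kt] := eqVneq (k (t - s)) 0; first by rewrite kt !mul0r.
    congr (_ * _); have [s0|s0] := ltP s 0.
      by rewrite r0 ?negb_and -?ltNge ?s0// e_lt0// conv_lt0 ?subrr.
    have st : s <= t by rewrite leNgt; apply/negP => ts; move: kt; rewrite k_lt0 ?eqxx//; lra.
    have sT : 0 <= s <= T by rewrite s0 (le_trans st)//; case/andP: tT.
    by rewrite rE// e_in.
  by have := rV t tT; rewrite (rE t tT) kr; lra.
have G_lt0 s : s < 0 -> G s = 0.
  by move=> s0; rewrite /G f_lt0// k_lt0// conv_lt0// !mulr0 !subr0.
have := @ae_eq0_primitive R (G \_ `[0, T]).
have /[swap] /[apply] : Rintegrable leb (G \_ `[0, T]).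
  by apply: Rintegrable_patch => //; exact: RintegrableS.
have prim t : t <= T -> \int[leb]_(s in `]-oo, t]) (G \_ `[0, T]) s = 0.
  move=> tT; have [t0|t0] := ltP t 0.
    rewrite /Rintegral (eq_integral (cst 0%E)) ?integral0// => s.
    rewrite inE/= in_itv/= => st; rewrite patchE memNset//= in_itv/= leNgt.
    by rewrite (le_lt_trans st).
  rewrite -[RHS](key t) ?t0// Rintegral_mkcond; apply: eq_Rintegral => s _.
  rewrite !patchE; have [s0|s0] := ltP s 0.
    rewrite (G_lt0 s s0) mulr0; case: ifP => // _; case: ifP => //.
  have [st|st] := leP s t.
    rewrite mem_set/= ?in_itv//= mem_set/= ?in_itv/= ?s0 ?(le_trans st)//.
    by rewrite e_in ?mul1r// subr_ge0 st/=; lra.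
  rewrite memNset/= ?in_itv/=; last by apply/negP; rewrite -ltNge.
  by rewrite e_lt0 ?mul0r// subr_lt0.
move=> H; have {}H : {ae leb, forall s, (G \_ `[0, T]) s = 0}.
  apply: H => t; have [tT|tT] := leP t T; first exact: prim.
  rewrite -[RHS](prim T)// Rintegral_mkcond [RHS]Rintegral_mkcond.
  apply: eq_Rintegral => s _; rewrite !patchE.
  have [sT|sT] := leP s T.
    have -> : s \in `]-oo, t]%classic by rewrite inE/= in_itv/= (le_trans sT)// ltW.
    by have -> : s \in `]-oo, T]%classic by rewrite inE/= in_itv.
  have -> : s \in `[0, T]%classic = false.
    by rewrite memNset//= in_itv/= [s <= T]leNgt sT andbF.
  by rewrite !if_same.
apply: filterS H; first exact: (ae_filter_ringOfSetsType leb).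
move=> s Gs sT; apply/eqP; rewrite -subr_eq0; apply/eqP.
rewrite -/(G s); have [s0|s0] := ltP s 0; first exact: G_lt0.
by rewrite -Gs patchE mem_set//= in_itv/= s0.
Qed.

(** Confined to [s <= T]: beyond [T] the truncated [f] and [k] vanish while their convolution need
    not. *)
Hypothesis resE :
  {ae leb, forall s, s <= T -> f s = lambda * k s - lambda * conv f k s}.

(** The bound is uniform in [s] so that [|f| * (|k| * |g|)] is finite for a merely integrable [f].
    It is imposed on [k * g] rather than on [g], since a source such as
    [f (T - u) * varsigma u ^+ 2] is not known beforehand to be integrable. *)
Definition conv_bounded g (C : R) := forall s, 0 <= s <= T ->
  Rintegrable leb (fun u => k (s - u) * g u) /\
  \int[leb]_u `|k (s - u) * g u| <= C.

Lemma conv_boundedD (g h : R -> R) C1 C2 : measurable_fun [set: R] g ->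
  measurable_fun [set: R] h -> conv_bounded g C1 -> conv_bounded h C2 ->
  conv_bounded (fun u => g u + h u) (C1 + C2).
Proof.
move=> mg mh kg kh s sT; have [I1 B1] := kg s sT; have [I2 B2] := kh s sT.
have e1 u : k (s - u) * (g u + h u) = k (s - u) * g u + k (s - u) * h u by rewrite mulrDr.
split; first by under [X in Rintegrable _ X]eq_fun do rewrite e1; exact: RintegrableD.
apply: le_trans (lerD B1 B2).
rewrite -RintegralTD; try exact: Rintegrable_norm.
apply: le_RintegralT.
- by apply: Rintegrable_norm; under [X in Rintegrable _ X]eq_fun do rewrite e1; exact: RintegrableD.
- by apply: RintegrableD; exact: Rintegrable_norm.
- by move=> u; rewrite e1 ler_normD.
Qed.

Lemma conv_boundedZ c (g : R -> R) C : conv_bounded g C ->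
  conv_bounded (fun u => c * g u) (`|c| * C).
Proof.
move=> kg s sT; have [I1 B1] := kg s sT.
have e1 u : k (s - u) * (c * g u) = c * (k (s - u) * g u) by rewrite mulrCA.
split; first by under [X in Rintegrable _ X]eq_fun do rewrite e1; exact: RintegrableZ.
under eq_Rintegral do rewrite e1 normrM.
by rewrite RintegralTZ; [exact: ler_wpM2l|exact: Rintegrable_norm].
Qed.

(** Associativity gives [(f * k) * g], and [resE], reflected at [T], replaces [lambda (f * k)] by
    [lambda k - f]. Integrability of [f (T - u) * g u] is a conclusion, read off from the two other
    terms. *)
Lemma conv_density_resolvent (g : R -> R) C : measurable_fun [set: R] g ->
  (forall x, x < 0 -> g x = 0) -> conv_bounded g C ->
  [/\ Rintegrable leb (fun u => f (T - u) * g u),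
      Rintegrable leb (fun s => f (T - s) * conv k g s) &
      lambda * conv f (conv k g) T = lambda * conv k g T - conv f g T].
Proof.
move=> mg g0 kg.
have fT s : f (T - s) != 0 -> 0 <= s <= T.
  by apply: contra_neqT => sT; apply: suppf; rewrite subr_ge0 gerBl andbC.
have I3 : conv3_integrable f k g T.
  by apply: (conv3_integrable_bounded (C := C)) => // s /fT; exact: kg.
have I1 : Rintegrable leb (fun s => f (T - s) * conv k g s).
  apply: (Rintegrable_bounded_conv (C := C)) => //; first exact: measurable_conv.
  move=> s /fT sT; have [Ikg kgC] := kg s sT.
  exact: le_trans (le_normr_Rintegral measurableT Ikg) kgC.
have [Ikg _] : Rintegrable leb (fun u => k (T - u) * g u) /\
    \int[leb]_u `|k (T - u) * g u| <= C by apply: kg; rewrite T0 lexx.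
have mfk := measurable_conv mf mk.
have I2 : Rintegrable leb (fun u => conv f k (T - u) * g u).
  apply: ae_eq_Rintegrable (Rintegrable_fubini2 I3).
    exact: measurable_conv_integrand.
  by have := Rintegrable_ae2 I3; apply: filterS => u /= Iu; rewrite conv3_inner.
have ae : {ae leb, forall u, lambda * (k (T - u) * g u) -
    lambda * (conv f k (T - u) * g u) = f (T - u) * g u}.
  have := ae_subr T resE; apply: filterS; first exact: (ae_filter_ringOfSetsType leb). move=> u /= H.
  have [u0|u0] := ltP u 0; first by rewrite g0// !mulr0 subrr.
  by rewrite H; [ring|lra].
have I4 : Rintegrable leb (fun u => lambda * (k (T - u) * g u) -
    lambda * (conv f k (T - u) * g u)).
  by apply: RintegrableB; exact: RintegrableZ.
have mfg : measurable_fun [set: R] (fun u => f (T - u) * g u).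
  exact: measurable_conv_integrand.
split => //; first exact: ae_eq_Rintegrable ae I4.
rewrite convA// -[conv f g T]/(\int[leb]_u (f (T - u) * g u)).
rewrite -(ae_eq_Rintegral (Rintegrable_measurable I4) mfg ae).
rewrite RintegralTB ?RintegralTZ//; try exact: RintegrableZ.
by rewrite subKr.
Qed.

(** By [resE], [|f|] is at most [|lambda| (|k| + |f| * |k|)]; the first term contributes [C], and
    Tonelli bounds the second by [C] times the integral of [|f|]. This makes the source of the last
    moment equation admissible. *)
Lemma conv_density_norm_le (g : R -> R) C : measurable_fun [set: R] g ->
  (forall x, x < 0 -> g x = 0) -> conv_bounded g C ->
  \int[leb]_u `|f (T - u) * g u| <= `|lambda| * (C + C * \int[leb]_s `|f s|).
Proof.
move=> mg g0 kg; have [Ifg _ _] := conv_density_resolvent mg g0 kg.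
have fT s : f (T - s) != 0 -> 0 <= s <= T.
  by apply: contra_neqT => sT; apply: suppf; rewrite subr_ge0 gerBl andbC.
have I3 : conv3_integrable f k g T.
  by apply: (conv3_integrable_bounded (C := C)) => // s /fT; exact: kg.
have [Ikg kgC] : Rintegrable leb (fun u => k (T - u) * g u) /\
    \int[leb]_u `|k (T - u) * g u| <= C by apply: kg; rewrite T0 lexx.
have I3' := Rintegrable_norm I3.
have IF := Rintegrable_fubini2 I3'.
have Ikg' := Rintegrable_norm Ikg.
pose B u := `|lambda| * (`|k (T - u) * g u| +
  \int[leb]_s `|f (T - s) * (k (s - u) * g u)|).
have IB : Rintegrable leb B by apply: RintegrableZ; exact: RintegrableD.
have Inf' := Rintegrable_norm If.
apply: (@le_trans _ _ (\int[leb]_u B u)).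
  have Ifg' := Rintegrable_norm Ifg.
  have ae : {ae leb, forall u, `|f (T - u) * g u| <= B u}.
    have ae1 := ae_subr T resE; have ae2 := Rintegrable_ae2 I3.
    move: ae1 ae2; apply: filterS2; first exact: (ae_filter_ringOfSetsType leb).
    move=> u /= H Iu.
    have [u0|u0] := ltP u 0.
      rewrite g0// mulr0 normr0 mulr_ge0// addr_ge0//.
      by apply: Rintegral_ge0.
    have -> : f (T - u) * g u = lambda * (k (T - u) * g u -
        \int[leb]_s (f (T - s) * (k (s - u) * g u))).
      by rewrite conv3_inner// H; [ring|lra].
    rewrite normrM ler_wpM2l//; apply: (le_trans (ler_normB _ _)).
    by rewrite lerD2l; apply: le_normr_Rintegral.
  rewrite -lee_fin -(Rintegral_EFin Ifg') -(Rintegral_EFin IB).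
  apply: ae_ge0_le_integral => //.
  - exact: (measurable_int leb).
  - move=> u _; rewrite lee_fin mulr_ge0// addr_ge0//.
    by apply: Rintegral_ge0.
  - exact: (measurable_int leb).
  - move: ae; apply: filterS; first exact: (ae_filter_ringOfSetsType leb).
    by move=> u h _; rewrite lee_fin.
rewrite /B RintegralTZ; last exact: RintegrableD.
rewrite ler_wpM2l// RintegralTD// lerD// -(Rfubini I3')/=.
rewrite -(Rintegral_subr T Inf') -RintegralTZ; last exact: (Rintegrable_subr T Inf').
apply: le_RintegralT; [exact: (Rintegrable_fubini1 I3')| |].
  by apply: RintegrableZ; exact: (Rintegrable_subr T Inf').
move=> s /=; have [fs|fs] := eqVneq (f (T - s)) 0.
  rewrite fs normr0 mulr0 /Rintegral; under eq_integral do rewrite mul0r normr0.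
  by rewrite integral0.
have [Iks ksC] := kg s (fT s fs).
under eq_Rintegral do rewrite normrM.
by rewrite RintegralTZ 1?mulrC ?ler_wpM2r//; exact: Rintegrable_norm.
Qed.

Lemma conv_bounded_bounded (h : R -> R) M : measurable_fun [set: R] h ->
  (forall x, x < 0 -> h x = 0) -> (forall x, 0 <= x <= T -> `|h x| <= M) ->
  conv_bounded h (M * \int[leb]_u `|k u|).
Proof.
move=> mh h0 hM s /andP[s0 sT].
have M0 : 0 <= M by apply: le_trans (hM T _); rewrite ?T0 ?lexx.
have kh x : k (s - x) != 0 -> `|h x| <= M.
  have [x0|x0] := ltP x 0; first by rewrite h0// normr0.
  move=> ks; apply: hM; rewrite x0/=; rewrite leNgt; apply/negP => Tx.
  by move: ks; rewrite k_lt0 ?eqxx//; lra.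
have Ikh : Rintegrable leb (fun u => k (s - u) * h u).
  exact: (Rintegrable_bounded_conv (C := M)).
split => //; have Iks := Rintegrable_subr s (Rintegrable_norm Ik).
rewrite -(Rintegral_subr s (Rintegrable_norm Ik)) -RintegralTZ//.
apply: le_RintegralT; [exact: Rintegrable_norm|exact: RintegrableZ|].
move=> u; rewrite normrM mulrC; have [->|ku] := eqVneq (k (s - u)) 0.
  by rewrite normr0 !mulr0.
by rewrite ler_wpM2r// kh.
Qed.

(* Convolve the equation with [f]: as [f * (k * g) = k * g - (f * g) / lambda], the
   terms [k * _] cancel against the equation at time [T]. *)
Lemma volterra_solve (h nu w : R -> R) a M C1 C2 :
  measurable_fun [set: R] h -> (forall x, x < 0 -> h x = 0) ->
  (forall x, 0 <= x <= T -> `|h x| <= M) ->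
  measurable_fun [set: R] nu -> (forall x, x < 0 -> nu x = 0) ->
  conv_bounded nu C1 ->
  measurable_fun [set: R] w -> (forall x, x < 0 -> w x = 0) ->
  conv_bounded w C2 ->
  (forall s, 0 <= s <= T ->
    h s + lambda * conv k h s = a * (1 - lambda * conv k w s) + conv k nu s) ->
  [/\ Rintegrable leb (fun u => f (T - u) * nu u),
      Rintegrable leb (fun u => f (T - u) * w u) &
  h T = a * (1 - \int[leb]_s f s - conv f w T) + conv f nu T / lambda].
Proof.
move=> mh h0 hM mnu nu0 nuC mw w0 wC E.
have hC := conv_bounded_bounded mh h0 hM.
have [I1 J1 D1] := conv_density_resolvent mh h0 hC.
have [I2 J2 D2] := conv_density_resolvent mnu nu0 nuC.
have [I3 J3 D3] := conv_density_resolvent mw w0 wC.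
split => //.
have TT : 0 <= T <= T by rewrite T0 lexx.
have Ife : Rintegrable leb (fun s => f (T - s)) by exact: Rintegrable_subr.
(* The equation is only known on [[0, T]], but [f (T - s)] vanishes for all other [s]. *)
have key : conv f h T + lambda * conv f (conv k h) T =
    a * (\int[leb]_s f s - lambda * conv f (conv k w) T) + conv f (conv k nu) T.
  rewrite -!RintegralTZ//.
  have -> : \int[leb]_s f s = \int[leb]_s f (T - s) by rewrite Rintegral_subr.
  rewrite -RintegralTB//; last exact: RintegrableZ.
  have IB : Rintegrable leb (fun x => f (T - x) - lambda * (f (T - x) * conv k w x)).
    by apply: RintegrableB => //; exact: RintegrableZ.
  rewrite -RintegralTZ// -!RintegralTD//; try exact: RintegrableZ.
  apply: eq_Rintegral => s _.
  have [fs|fs] := eqVneq (f (T - s)) 0; first by rewrite fs; ring.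
  have sT : 0 <= s <= T.
    by move: fs; apply: contra_neqT => sT; apply: suppf; rewrite subr_ge0 gerBl andbC.
  have -> : h s = a * (1 - lambda * conv k w s) + conv k nu s - lambda * conv k h s.
    by rewrite -E// addrK.
  by ring.
have D2' : conv f (conv k nu) T = conv k nu T - conv f nu T / lambda.
  by apply: (mulfI l0); rewrite D2; field.
move: key; rewrite D1 D3 D2' => key.
have -> : h T = a * (1 - lambda * conv k w T) + conv k nu T - lambda * conv k h T.
  by rewrite -E// addrK.
have -> : lambda * conv k h T = a * (\int[leb]_s f s -
    (lambda * conv k w T - conv f w T)) + (conv k nu T - conv f nu T / lambda).
  by rewrite -key; ring.
by ring.
Qed.

End volterra.

Section truncation.
Context {R : realType}.
Local Notation leb := (@lebesgue_measure R).
Implicit Types (f g h : R -> R) (T s t : R).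

Lemma patch_itv_out f T x : ~~ (0 <= x <= T) -> (f \_ `[0, T]) x = 0.
Proof. by move=> xT; rewrite patchE memNset//= in_itv; exact/negP. Qed.

Lemma patch_itv_in f T x : 0 <= x <= T -> (f \_ `[0, T]) x = f x.
Proof. by move=> xT; rewrite patchE mem_set//= in_itv. Qed.

Lemma patch_itv_lt0 f T x : x < 0 -> (f \_ `[0, T]) x = 0.
Proof. by move=> x0; apply: patch_itv_out; rewrite negb_and -ltNge x0. Qed.

(** Cutting both factors at 0 encodes the domain: [u] and [s - u] are both nonnegative exactly for
    [u] in [[0, s]], and then neither exceeds [T]. *)
Lemma convol_integrandE g h T s : 0 <= s <= T ->
  (fun u => g (s - u) * h u) \_ `[0, s] =
  (fun u => (g \_ `[0, T]) (s - u) * (h \_ `[0, T]) u).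
Proof.
move=> sT; apply/funext => u; have [us|us] := boolP (0 <= u <= s).
  by rewrite !patch_itv_in//; lra.
rewrite patch_itv_out//.
have [u0|u0] := ltP u 0; first by rewrite [X in _ = _ * X]patch_itv_lt0 ?mulr0.
rewrite [X in _ = X * _]patch_itv_lt0 ?mul0r//.
by move: us; rewrite u0/= -ltNge subr_lt0.
Qed.

Lemma convolE g h T s : 0 <= s <= T ->
  convol g h s = conv (g \_ `[0, T]) (h \_ `[0, T]) s.
Proof. by move=> sT; rewrite /convol Rintegral_mkcond (convol_integrandE _ _ sT). Qed.

Lemma integrable_convolE g h T s : 0 <= s <= T ->
  leb.-integrable `[0, s] (fun u => (g (s - u) * h u)%:E) <->
  Rintegrable leb (fun u => (g \_ `[0, T]) (s - u) * (h \_ `[0, T]) u).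
Proof.
move=> sT; rewrite -(convol_integrandE _ _ sT).
by apply: (@Rintegrable_mkcond _ _ _ leb `[0, s] (fun u => g (s - u) * h u)).
Qed.

Lemma measurable_patch_itv f T : measurable_fun (`[0, T] : set R) f ->
  measurable_fun [set: R] (f \_ `[0, T]).
Proof. by move=> mf; apply/(measurable_restrictT _ _).1. Qed.

Lemma Rintegrable_patch_sqr f T : measurable_fun (`[0, T] : set R) f ->
  leb.-integrable `[0, T] (fun t => (f t ^+ 2)%:E) ->
  Rintegrable leb (fun x => (f \_ `[0, T]) x ^+ 2).
Proof.
move=> mf /(@Rintegrable_patch _ _ _ leb `[0, T] (fun t => f t ^+ 2)).
move=> /(_ (measurable_itv _)); congr (Rintegrable _ _).
by apply/funext => x; rewrite !patchE; case: ifP => //; rewrite expr0n.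
Qed.

(** On a bounded interval [|f| <= 1 + f^2] is an integrable majorant. *)
Lemma Rintegrable_patch_L1 f T : measurable_fun (`[0, T] : set R) f ->
  leb.-integrable `[0, T] (fun t => (f t ^+ 2)%:E) ->
  Rintegrable leb (f \_ `[0, T]).
Proof.
move=> mf /(Rintegrable_patch_sqr mf) If2.
have Ie : Rintegrable leb (\1_(`[0, T]) : R -> R) by exact: integrable_indic_itv.
apply: (le_Rintegrable _ _ (RintegrableD Ie If2)); first exact: measurable_patch_itv.
move=> x; rewrite !patchE indicE; case: ifP => _ /=.
  rewrite -(real_normK (num_real (f x))); have := normr_ge0 (f x); nra.
by rewrite normr0 add0r sqr_ge0.
Qed.

Lemma loc_square_integrable_patch f T : 0 < T -> loc_square_integrable f ->
  [/\ measurable_fun (`[0, T] : set R) f,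
      Rintegrable leb (f \_ `[0, T]) &
      Rintegrable leb (fun x => (f \_ `[0, T]) x ^+ 2)].
Proof.
move=> T0 [mf If].
have mfT : measurable_fun (`[0, T] : set R) f.
  apply: measurable_funS mf => //.
  by move=> x /=; rewrite !in_itv/= andbT => /andP[].
by split => //; [apply: Rintegrable_patch_L1 => //; exact: If|
  apply: Rintegrable_patch_sqr => //; exact: If].
Qed.

End truncation.

(** * The resolvent and its density on a finite horizon *)

Section resolvent.
Context {R : realType}.
Local Notation leb := (@lebesgue_measure R).
Variables (K Rl : R -> R) (lambda : R).
Hypotheses (l0 : lambda != 0).
Hypotheses (hK : kernel_assumption K) (hR : resolvent_assumption K lambda Rl).
Local Notation f := (resolvent_density Rl).

(** The value of the density at 0 carries no information, but a single point affects neither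
    measurability nor integrals, so the closed interval can be used. *)
Lemma resolvent_density_patch T : 0 < T ->
  [/\ measurable_fun (`[0, T] : set R) f,
      Rintegrable leb (f \_ `[0, T]) &
      Rintegrable leb (fun x => (f \_ `[0, T]) x ^+ 2)].
Proof.
move=> T0; have [mf If] := resolvent_density_L2 hR.
have mf' : measurable_fun (`[0, +oo[ : set R) f.
  by apply/measurable_fun_itv_obnd_cbndP.
have mfT : measurable_fun (`[0, T] : set R) f.
  apply: measurable_funS mf' => //.
  by move=> x /=; rewrite !in_itv/= andbT => /andP[].
have If2 : leb.-integrable `[0, T] (fun t => (f t ^+ 2)%:E).
  suff : leb.-integrable `]0, T] (fun t => (f t ^+ 2)%:E).
    have mfo : measurable_fun (`]0, T] : set R) (fun t => (f t ^+ 2)%:E).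
      apply/measurable_EFinP; apply: measurable_funX.
      apply: measurable_funS mfT => //.
      by move=> x /=; rewrite !in_itv/= => /andP[/ltW-> ->].
    move=> /integrableP[_ Ioo]; apply/integrableP; split.
      by apply/measurable_EFinP; exact: measurable_funX.
    by rewrite -integral_itv_obnd_cbnd//; exact: measurableT_comp.
  apply: integrableS If => //.
  by move=> x /=; rewrite !in_itv/= andbT => /andP[].
by split => //; [apply: Rintegrable_patch_L1|apply: Rintegrable_patch_sqr].
Qed.

(** Differentiability holds on []0, +oo[], so [derivable_FTC] gives the formula with an unknown
    constant [c] in place of 1. The resolvent equation near 0 identifies it: [Rl] is bounded and [K]
    integrable, hence [K * Rl] tends to 0. *)
Lemma resolvent_primitive T : 0 < T -> forall t, 0 <= t <= T ->
  Rl t = 1 - \int[leb]_(s in `]0, t]) (f \_ `[0, T]) s.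
Proof.
move=> T0; have [mf If If2] := resolvent_density_patch T0.
have [mK IK IK2] := loc_square_integrable_patch T0 (kernel_L2loc hK).
have Inf : Rintegrable leb (fun x => -1 * (f \_ `[0, T]) x) by exact: RintegrableZ.
have FTC a b : 0 < a -> a <= b -> b <= T ->
    Rl b - Rl a = - \int[leb]_(s in `]a, b]) (f \_ `[0, T]) s.
  move=> a0 ab bT.
  transitivity (\int[leb]_(s in `]a, b]) (-1 * (f \_ `[0, T]) s)); last first.
    by rewrite RintegralZl//; [rewrite mulN1r|exact: RintegrableS].
  apply: derivable_FTC => //.
  move=> x /andP[ax xb]; have x0 := lt_le_trans a0 ax.
  rewrite patch_itv_in ?(ltW x0) ?(le_trans xb)// mulN1r /resolvent_density opprK.
  by split; [exact: (resolvent_derivable hR)|rewrite derive1E].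
pose c := Rl T + \int[leb]_(s in `]0, T]) (f \_ `[0, T]) s.
have Rc t : 0 < t -> t <= T -> Rl t = c - \int[leb]_(s in `]0, t]) (f \_ `[0, T]) s.
  move=> t0 tT; have := FTC t T t0 tT (lexx T).
  by rewrite /c (Rintegral_itvD If (ltW t0) tT); lra.
pose M := `|c| + \int[leb]_s `|(f \_ `[0, T]) s| + 1.
have Inf' := Rintegrable_norm If.
have I0 : 0 <= \int[leb]_s `|(f \_ `[0, T]) s| by apply: Rintegral_ge0.
have RM t : 0 <= t <= T -> `|Rl t| <= M.
  move=> /andP[t0 tT]; have [{}t0|t0'] := ltP 0 t; last first.
    have -> : t = 0 by apply/eqP; rewrite eq_le t0 t0'.
    by rewrite (resolvent0 hR) normr1 /M lerDr addr_ge0.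
  rewrite Rc//; apply: (le_trans (ler_normB _ _)); rewrite /M -addrA lerD2l.
  apply: (@le_trans _ _ (\int[leb]_s `|(f \_ `[0, T]) s|)); last by rewrite lerDl.
  apply: (le_trans (le_normr_Rintegral _ _)) => //; first exact: RintegrableS.
  rewrite Rintegral_mkcond; apply: le_RintegralT => //.
    by apply: Rintegrable_patch => //; exact: RintegrableS.
  by move=> x; rewrite patchE; case: ifP => // _; exact: normr_ge0.
have c1 : c = 1.
  apply/eqP; rewrite -subr_eq0 -normr_le0; apply/ler_addgt0Pl => eps eps0.
  rewrite addr0.
  have Iw : Rintegrable leb (fun x => `|(K \_ `[0, T]) x| + `|(f \_ `[0, T]) x|).
    by apply: RintegrableD; exact: Rintegrable_norm.
  (* With [J] the integral of [|K| + |f|] over [[0, t]], the resolvent equation at [t] bounds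
     [|c - 1|] by [J + |lambda| * M * J = C * J]; [t] is small enough for [J < eps / C]. *)
  pose C := `|lambda| * M + 1.
  have C0 : 0 < C by rewrite ltr_wpDl// mulr_ge0// !addr_ge0.
  have [d [d0 Hd]] := integral_normr_continuous Iw (divr_gt0 eps0 C0).
  pose t := Num.min T (d / 2).
  have t0 : 0 < t by rewrite lt_min T0 divr_gt0.
  have tT : t <= T by rewrite ge_min lexx.
  have td : t < d by rewrite gt_min; apply/orP; right; lra.
  have lebd : (leb (`[0%R, t] : set R) < d%:E)%E.
    by rewrite lebesgue_measure_itv/= lte_fin t0 -EFinB subr0 lte_fin.
  have := Hd _ (measurable_itv _) lebd.
  set J := (X in X < _) => Jlt.
  have ttT : 0 <= t <= t by rewrite (ltW t0) lexx.
  have [_] := resolventP hR (ltW t0); rewrite (convolE _ _ ttT) => RVt.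
  have JK : \int[leb]_s `|(K \_ `[0, t]) s| <= J.
    rewrite /J [leRHS]Rintegral_mkcond; apply: le_RintegralT.
    - apply: Rintegrable_norm.
      by have [] := loc_square_integrable_patch t0 (kernel_L2loc hK).
    - apply: Rintegrable_patch; first exact: measurable_itv.
      by apply: RintegrableS => //; exact: Rintegrable_norm.
    - move=> x; have [xt|xt] := boolP (0 <= x <= t).
        rewrite !patch_itv_in//; [|by lra|by lra].
        by rewrite [leRHS]ger0_norm ?addr_ge0// lerDl.
      by rewrite !patch_itv_out// normr0.
  have Jf : `|\int[leb]_(s in `]0, t]) (f \_ `[0, T]) s| <= J.
    apply: (le_trans (le_normr_Rintegral _ _)) => //; first exact: RintegrableS.
    rewrite /J [leLHS]Rintegral_mkcond [leRHS]Rintegral_mkcond; apply: le_RintegralT.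
    - by apply: Rintegrable_patch => //; exact: RintegrableS.
    - apply: Rintegrable_patch; first exact: measurable_itv.
      by apply: RintegrableS => //; exact: Rintegrable_norm.
    - move=> x; rewrite [leLHS]patchE [leRHS]patchE.
      have [|] := boolP (x \in `]0, t]%classic); rewrite ?inE/= ?in_itv/=.
        move=> /andP[x0 xt]; rewrite mem_set/=; last by rewrite in_itv/= xt ltW.
        by rewrite [leRHS]ger0_norm ?addr_ge0// lerDr.
      by move=> _; case: ifP => _ //; exact: normr_ge0.
  have It : Rintegrable leb (fun u => (K \_ `[0, t]) (t - u) * (Rl \_ `[0, t]) u).
    by apply/(integrable_convolE _ _ ttT); have [] := resolventP hR (ltW t0).
  have [mKt IKt _] := loc_square_integrable_patch t0 (kernel_L2loc hK).
  have Bc : `|conv (K \_ `[0, t]) (Rl \_ `[0, t]) t| <= M * J.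
    apply: (le_trans (le_normr_Rintegral _ It)) => //.
    apply: (@le_trans _ _ (M * \int[leb]_s `|(K \_ `[0, t]) s|)); last first.
      by rewrite ler_wpM2l// !addr_ge0.
    have IKt' := Rintegrable_norm IKt.
    rewrite -(Rintegral_subr t IKt') -RintegralTZ; last exact: (Rintegrable_subr t IKt').
    apply: le_RintegralT; [exact: Rintegrable_norm| |].
      by apply: RintegrableZ; exact: (Rintegrable_subr t IKt').
    move=> u; rewrite normrM mulrC ler_wpM2r//.
    have [ut|ut] := boolP (0 <= u <= t); first by rewrite patch_itv_in// RM//; lra.
    by rewrite patch_itv_out// normr0 !addr_ge0.
  have -> : c - 1 = \int[leb]_(s in `]0, t]) (f \_ `[0, T]) s -
      lambda * conv (K \_ `[0, t]) (Rl \_ `[0, t]) t.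
    by have := Rc t t0 tT; move: RVt; lra.
  apply: (le_trans (ler_normB _ _)); rewrite normrM.
  have J0 : 0 <= J by apply: Rintegral_ge0.
  apply: (@le_trans _ _ (C * J)); last first.
    by rewrite mulrC -ler_pdivlMr// ltW.
  rewrite /C mulrDl mul1r addrC lerD// -mulrA ler_wpM2l//.
move=> t /andP[t0 tT]; have [{}t0|t0'] := ltP 0 t; first by rewrite Rc// c1.
have -> : t = 0 by apply/eqP; rewrite eq_le t0 t0'.
by rewrite (resolvent0 hR) set_itvoc0 Rintegral_set0 subr0.
Qed.

Lemma resolvent_density_ae T : 0 < T ->
  {ae leb, forall s, s <= T -> (f \_ `[0, T]) s =
    lambda * (K \_ `[0, T]) s - lambda * conv (f \_ `[0, T]) (K \_ `[0, T]) s}.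
Proof.
move=> T0; have [mf If _] := resolvent_density_patch T0.
have [mK IK _] := loc_square_integrable_patch T0 (kernel_L2loc hK).
apply: (@resolvent_density_eq R T lambda (K \_ `[0, T]) (f \_ `[0, T]) IK If
  (patch_itv_out K (T := T)) (patch_itv_out f (T := T)) (Rl \_ `[0, T])).
- move=> t tT; rewrite patch_itv_in// (resolvent_primitive T0)//; congr (_ - _).
  rewrite Rintegral_itv_obnd_cbnd; last first.
    exact: RintegrableS.
  rewrite Rintegral_mkcond; apply: eq_Rintegral => s _; rewrite indicE.
  have [st|st] := boolP (0 <= s <= t).
    by rewrite patch_itv_in// mem_set/= ?mul1r// in_itv/=; lra.
  rewrite patch_itv_out//; have [s0|s0] := ltP s 0.
    by rewrite patch_itv_lt0// mulr0.
  by rewrite memNset ?mul0r//= in_itv/=; apply/negP; move: st; apply: contra; lra.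
- by move=> t; exact: patch_itv_out.
- move=> t tT; have [t0 _] := andP tT.
  by have [_] := resolventP hR t0; rewrite (convolE _ _ tT) patch_itv_in.
Qed.

(** This is [volterra_solve] with [w = mu / (lambda m0) - 1]. The [-1] in [w] cancels the integral
    of [f] in [1 - \int f - f * w], which leaves [1 - (f * mu) / (lambda m0)]. *)
Lemma volterra_equation_solution (T m0 a M C : R) (mu h nu : R -> R) :
  0 < T -> m0 != 0 -> loc_square_integrable mu ->
  measurable_fun (`[0, T] : set R) h ->
  (forall s, 0 <= s <= T -> `|h s| <= M) ->
  measurable_fun (`[0, T] : set R) nu ->
  (forall s, 0 <= s <= T ->
    leb.-integrable `[0, s] (fun u => (K (s - u) * nu u)%:E) /\
    \int[leb]_(u in `[0, s]) `|K (s - u) * nu u| <= C) ->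
  (forall s, 0 <= s <= T -> h s + lambda * convol K h s =
    a * volterra_phi K mu lambda m0 s + convol K nu s) ->
  leb.-integrable `[0, T] (fun u => (f (T - u) * nu u)%:E) /\
  h T = a * (1 - convol f mu T / (lambda * m0)) + convol f nu T / lambda.
Proof.
move=> T0 m00 hmu mh hM mnu nuC E.
have TT : 0 <= T <= T by rewrite (ltW T0) lexx.
have [mf If If2] := resolvent_density_patch T0.
have [mK IK IK2] := loc_square_integrable_patch T0 (kernel_L2loc hK).
have [mmu Imu Imu2] := loc_square_integrable_patch T0 hmu.
have mmu' := Rintegrable_measurable Imu.
have ok := patch_itv_out K (T := T); have of_ := patch_itv_out f (T := T).
pose e : R -> R := \1_(`[0, T]).
have me : measurable_fun [set: R] e by exact: measurable_indic.
have e0 x : x < 0 -> e x = 0 by move=> x0; rewrite /e indicE memNset//= in_itv/= leNgt x0.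
pose w := (fun s => mu s / (lambda * m0) - 1) \_ `[0, T].
have wE u : w u = (lambda * m0)^-1 * (mu \_ `[0, T]) u + (-1) * e u.
  rewrite /w /e indicE; have [uT|uT] := boolP (0 <= u <= T).
    by rewrite !patch_itv_in// mem_set/= ?in_itv// mulr1 mulrC.
  by rewrite !patch_itv_out// memNset/= ?in_itv/= ?mulr0 ?addr0//; exact/negP.
have kmu : conv_bounded T (K \_ `[0, T]) (mu \_ `[0, T])
    (\int[leb]_x ((K \_ `[0, T]) x ^+ 2) + \int[leb]_x ((mu \_ `[0, T]) x ^+ 2)).
  move=> s sT; have IKs2 := Rintegrable_subr s IK2.
  have IKm : Rintegrable leb (fun u => (K \_ `[0, T]) (s - u) * (mu \_ `[0, T]) u).
    apply: RintegrableM => //; apply: (measurableT_comp (Rintegrable_measurable IK)).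
    exact: measurable_subr.
  split => //; rewrite -(Rintegral_subr s IK2) -RintegralTD//.
  apply: le_RintegralT; [exact: Rintegrable_norm|exact: RintegrableD|].
  move=> u; rewrite normrM; set x := (K \_ _) _; set y := (mu \_ _) _.
  rewrite -(real_normK (num_real x)) -(real_normK (num_real y)).
  by have := normr_ge0 x; have := normr_ge0 y; nra.
have ke := conv_bounded_bounded (ltW T0) IK ok me e0 (M := 1).
have {}ke : conv_bounded T (K \_ `[0, T]) e (1 * \int[leb]_u `|(K \_ `[0, T]) u|).
  by apply: ke => x _; rewrite /e indicE; case: (_ \in _); rewrite ?normr1 ?normr0.
have mw : measurable_fun [set: R] w.
  by rewrite (funext wE); apply: measurable_funD; exact: measurable_funM.
pose cmu := `|(lambda * m0)^-1| * (\int[leb]_x ((K \_ `[0, T]) x ^+ 2) +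
  \int[leb]_x ((mu \_ `[0, T]) x ^+ 2)).
pose ce := `|-1 : R| * (1 * \int[leb]_u `|(K \_ `[0, T]) u|).
have kw : conv_bounded T (K \_ `[0, T]) w (cmu + ce).
  rewrite (funext wE); apply: conv_boundedD => //; try exact: measurable_funM.
  - exact: conv_boundedZ.
  - exact: conv_boundedZ.
have knu : conv_bounded T (K \_ `[0, T]) (nu \_ `[0, T]) C.
  move=> s sT; have [I1 B1] := nuC s sT; split; first exact/(integrable_convolE _ _ sT).
  apply: le_trans B1; rewrite [leRHS]Rintegral_mkcond; apply: eq_implies_le.
  apply: eq_Rintegral => u _; have /(congr1 (fun F => F u)) := convol_integrandE K nu sT.
  move=> <-; rewrite !patchE; case: ifP => // _; exact: normr0.
have hM' x : 0 <= x <= T -> `|(h \_ `[0, T]) x| <= M.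
  by move=> xT; rewrite patch_itv_in//; exact: hM.
have E' s : 0 <= s <= T -> (h \_ `[0, T]) s + lambda * conv (K \_ `[0, T]) (h \_ `[0, T]) s =
    a * (1 - lambda * conv (K \_ `[0, T]) w s) + conv (K \_ `[0, T]) (nu \_ `[0, T]) s.
  by move=> sT; have := E s sT; rewrite /volterra_phi !(convolE _ _ sT) patch_itv_in.
have [I1 _ EE] := volterra_solve (ltW T0) l0 IK If ok of_ (resolvent_density_ae T0)
  (measurable_patch_itv mh) (@patch_itv_lt0 R h T) hM'
  (measurable_patch_itv mnu) (@patch_itv_lt0 R nu T) knu mw (@patch_itv_lt0 R _ T) kw E'.
split; first exact/(integrable_convolE _ _ TT).
rewrite -[LHS](patch_itv_in h TT) EE !(convolE _ _ TT); congr (_ * _ + _).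
have Ifm : Rintegrable leb (fun u => (f \_ `[0, T]) (T - u) * (mu \_ `[0, T]) u).
  apply: RintegrableM => //; last exact: (Rintegrable_subr T If2).
  by apply: (measurableT_comp (Rintegrable_measurable If)); exact: measurable_subr.
have -> : conv (f \_ `[0, T]) w T = (lambda * m0)^-1 * conv (f \_ `[0, T]) (mu \_ `[0, T]) T
    - \int[leb]_s (f \_ `[0, T]) s.
  rewrite -(Rintegral_subr T If) -RintegralTZ// -RintegralTB; last 2 first.
  - exact: RintegrableZ.
  - exact: Rintegrable_subr.
  apply: eq_Rintegral => u _; rewrite wE /e indicE.
  have [uT|uT] := boolP (0 <= u <= T).
    by rewrite mem_set/= ?in_itv//=; ring.
  rewrite [(f \_ _) _]patch_itv_out; first by ring.
  by move: uT; apply: contra; rewrite subr_ge0 gerBl andbC.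
by field; rewrite l0 m00.
Qed.

(* For fixed [s], the function [u |-> K (s - u) * vs u ^+ 2] satisfies [conv_bounded]
   by the Cauchy-Schwarz inequality. *)
Lemma density_weight_bounded (T D : R) (vs : R -> R) : 0 < T ->
  loc_square_integrable vs ->
  (forall s, 0 <= s <= T ->
    Rintegrable leb (fun u => ((K \_ `[0, T]) (s - u) * (vs \_ `[0, T]) u) ^+ 2) /\
    \int[leb]_u ((K \_ `[0, T]) (s - u) * (vs \_ `[0, T]) u) ^+ 2 <= D) ->
  exists C, forall s, 0 <= s <= T ->
    leb.-integrable `[0, s] (fun u => (K (s - u) * (f (T - u) * vs u ^+ 2))%:E) /\
    \int[leb]_(u in `[0, s]) `|K (s - u) * (f (T - u) * vs u ^+ 2)| <= C.
Proof.
move=> T0 hvs hD.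
have [mf If If2] := resolvent_density_patch T0.
have [mK IK IK2] := loc_square_integrable_patch T0 (kernel_L2loc hK).
have [mvs Ivs Ivs2] := loc_square_integrable_patch T0 hvs.
have mk := Rintegrable_measurable IK; have mvs' := Rintegrable_measurable Ivs.
exists (`|lambda| * (D + D * \int[leb]_s `|(f \_ `[0, T]) s|)) => s sT.
have ok := patch_itv_out K (T := T); have of_ := patch_itv_out f (T := T).
pose kv t u := (K \_ `[0, T]) (t - u) * (vs \_ `[0, T]) u.
(* The kernel is moved into [c]: then [f (T - u) * c u] is the integrand to bound, while
   [k (t - u) * c u] splits into [kv t u * kv s u], two square integrable factors with energy at
   most [D]. *)
pose c u := (K \_ `[0, T]) (s - u) * ((vs \_ `[0, T]) u) ^+ 2.
have mc : measurable_fun [set: R] c.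
  by apply: measurable_conv_integrand => //; exact: measurable_funX.
have c0 x : x < 0 -> c x = 0 by move=> x0; rewrite /c [(vs \_ _) _]patch_itv_lt0// expr0n mulr0.
have mkv t : measurable_fun [set: R] (kv t) by exact: measurable_conv_integrand.
have kc : conv_bounded T (K \_ `[0, T]) c D.
  move=> t tT; have [It Dt] := hD t tT; have [Is Ds] := hD s sT.
  have e1 u : (K \_ `[0, T]) (t - u) * c u = kv t u * kv s u by rewrite /c /kv; ring.
  have Ikk : Rintegrable leb (fun u => kv t u * kv s u) by apply: RintegrableM; [exact: mkv|exact: mkv|exact: It|exact: Is].
  split; first by under [X in Rintegrable _ X]eq_fun do rewrite e1.
  under eq_Rintegral do rewrite e1.
  apply: (@le_trans _ _ (\int[leb]_u (2^-1 * (kv t u ^+ 2 + kv s u ^+ 2)))).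
    apply: le_RintegralT; [exact: Rintegrable_norm| |].
      by apply: RintegrableZ; exact: RintegrableD.
    move=> u; rewrite normrM -(real_normK (num_real (kv t u))).
    rewrite -(real_normK (num_real (kv s u))).
    by have := sqr_ge0 (`|kv t u| - `|kv s u|); nra.
  rewrite RintegralTZ; last exact: RintegrableD.
  by rewrite RintegralTD//; move: Dt Ds; rewrite /kv; lra.
have [I1 _ _] := conv_density_resolvent (ltW T0) IK If of_ (resolvent_density_ae T0) mc c0 kc.
have B1 := conv_density_norm_le (ltW T0) IK If of_ (resolvent_density_ae T0) mc c0 kc.
have e2 : (fun u => K (s - u) * (f (T - u) * vs u ^+ 2)) \_ `[0, s] =
    (fun u => (f \_ `[0, T]) (T - u) * c u).
  apply/funext => u; rewrite /c; have [us|us] := boolP (0 <= u <= s).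
    by rewrite !patch_itv_in//; [ring|lra..].
  rewrite [LHS]patch_itv_out//.
  have [u0|u0] := ltP u 0; first by rewrite [(vs \_ _) _]patch_itv_lt0// expr0n/= !mulr0.
  have su : s - u < 0 by move: us; rewrite u0/= -ltNge subr_lt0.
  by rewrite [(K \_ _) _]patch_itv_lt0// mul0r mulr0.
split.
  apply/(@Rintegrable_mkcond _ _ _ leb `[0, s] (fun u => K (s - u) * (f (T - u) * vs u ^+ 2))) => //.
  by rewrite e2.
apply: le_trans B1; rewrite Rintegral_mkcond; apply: eq_implies_le.
apply: eq_Rintegral => u _; have /(congr1 (fun F => F u)) := e2.
by move=> <-; rewrite !patchE; case: ifP => // _; rewrite normr0.
Qed.

End resolvent.

(** * Independence and Gaussian moments *)

Section density.
Context d (T : measurableType d) (R : realType).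
Variables (mu nu : {measure set T -> \bar R}) (p : T -> R).
Hypotheses (mp : measurable_fun [set: T] p) (p0 : forall x, 0 <= p x).
Hypothesis nuE : forall A, measurable A -> nu A = (\int[mu]_(x in A) (p x)%:E)%E.

Import HBNNSimple.

(** [nu] is known only through its values on sets, so the formula passes from indicators to simple
    functions and then to limits by monotone convergence. *)
Lemma ge0_integral_density (f : T -> \bar R) : measurable_fun [set: T] f ->
  (forall x, 0 <= f x)%E ->
  (\int[nu]_x f x = \int[mu]_x (f x * (p x)%:E))%E.
Proof.
move=> mf f0; pose f_ := nnsfun_approx measurableT mf.
have mpE : measurable_fun [set: T] (EFin \o p) by exact/measurable_EFinP.
transitivity (limn (fun n => \int[nu]_x (f_ n x)%:E)%E).
  rewrite -monotone_convergence//.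
  - by apply: eq_integral => x _; apply/esym/cvg_lim => //; exact: cvg_nnsfun_approx.
  - by move=> n; exact/measurable_EFinP.
  - by move=> n x _; rewrite lee_fin.
  - by move=> x _ m n mn; rewrite lee_fin; exact/lefP/nd_nnsfun_approx.
transitivity (limn (fun n => \int[mu]_x ((f_ n x)%:E * (p x)%:E))%E); last first.
  rewrite -monotone_convergence//.
  - apply: eq_integral => x _; apply/cvg_lim => //.
    by apply: cvgeZr => //; exact: cvg_nnsfun_approx.
  - by move=> n; apply: emeasurable_funM => //; exact/measurable_EFinP.
  - by move=> n x _; rewrite mule_ge0// lee_fin.
  - move=> x _ m n mn; apply: lee_wpmul2r; first by rewrite lee_fin.
    by rewrite lee_fin; exact/lefP/nd_nnsfun_approx.
congr (limn _); apply/funext => n.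
transitivity (\sum_(y \in range (f_ n)) (y%:E * nu (f_ n @^-1` [set y])))%E.
  by rewrite integralT_nnsfun sintegralE.
under [RHS]eq_integral.
  move=> x _; rewrite fimfunE -fsumEFin// ge0_mule_fsuml; last first.
    by move=> r; exact: nnfun_muleindic_ge0.
  over.
rewrite ge0_integral_fsum//; last 2 first.
- move=> r; apply: emeasurable_funM => //; exact/measurable_EFinP/measurableT_comp.
- move=> r x _; apply: mule_ge0; first by rewrite nnfun_muleindic_ge0.
  by rewrite lee_fin.
apply: eq_fsbigr => r /set_mem[x _ <-].
under [RHS]eq_integral do rewrite EFinM -muleA.
rewrite ge0_integralZl//; last 3 first.
- by apply: emeasurable_funM => //; exact/measurable_EFinP/measurable_indic.
- by move=> y _; rewrite mule_ge0// lee_fin.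
- by rewrite lee_fin.
congr (_ * _)%E; rewrite nuE// integral_mkcond; apply: eq_integral => y _.
by rewrite patchE indicE; case: ifP => _; rewrite ?mul1e ?mul0e.
Qed.

Lemma Rintegrable_density (f : T -> R) : measurable_fun [set: T] f ->
  Rintegrable mu (fun x => f x * p x) -> Rintegrable nu f.
Proof.
move=> mf Ifp; apply/integrableP; split; first exact/measurable_EFinP.
rewrite ge0_integral_density//; last by do 2 apply: measurableT_comp => //; exact/measurable_EFinP.
have /integrableP[_] := Ifp; apply: le_lt_trans; apply: eq_implies_le.
by apply: eq_integral => x _ /=; rewrite normrM (ger0_norm (p0 x)).
Qed.

Lemma Rintegral_density (f : T -> R) : measurable_fun [set: T] f ->
  Rintegrable mu (fun x => f x * p x) ->
  \int[nu]_x f x = \int[mu]_x (f x * p x).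
Proof.
move=> mf Ifp; have If := Rintegrable_density mf Ifp.
have pos (g : T -> R) : measurable_fun [set: T] g -> (forall x, 0 <= g x) ->
    \int[nu]_x g x = \int[mu]_x (g x * p x).
  move=> mg g0; rewrite /Rintegral; congr fine.
  by rewrite ge0_integral_density//; exact/measurable_EFinP.
(* [f = |f| - h] is a difference of nonnegative integrable functions, to each of which [pos]
   applies. *)
pose h x := `|f x| - f x.
have Inf' := Rintegrable_norm If.
have Infp : Rintegrable mu (fun x => `|f x| * p x).
  have := Rintegrable_norm Ifp; apply: eq_integrable => // x _ /=.
  by rewrite normrM (ger0_norm (p0 x)).
have e1 : \int[nu]_x f x = \int[nu]_x `|f x| - \int[nu]_x h x.
  rewrite -RintegralTB//; last exact: RintegrableB.
  by apply: eq_Rintegral => x _; rewrite /h; ring.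
have mnf : measurable_fun [set: T] (fun x => `|f x|) by exact: measurableT_comp.
rewrite e1 !pos//; last 2 first.
- exact: measurable_funB.
- by move=> x; rewrite subr_ge0 ler_norm.
rewrite -RintegralTB//; last first.
  have := RintegrableB Infp Ifp; apply: eq_integrable => // x _ /=.
  by rewrite /h mulrBl.
by apply: eq_Rintegral => x _; rewrite /h; ring.
Qed.

End density.

Section independence.
Context d (Omega : measurableType d) (R : realType) (P : probability Omega R).
Implicit Types Y Z : Omega -> R.

(** Independence identifies the joint law with the product of the two laws, by uniqueness of product
    measures; Fubini then factors the integral. *)
Lemma indep_expectation Y Z :
  measurable_fun [set: Omega] Y -> measurable_fun [set: Omega] Z ->
  (forall A B : set R, measurable A -> measurable B ->
    P (Y @^-1` A `&` Z @^-1` B) = (P (Y @^-1` A) * P (Z @^-1` B))%E) ->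
  Rintegrable P Y -> Rintegrable P Z ->
  Rintegrable P (fun w => Y w * Z w) /\
  \int[P]_w (Y w * Z w) = \int[P]_w Y w * \int[P]_w Z w.
Proof.
move=> mY mZ indYZ IY IZ.
pose Ym := isMeasurableFun.Build _ _ _ _ _ mY.
pose Y' : {mfun Omega >-> R} := HB.pack Y Ym.
pose Zm := isMeasurableFun.Build _ _ _ _ _ mZ.
pose Z' : {mfun Omega >-> R} := HB.pack Z Zm.
pose PY : probability R R := distribution P Y'.
pose PZ : probability R R := distribution P Z'.
have mYZ : measurable_fun [set: Omega] (fun w => (Y w, Z w)) by exact: measurable_fun_pair.
pose YZm := isMeasurableFun.Build _ _ _ _ _ mYZ.
pose YZ' : {mfun Omega >-> (R * R)%type} := HB.pack (fun w => (Y w, Z w)) YZm.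
pose PYZ : probability (R * R)%type R := distribution P YZ'.
have prodE X : measurable X -> (PY \x PZ)%E X = PYZ X.
  apply: product_measure_unique => A B mA mB.
  by rewrite /PYZ /distribution /pushforward/= -indYZ.
have eqint (f : R * R -> \bar R) : measurable_fun setT f -> (forall z, 0 <= f z)%E ->
    (\int[(PY \x PZ)%E]_z f z = \int[P]_w f (Y w, Z w))%E.
  move=> mf f0; rewrite -[RHS](ge0_integral_distribution YZ')//.
  by apply: eq_measure_integral => X mX _; exact: prodE.
have mprod : measurable_fun [set: R * R] (fun z => z.1 * z.2).
  by apply: measurable_funM.
have IPY : Rintegrable PY id.
  by apply: integrable_pushforward => //; exact/measurable_EFinP.
have IPZ : Rintegrable PZ id.
  by apply: integrable_pushforward => //; exact/measurable_EFinP.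
have EY : \int[PY]_y y = \int[P]_w Y w.
  by rewrite /Rintegral (integral_distribution (X := Y') (f := EFin))//; exact/measurable_EFinP.
have EZ : \int[PZ]_y y = \int[P]_w Z w.
  by rewrite /Rintegral (integral_distribution (X := Z') (f := EFin))//; exact/measurable_EFinP.
have Iprod : Rintegrable (PY \x PZ)%E (fun z => z.1 * z.2).
  apply: Rintegrable_prod1 => //.
  have IPZ' := Rintegrable_norm IPZ; have IPY' := Rintegrable_norm IPY.
  have e y : (\int[PZ]_z (`|y * z|)%:E)%E = (\int[PZ]_z `|z| * `|y|)%:E.
    under eq_integral do rewrite normrM.
    by rewrite (Rintegral_EFin (RintegrableZ `|y| IPZ')) RintegralTZ// mulrC.
  under eq_integral do rewrite e.
  by rewrite (Rintegral_EFin (RintegrableZ _ IPY')) ltry.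
have IYZ : Rintegrable P (fun w => Y w * Z w).
  apply/integrableP; split; first by apply/measurable_EFinP; exact: measurable_funM.
  have /integrableP[_] := Iprod; apply: le_lt_trans.
  by rewrite eqint//; apply: measurableT_comp => //; exact/measurable_EFinP.
split => //.
transitivity (\int[(PY \x PZ)%E]_z (z.1 * z.2)).
  rewrite /Rintegral; congr fine.
  rewrite -[LHS](integral_distribution (X := YZ') (f := fun z => (z.1 * z.2)%:E))//.
    by apply: eq_measure_integral => X mX _; first [exact: prodE | exact: (esym (prodE _ mX))].
  exact/measurable_EFinP.
rewrite -(Rfubini1 Iprod)/= -EY -EZ.
transitivity (\int[PY]_y (\int[PZ]_z z * y)).
  by apply: eq_Rintegral => y _; rewrite RintegralTZ// mulrC.
by rewrite RintegralTZ// mulrC.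
Qed.

End independence.

Section gaussian_moments.
Context {R : realType}.
Local Notation leb := (@lebesgue_measure R).

(** Up to a constant factor this says [(x p(x))' = p(x) - x^2 p(x) / s^2], the integration by parts
    behind the second moment. *)
Lemma is_derive_gauss (b x : R) :
  is_derive x 1 (fun y : R => y * expR (- (y ^+ 2 * b)))
    (expR (- (x ^+ 2 * b)) * (1 - 2 * b * x ^+ 2)).
Proof.
apply: is_derive_eq.
by rewrite /GRing.scale/=; ring.
Qed.

Variable s : R.
Hypothesis s0 : s != 0.
Local Notation p := (normal_pdf 0 s).
Let b := (s ^+ 2 *+ 2)^-1.

Let s20 : 0 < s ^+ 2. Proof. by rewrite exprn_even_gt0. Qed.

Let bE : 2 * b = (s ^+ 2)^-1.
Proof. by rewrite /b -mulr_natr; field; exact: s0. Qed.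

Let pE x : p x = normal_peak s * expR (- (x ^+ 2 * b)).
Proof. by rewrite normal_pdfE// /normal_fun subr0 mulNr. Qed.

Let itv (n : nat) : set R := `](- n.+1%:R), n.+1%:R].

Let mitv n : measurable (itv n : set (measurableTypeR R)).
Proof. exact: measurable_itv. Qed.

Let gauss_second_moment_itv n : leb.-integrable (itv n) (EFin \o (fun x => x ^+ 2 * p x)) /\
  \int[leb]_(x in itv n) (x ^+ 2 * p x) =
  s ^+ 2 * (\int[leb]_(x in itv n) p x) - 2 * s ^+ 2 * (n.+1%:R * p n.+1%:R).
Proof.
have Ip : Rintegrable leb p := integrable_normal_pdf 0 s.
(* The closed interval is used because [derivable_FTC] requires the derivative at both endpoints. *)
pose g := (fun x => p x * (1 - x ^+ 2 / s ^+ 2)) \_ `[- n.+1%:R, n.+1%:R].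
have mpx : measurable_fun [set: R] (fun x => p x * (1 - x ^+ 2 / s ^+ 2)).
  apply: measurable_funM; first exact: measurable_normal_pdf.
  by apply: measurable_funB => //; apply: measurable_funM => //; exact: measurable_funX.
have Ig : Rintegrable leb g.
  apply: (le_Rintegrable _ _ (RintegrableZ (1 + n.+1%:R ^+ 2 / s ^+ 2) Ip)).
    by apply/(measurable_restrictT _ _).1 => //; exact: measurable_funTS.
  move=> x; rewrite /g patchE; case: ifPn => [|_]; last first.
    by rewrite normr0 mulr_ge0 ?normal_pdf_ge0// addr_ge0// divr_ge0// ?sqr_ge0.
  rewrite inE/= in_itv/= => /andP[x1 x2].
  rewrite normrM (ger0_norm (normal_pdf_ge0 _ _ _)) mulrC ler_wpM2r ?normal_pdf_ge0//.
  have x2n : x ^+ 2 / s ^+ 2 <= n.+1%:R ^+ 2 / s ^+ 2.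
    rewrite ler_wpM2r// ?invr_ge0 ?sqr_ge0//.
    have : 0 <= (n.+1%:R - x) * (n.+1%:R + x) by rewrite mulr_ge0//; lra.
    by lra.
  have : 0 <= x ^+ 2 / s ^+ 2 by rewrite divr_ge0// sqr_ge0.
  by rewrite ler_norml; lra.
have nn : - n.+1%:R <= n.+1%:R :> R.
  by have : 0 <= n.+1%:R :> R by []; lra.
pose Q x : R := normal_peak s * (x * expR (- (x ^+ 2 * b))).
have QE x : Q x = x * p x by rewrite /Q pE mulrCA.
have H : Q n.+1%:R - Q (- n.+1%:R) = \int[leb]_(t in `]- n.+1%:R, n.+1%:R]) g t.
  apply: derivable_FTC => // x /andP[x1 x2].
  have -> : g x = normal_peak s * (expR (- (x ^+ 2 * b)) * (1 - 2 * b * x ^+ 2)).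
    by rewrite /g patchE mem_set/= ?in_itv/= ?x1// pE bE; field; exact: s0.
  have hd := is_derive_gauss b x.
  apply: is_derive_eq.
  by rewrite /GRing.scale/=; ring.
have Qn : Q n.+1%:R - Q (- n.+1%:R) = 2 * (n.+1%:R * p n.+1%:R).
  by rewrite !QE !pE sqrrN; ring.
have I1 : leb.-integrable (itv n) (EFin \o p) by apply: integrableS Ip => //; exact: mitv.
have I2 : leb.-integrable (itv n) (EFin \o (fun x => x ^+ 2 * p x)).
  have : leb.-integrable (itv n) (EFin \o (fun x => s ^+ 2 * (p x - g x))).
    apply: RintegrableS; first exact: mitv.
    by apply: RintegrableZ; exact: RintegrableB.
  apply: eq_integrable; first exact: mitv.
  move=> x; rewrite inE /itv/= in_itv/= => /andP[x1 x2].
  by rewrite /g patchE mem_set/= ?in_itv/= ?(ltW x1)//; congr EFin; field; exact: s0.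
split => //.
have : \int[leb]_(t in itv n) g t = \int[leb]_(t in itv n) (p t - (s ^+ 2)^-1 * (t ^+ 2 * p t)).
  apply: eq_Rintegral => x; rewrite inE /itv/= in_itv/= => /andP[x1 x2].
  by rewrite /g patchE mem_set/= ?in_itv/= ?(ltW x1)//; ring.
rewrite -[LHS]/(\int[leb]_(t in `]- n.+1%:R, n.+1%:R]) g t) -H Qn.
rewrite (RintegralB (mitv n) I1 (integrableZl (mitv n) (s ^+ 2)^-1 I2)).
rewrite (RintegralZl _ (mitv n) I2) => E.
have {}E : (s ^+ 2)^-1 * \int[leb]_(x in itv n) (x ^+ 2 * p x) =
    \int[leb]_(x in itv n) p x - 2 * (n.+1%:R * p n.+1%:R) by rewrite E; ring.
rewrite -[LHS](mulVKf (lt0r_neq0 s20)) E; ring.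
Qed.

Let itv_cover : \bigcup_n itv n = setT.
Proof.
apply/seteqP; split => // x _.
exists (Num.truncn `|x|) => //; rewrite /itv/= in_itv/=.
have := truncnS_gt `|x|; rewrite ltr_norml => /andP[-> /ltW ->]//.
Qed.

Let itv_nd : nondecreasing_seq itv.
Proof.
move=> m n mn; rewrite subsetEset => x; rewrite /itv/= !in_itv/= => /andP[x1 x2].
have mn' : m.+1%:R <= n.+1%:R :> R by rewrite ler_nat.
by apply/andP; split; lra.
Qed.

Lemma normal_second_moment : (\int[leb]_x (x ^+ 2 * p x)%:E)%E = (s ^+ 2)%:E.
Proof.
have Ip : Rintegrable leb p := integrable_normal_pdf 0 s.
have mx2p : measurable_fun [set: R] (fun x => (x ^+ 2 * p x)%:E).
  apply/measurable_EFinP; apply: measurable_funM; first exact: measurable_funX.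
  exact: measurable_normal_pdf.
have U : (\int[leb]_(x in itv n) (x ^+ 2 * p x)%:E)%E @[n --> \oo] -->
    (\int[leb]_x (x ^+ 2 * p x)%:E)%E.
  rewrite -itv_cover; apply: ge0_nondecreasing_set_cvg_integral; first exact: itv_nd.
  - by move=> i; exact: measurable_itv.
  - by move=> i; exact: measurable_funTS.
  - by move=> i x _; rewrite lee_fin mulr_ge0 ?sqr_ge0 ?normal_pdf_ge0.
have V : (\int[leb]_(x in itv n) (p x)%:E)%E @[n --> \oo] --> 1%E.
  rewrite -(integral_normal_pdf 0 s) -itv_cover.
  apply: ge0_nondecreasing_set_cvg_integral; first exact: itv_nd.
  - by move=> i; exact: measurable_itv.
  - by move=> i; apply: measurable_funTS; apply/measurable_EFinP; exact: measurable_normal_pdf.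
  - by move=> i x _; rewrite lee_fin normal_pdf_ge0.
have W : (n.+1%:R * p n.+1%:R) @[n --> \oo] --> (0 : R).
  have b0 : 0 < b by rewrite invr_gt0 pmulrn_lgt0.
  (* With [y = (n + 1)^2 * b], the bound [exp (- y) <= 1 / y] leaves a multiple of [1 / (n + 1)] for
     the boundary term. *)
  apply: (@squeeze_cvgr _ _ _ _ (fun=> 0) (fun n => normal_peak s / b * harmonic n)).
  - apply: nearW => n; rewrite mulr_ge0 ?normal_pdf_ge0//= pE.
    have n0 : 0 < n.+1%:R :> R by [].
    rewrite mulrCA -mulrA ler_wpM2l ?normal_peak_ge0//.
    have e1 : 1 + n.+1%:R ^+ 2 * b <= expR (n.+1%:R ^+ 2 * b) by exact: expR_ge1Dx.
    have e0 : 0 < n.+1%:R ^+ 2 * b by rewrite mulr_gt0// exprn_gt0.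
    rewrite expRN.
    apply: (@le_trans _ _ (n.+1%:R * (n.+1%:R ^+ 2 * b)^-1)).
      by rewrite ler_wpM2l ?ler0n// lef_pV2 ?posrE ?expR_gt0//; lra.
    apply: eq_implies_le; field.
    by rewrite gt_eqF//= gt_eqF.
  - exact: cvg_cst.
  - rewrite -[X in _ --> X](mulr0 (normal_peak s / b)).
    by apply: cvgM; [exact: cvg_cst|exact: cvg_harmonic].
apply: (cvg_unique _ U) => //.
have E n : (\int[leb]_(x in itv n) (x ^+ 2 * p x)%:E)%E =
    (s ^+ 2 * fine (\int[leb]_(x in itv n) (p x)%:E)%E - 2 * s ^+ 2 * (n.+1%:R * p n.+1%:R))%:E.
  have [I2 e] := gauss_second_moment_itv n.
  rewrite -[(s ^+ 2 * _ - _)]e /Rintegral fineK//.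
  by apply: integrable_fin_num => //; exact: mitv.
rewrite (funext E); apply: cvg_EFin; first exact: nearW.
rewrite [X in _ --> X](_ : _ = s ^+ 2 * 1 - 2 * s ^+ 2 * 0); last by rewrite mulr0 subr0 mulr1.
apply: cvgB; apply: cvgM; try exact: cvg_cst.
  exact: fine_cvg.
exact: W.
Qed.

Lemma Rintegrable_normal2 : Rintegrable leb (fun x => x ^+ 2 * p x).
Proof.
apply: Rintegrable_lty.
- by apply: measurable_funM; [exact: measurable_funX|exact: measurable_normal_pdf].
- by move=> x; rewrite mulr_ge0 ?sqr_ge0 ?normal_pdf_ge0.
- by rewrite normal_second_moment ltry.
Qed.

Lemma Rintegrable_normal1 : Rintegrable leb (fun x => x * p x).
Proof.
have Ip : Rintegrable leb p := integrable_normal_pdf 0 s.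
apply: (le_Rintegrable _ _ (RintegrableD Ip Rintegrable_normal2)).
  by apply: measurable_funM => //; exact: measurable_normal_pdf.
move=> x; rewrite normrM (ger0_norm (normal_pdf_ge0 _ _ _)) -[X in _ <= X + _]mul1r -mulrDl.
rewrite ler_wpM2r ?normal_pdf_ge0// -(real_normK (num_real x)).
by have := normr_ge0 x; nra.
Qed.

Lemma normal_first_moment : \int[leb]_x (x * p x) = 0.
Proof.
have H : \int[leb]_x (x * p x) = - \int[leb]_x (x * p x).
  rewrite -[LHS](Rintegral_subr 0 Rintegrable_normal1) -[RHS]mulN1r.
  rewrite -RintegralTZ; last exact: Rintegrable_normal1.
  by apply: eq_Rintegral => x _; rewrite !pE sub0r sqrrN; ring.
by move: H; lra.
Qed.

End gaussian_moments.

(** * Simple processes *)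

Section brownian.
Context {d : measure_display} {Omega : measurableType d} {R : realType}.
Variables (P : probability Omega R) (F : R -> set (set Omega)) (W : R -> Omega -> R).
Hypotheses (hF : usual_filtration P F) (hW : brownian_motion P F W).
Local Notation leb := (@lebesgue_measure R).
Implicit Types (x y Y : Omega -> R) (s t : R).

(** [measurable_wrt] refers to the sigma-algebra generated by [F s], which is [F s] itself because
    [F s] is already one. *)
Lemma measurable_wrt_preimage s Y (B : set R) : 0 <= s ->
  measurable_wrt (F s) Y -> measurable B -> F s (Y @^-1` B).
Proof.
move=> s0 mY mB; have sF := filtration_sigma hF s0.
have := mY measurableT B mB; rewrite setTI.
by rewrite /measurable/= sigma_algebra_id.
Qed.

Lemma measurable_wrt_measurable s Y : 0 <= s -> measurable_wrt (F s) Y ->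
  measurable_fun [set: Omega] Y.
Proof.
move=> s0 mY _ B mB; rewrite setTI.
by apply: (filtration_sub hF s0); exact: measurable_wrt_preimage.
Qed.

Lemma measurable_wrt_le s t Y : 0 <= s -> s <= t -> measurable_wrt (F s) Y ->
  measurable_wrt (F t) Y.
Proof.
move=> s0 st mY _ B mB; rewrite setTI.
by apply: sub_sigma_algebra; apply: (filtration_le hF s0 st); exact: measurable_wrt_preimage.
Qed.

Lemma measurable_wrtM G x y : measurable_wrt G x -> measurable_wrt G y ->
  measurable_wrt G (fun w => x w * y w).
Proof. by move=> mx my; apply: measurable_funM. Qed.

Lemma measurable_wrtB G x y : measurable_wrt G x -> measurable_wrt G y ->
  measurable_wrt G (fun w => x w - y w).
Proof. by move=> mx my; apply: measurable_funB. Qed.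

Lemma measurable_W s : 0 <= s -> measurable_fun [set: Omega] (W s).
Proof. by move=> s0; apply: (measurable_wrt_measurable s0); exact: brownian_adapted hW _ s0. Qed.

Definition incr a b (w : Omega) : R := W b w - W a w.

Lemma measurable_incr a b : 0 <= a -> 0 <= b -> measurable_fun [set: Omega] (incr a b).
Proof. by move=> a0 b0; apply: measurable_funB; exact: measurable_W. Qed.

Lemma incr_adapted a b t : 0 <= a -> 0 <= b -> a <= t -> b <= t ->
  measurable_wrt (F t) (incr a b).
Proof.
move=> a0 b0 at_ bt; apply: measurable_wrtB.
  exact: (measurable_wrt_le b0 bt (brownian_adapted hW b0)).
exact: (measurable_wrt_le a0 at_ (brownian_adapted hW a0)).
Qed.

Lemma incr_moments s t : 0 <= s -> s < t ->
  [/\ Rintegrable P (incr s t), Rintegrable P (fun w => incr s t w ^+ 2),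
      \int[P]_w incr s t w = 0 & \int[P]_w (incr s t w ^+ 2) = t - s].
Proof.
move=> s0 st; have t0 : 0 <= t by rewrite (le_trans s0)// ltW.
have mD := measurable_incr s0 t0.
have mD' : @measurable_fun _ _ Omega (measurableTypeR R) setT (incr s t) := mD.
pose Dm := isMeasurableFun.Build _ _ _ _ _ mD'.
pose D : {mfun Omega >-> measurableTypeR R} := HB.pack (incr s t : Omega -> measurableTypeR R) Dm.
pose PD : probability (measurableTypeR R) R := distribution P D.
pose v := Num.sqrt (t - s).
have v0 : v != 0 by rewrite gt_eqF// sqrtr_gt0 subr_gt0.
have PDE (A : set (measurableTypeR R)) : measurable A -> PD A = (\int[leb]_(x in A) (normal_pdf 0 v x)%:E)%E.
  by move=> mA; exact: (brownian_normal hW s0 st mA).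
have mp : measurable_fun [set: measurableTypeR R] (normal_pdf 0 v) by exact: measurable_normal_pdf.
have p0 r : 0 <= normal_pdf 0 v r by exact: normal_pdf_ge0.
have I1 : Rintegrable PD id.
  by apply: (Rintegrable_density mp p0 PDE) => //; exact: Rintegrable_normal1.
have m2 : measurable_fun [set: measurableTypeR R] (fun r : R => r ^+ 2) by exact: measurable_funX.
have I2 : Rintegrable PD (fun r => r ^+ 2).
  by apply: (Rintegrable_density mp p0 PDE) => //; exact: Rintegrable_normal2.
have E1 : \int[PD]_r r = 0.
  rewrite (Rintegral_density mp p0 PDE) ?normal_first_moment//.
  exact: Rintegrable_normal1.
have E2 : \int[PD]_r (r ^+ 2) = t - s.
  rewrite (Rintegral_density mp p0 PDE)//; last exact: Rintegrable_normal2.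
  by rewrite /Rintegral normal_second_moment//= sqr_sqrtr// subr_ge0 ltW.
have tr (g : R -> R) : measurable_fun [set: measurableTypeR R] g -> Rintegrable PD g ->
    Rintegrable P (fun w => g (incr s t w)).
  move=> mg /integrableP[_ goo]; apply/integrableP; split.
    by apply/measurable_EFinP; exact: measurableT_comp.
  apply: le_lt_trans goo; apply: eq_implies_le.
  rewrite (ge0_integral_distribution D (f := fun r => `|(EFin \o g) r|%E))//.
  by apply: measurableT_comp => //; exact/measurable_EFinP.
have J1 := tr id (@measurable_id _ _ _) I1.
have J2 := tr _ m2 I2.
split => //.
  by rewrite -E1 /Rintegral (integral_distribution (X := D) (f := EFin))//; exact/measurable_EFinP.
rewrite -E2 /Rintegral (integral_distribution (X := D) (f := fun r => (r ^+ 2)%:E))//.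
exact/measurable_EFinP.
Qed.

Lemma incr_indep s t Y (g : R -> R) : 0 <= s -> s < t -> measurable_wrt (F s) Y ->
  measurable_fun [set: R] g -> Rintegrable P Y -> Rintegrable P (fun w => g (incr s t w)) ->
  Rintegrable P (fun w => Y w * g (incr s t w)) /\
  \int[P]_w (Y w * g (incr s t w)) = \int[P]_w Y w * \int[P]_w g (incr s t w).
Proof.
move=> s0 st mY mg IY Ig; have t0 : 0 <= t by rewrite (le_trans s0)// ltW.
apply: indep_expectation => //.
- exact: (measurable_wrt_measurable s0).
- exact: (measurableT_comp mg (measurable_incr s0 t0)).
- move=> A B mA mB; apply: (brownian_indep hW s0 st).
    exact: measurable_wrt_preimage.
  exists (g @^-1` B); first by rewrite -[X in measurable X]setTI; exact: mg.
  by rewrite setTI.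
Qed.

(** Measurability is conditional on [s < t]: when a simple process is cut at a horizon, its later
    intervals collapse to a point at which the coefficients need not be adapted. *)
Lemma incr_mean s t Y : 0 <= s -> s <= t -> (s < t -> measurable_wrt (F s) Y) ->
  Rintegrable P Y ->
  Rintegrable P (fun w => Y w * incr s t w) /\ \int[P]_w (Y w * incr s t w) = 0.
Proof.
move=> s0; rewrite le_eqVlt => /predU1P[<- _ _|st mY IY].
  have -> : (fun w => Y w * incr s s w) = (fun=> 0).
    by apply/funext => w; rewrite /incr subrr mulr0.
  by split; [exact: Rintegrable0|rewrite /Rintegral integral0].
have [I1 _ E1 _] := incr_moments s0 st.
have [] := @incr_indep s t Y id s0 st (mY st) (@measurable_id _ _ _) IY I1.
by rewrite E1 mulr0.
Qed.

Lemma incr_sqr s t Y : 0 <= s -> s <= t -> (s < t -> measurable_wrt (F s) Y) ->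
  Rintegrable P Y ->
  Rintegrable P (fun w => Y w * incr s t w ^+ 2) /\
  \int[P]_w (Y w * incr s t w ^+ 2) = (t - s) * \int[P]_w Y w.
Proof.
move=> s0; rewrite le_eqVlt => /predU1P[<- _ _|st mY IY].
  have -> : (fun w => Y w * incr s s w ^+ 2) = (fun=> 0).
    by apply/funext => w; rewrite /incr subrr expr0n mulr0.
  by rewrite subrr mul0r; split; [exact: Rintegrable0|rewrite /Rintegral integral0].
have [_ I2 _ E2] := incr_moments s0 st.
have [] := @incr_indep s t Y (fun r => r ^+ 2) s0 st (mY st) _ IY I2.
  exact: measurable_funX.
by rewrite E2 mulrC.
Qed.

(* An elementary integrand [x 1_(]a, b])]; measurability is void if [a = b]. *)
Record elementary (x : Omega -> R) (a b : R) : Prop := Elementary {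
  elementary_ge0 : 0 <= a ;
  elementary_le : a <= b ;
  elementary_measurable : measurable_fun [set: Omega] x ;
  elementary_adapted : a < b -> measurable_wrt (F a) x ;
  elementary_bounded : exists M, forall w, `|x w| <= M }.

(** Length of the intersection of []a, b]] and []a', b']], as [integral_overlap] confirms. *)
Definition overlap (a b a' b' : R) : R :=
  Num.max 0 (Num.min b b' - Num.max a a').

Lemma Rintegrable_boundedM x Y : measurable_fun [set: Omega] x ->
  (exists M, forall w, `|x w| <= M) -> Rintegrable P Y ->
  Rintegrable P (fun w => x w * Y w).
Proof.
move=> mx [M xM] IY; have mY := Rintegrable_measurable IY.
apply: (le_Rintegrable _ _ (RintegrableZ M (Rintegrable_norm IY))).
  exact: measurable_funM.
by move=> w; rewrite normrM ler_wpM2r.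
Qed.

Lemma Rintegrable_bounded x : measurable_fun [set: Omega] x ->
  (exists M, forall w, `|x w| <= M) -> Rintegrable P x.
Proof.
move=> mx bx; have I1 : Rintegrable P (fun=> 1).
  by apply: (finite_measure_integrable_cst P 1).
have := Rintegrable_boundedM mx bx I1; apply: eq_integrable => // w _ /=.
by rewrite mulr1.
Qed.

Lemma boundedM x y : (exists M, forall w, `|x w| <= M) ->
  (exists M, forall w, `|y w| <= M) -> exists M, forall w, `|x w * y w| <= M.
Proof.
move=> [M xM] [N yN]; exists (M * N) => w.
by rewrite normrM ler_pM.
Qed.

Lemma Rintegrable_incr a b : 0 <= a -> a <= b -> Rintegrable P (incr a b).
Proof.
move=> a0; rewrite le_eqVlt => /predU1P[<-|ab]; last by have [] := incr_moments a0 ab.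
have -> : incr a a = (fun=> 0) by apply/funext => w; rewrite /incr subrr.
exact: Rintegrable0.
Qed.

(** Both increments are split at the start [a'] and at the end of the common part. In each mixed
    product one factor is an increment lying after everything else, so its mean is 0; the square
    over the common part gives its length. *)
Lemma elementary_cov_le x a b y a' b' : elementary x a b -> elementary y a' b' ->
  a <= a' ->
  Rintegrable P (fun w => (x w * incr a b w) * (y w * incr a' b' w)) /\
  \int[P]_w ((x w * incr a b w) * (y w * incr a' b' w)) =
    overlap a b a' b' * \int[P]_w (x w * y w).
Proof.
move=> [a0 ab mx ax bx] [a0' ab' my ay by_] aa'.
have b0 := le_trans a0 ab; have b0' := le_trans a0' ab'.
rewrite /overlap (max_r aa').
have Ixy : Rintegrable P (fun w => x w * y w).
  by apply: Rintegrable_boundedM => //; exact: Rintegrable_bounded.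
have trivial_case : (forall w, (x w * incr a b w) * (y w * incr a' b' w) = 0) ->
    Num.max 0 (Num.min b b' - a') = 0 ->
    Rintegrable P (fun w => (x w * incr a b w) * (y w * incr a' b' w)) /\
    \int[P]_w ((x w * incr a b w) * (y w * incr a' b' w)) =
    Num.max 0 (Num.min b b' - a') * \int[P]_w (x w * y w).
  move=> e ->; rewrite mul0r (funext e); split; first exact: Rintegrable0.
  by rewrite /Rintegral integral0.
have [eab|nab] := eqVneq a b.
  apply: trivial_case; first by move=> w; rewrite -eab /incr subrr mulr0 mul0r.
  by apply/max_idPl; rewrite subr_le0 ge_min -eab aa'.
have [eab'|nab'] := eqVneq a' b'.
  apply: trivial_case; first by move=> w; rewrite -eab' /incr subrr !mulr0.
  by apply/max_idPl; rewrite subr_le0 ge_min -eab' lexx orbT.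
have {nab}ltab : a < b by rewrite lt_neqAle nab.
have {nab'}ltab' : a' < b' by rewrite lt_neqAle nab'.
have axa' : measurable_wrt (F a') x by apply: (measurable_wrt_le a0 aa'); exact: ax.
have axya' : measurable_wrt (F a') (fun w => x w * y w).
  by apply: measurable_wrtM => //; exact: ay.
have mxy : measurable_fun [set: Omega] (fun w => x w * y w) by exact: measurable_funM.
have bxy := boundedM bx by_.
have [ba'|a'b] := leP b a'.
  rewrite max_l; last by rewrite subr_le0 ge_min ba'.
  have [] := @incr_mean a' b' (fun w => (x w * y w) * incr a b w) a0' ab'.
  - by move=> _; apply: measurable_wrtM => //; exact: incr_adapted.
  - by apply: Rintegrable_boundedM => //; exact: Rintegrable_incr.
  have e w : (x w * incr a b w) * (y w * incr a' b' w) =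
    x w * y w * incr a b w * incr a' b' w by ring.
  by rewrite (funext e) mul0r.
have a'b_ := ltW a'b.
have [I1 E1] : Rintegrable P (fun w => (x w * y w) * incr a a' w * incr a' b' w) /\
    \int[P]_w ((x w * y w) * incr a a' w * incr a' b' w) = 0.
  apply: incr_mean => //.
  - by move=> _; apply: measurable_wrtM => //; exact: incr_adapted.
  - by apply: Rintegrable_boundedM => //; exact: Rintegrable_incr.
(* []a', m]] is the common part and []m, n]] the overhang of the longer interval. Whichever interval
   that is, the overhang meets only [incr a' m] of the other. *)
pose m := Num.min b b'; pose n := Num.max b b'.
have a'm : a' < m by rewrite lt_min a'b ltab'.
have m0 : 0 <= m by rewrite (le_trans a0')// ltW.
have mn : m <= n by rewrite ge_min le_max lexx.
have [I2 E2] : Rintegrable P (fun w => (x w * y w) * incr a' m w ^+ 2) /\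
    \int[P]_w ((x w * y w) * incr a' m w ^+ 2) = (m - a') * \int[P]_w (x w * y w).
  by apply: incr_sqr => //; exact: ltW.
have [I3 E3] : Rintegrable P (fun w => (x w * y w) * incr a' m w * incr m n w) /\
    \int[P]_w ((x w * y w) * incr a' m w * incr m n w) = 0.
  apply: incr_mean => //.
  - move=> _; apply: measurable_wrtM; first by apply: (measurable_wrt_le a0' (ltW a'm)).
    by apply: incr_adapted => //; exact: ltW.
  - by apply: Rintegrable_boundedM => //; apply: Rintegrable_incr => //; exact: ltW.
have e w : (x w * incr a b w) * (y w * incr a' b' w) =
    (x w * y w) * incr a a' w * incr a' b' w +
    ((x w * y w) * incr a' m w ^+ 2 + (x w * y w) * incr a' m w * incr m n w).
  by rewrite /incr /m /n; case: (leP b b') => _; ring.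
rewrite (funext e); split; first by apply: RintegrableD => //; exact: RintegrableD.
rewrite RintegralTD//; last exact: RintegrableD.
rewrite RintegralTD// E1 E2 E3 add0r addr0 max_r// subr_ge0; exact: ltW.
Qed.

Lemma overlapC a b a' b' : overlap a b a' b' = overlap a' b' a b.
Proof. by rewrite /overlap minC [Num.max a a']maxC. Qed.

Lemma elementary_cov x a b y a' b' : elementary x a b -> elementary y a' b' ->
  Rintegrable P (fun w => (x w * incr a b w) * (y w * incr a' b' w)) /\
  \int[P]_w ((x w * incr a b w) * (y w * incr a' b' w)) =
    overlap a b a' b' * \int[P]_w (x w * y w).
Proof.
move=> ex ey; have [aa'|a'a] := leP a a'; first exact: elementary_cov_le.
have [] := elementary_cov_le ey ex (ltW a'a).
rewrite overlapC.
have e w : (y w * incr a' b' w) * (x w * incr a b w) =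
  (x w * incr a b w) * (y w * incr a' b' w) by ring.
have e' w : y w * x w = x w * y w by ring.
by rewrite (funext e) (funext e').
Qed.

End brownian.

Section simple.
Context {d : measure_display} {Omega : measurableType d} {R : realType}.
Variables (P : probability Omega R) (F : R -> set (set Omega)) (W : R -> Omega -> R).
Hypotheses (hF : usual_filtration P F) (hW : brownian_motion P F W).
Local Notation leb := (@lebesgue_measure R).
Local Notation PL := (P \x leb)%E.
Implicit Types (S : simple_process F) (t s : R).

Definition cut S t i := Num.min (simple_time S i) t.
Definition cutlen S t i := cut S t i.+1 - cut S t i.

Lemma simple_time_ge0 S i : 0 <= simple_time S i.
Proof. exact: le_trans (simple_time0 S) (simple_time_le S (leq0n i)). Qed.

Lemma cut_ge0 S t i : 0 <= t -> 0 <= cut S t i.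
Proof. by move=> t0; rewrite le_min t0 simple_time_ge0. Qed.

Lemma cut_le S t i : cut S t i <= cut S t i.+1.
Proof. by apply: le_min2 => //; exact: simple_time_le. Qed.

Lemma cutlen_ge0 S t i : 0 <= cutlen S t i.
Proof. by rewrite subr_ge0 cut_le. Qed.

Lemma simple_coef_measurable S i : measurable_fun [set: Omega] (simple_coef S i).
Proof.
by apply: (measurable_wrt_measurable hF (simple_time_ge0 S i)); exact: simple_measurable.
Qed.

Lemma simple_elementary S t i : 0 <= t ->
  elementary F (simple_coef S i) (cut S t i) (cut S t i.+1).
Proof.
move=> t0; split.
- exact: cut_ge0.
- exact: cut_le.
- exact: simple_coef_measurable.
- rewrite /cut => h; have [tit|tti] := leP (simple_time S i) t.
    by exact: simple_measurable.
  by move: h; rewrite (min_r (ltW tti)) lt_min ltxx andbF.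
- exact: Defs.simple_bounded.
Qed.

Lemma simple_integralE S t w : simple_integral W S t w =
  \sum_(i < simple_size S) simple_coef S i w * incr W (cut S t i) (cut S t i.+1) w.
Proof. by []. Qed.

Definition cutvalue S t (z : Omega * R) : R :=
  ((fun s => simple_value S s z.1) \_ `[0, t]) z.2.

(** Here the coefficients are plain numbers, so that pathwise algebra on a fixed grid carries no
    measurability obligations. *)
Definition step_value S (c : nat -> R) s : R :=
  \sum_(i < simple_size S) c i * \1_(`]simple_time S i, simple_time S i.+1]) s.

Lemma step_value_patch S c t s : 0 <= t -> (step_value S c \_ `[0, t]) s =
  \sum_(i < simple_size S) c i * \1_(`]cut S t i, cut S t i.+1]) s.
Proof.
move=> t0; have [st|st] := boolP (0 <= s <= t).
  rewrite patch_itv_in//; apply: eq_bigr => i _; congr (_ * _).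
  rewrite !indicE; congr (nat_of_bool _)%:R.
  case/andP: st => _ st.
  apply/idP/idP; rewrite !inE/= !in_itv/= /cut gt_min le_min st andbT [t < _]ltNge st orbF//.
rewrite patch_itv_out// big1// => i _; rewrite indicE memNset ?mulr0//=.
rewrite in_itv/=; apply/negP; move: st; apply: contra => /andP[h1 h2].
move: h2; rewrite le_min => /andP[_ ->]; rewrite andbT.
by rewrite (le_trans (cut_ge0 S i t0))// ltW.
Qed.

(* The intervals are disjoint, so at most one indicator is nonzero. *)
Lemma step_value_cases S s : (forall c, step_value S c s = 0) \/
  exists i, forall c, step_value S c s = c i.
Proof.
have [i si|si] := pickP (fun i : 'I_(simple_size S) =>
    s \in `]simple_time S i, simple_time S i.+1]%classic).
  right; exists i => c; rewrite /step_value (bigD1 i)//= indicE si mulr1 big1 ?addr0//.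
  move=> j ji; rewrite indicE memNset ?mulr0//= in_itv/= => /andP[js sj].
  move: si => /set_mem/=; rewrite in_itv/= => /andP[is_ si].
  have := neq_ltn j i; rewrite -val_eqE in ji; rewrite ji => /esym/orP[ji'|ij'].
    have := simple_time_le S (ji' : (j.+1 <= i)%N).
    by rewrite leNgt => /negP; apply; exact: lt_le_trans is_ sj.
  have := simple_time_le S (ij' : (i.+1 <= j)%N).
  by rewrite leNgt => /negP; apply; exact: lt_le_trans js si.
left => c; rewrite /step_value big1// => j _.
by rewrite indicE si mulr0.
Qed.

(** At most one interval contains [s], so a function that fixes 0 acts coefficientwise. It is
    applied to squaring, to clipping and to the residue of clipping. *)
Lemma step_value_map S (g : R -> R) c s : g 0 = 0 ->
  g (step_value S c s) = step_value S (g \o c) s.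
Proof.
by move=> g0; have [h|[i h]] := step_value_cases S s; rewrite !h.
Qed.

Lemma cutvalueE S t z : 0 <= t -> cutvalue S t z =
  \sum_(i < simple_size S) simple_coef S i z.1 *
    \1_(`]cut S t i, cut S t i.+1]) z.2.
Proof. by move=> t0; exact: (step_value_patch S (fun i => simple_coef S i z.1)). Qed.

Lemma integral_overlap a b a' b' : a <= b -> a' <= b' ->
  Rintegrable leb (fun s => \1_(`]a, b]) s * \1_(`]a', b']) s : R) /\
  \int[leb]_s (\1_(`]a, b]) s * \1_(`]a', b']) s) = overlap a b a' b'.
Proof.
move=> ab ab'.
have e s : \1_(`]a, b]) s * \1_(`]a', b']) s =
    \1_(`]Num.max a a', Num.min b b']) s :> R.
  rewrite !indicE -natrM mulnb; congr (nat_of_bool _)%:R.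
  apply/idP/idP; rewrite !inE/= !in_itv/= gt_max le_min.
    by move=> /andP[/set_mem/= + /set_mem/=]; rewrite !in_itv/= => /andP[-> ->] /andP[-> ->].
  by move=> /andP[/andP[h1 h2] /andP[h3 h4]]; rewrite !mem_set//= in_itv/= ?h1 ?h2 ?h3 ?h4.
rewrite (funext e); split; first exact: integrable_indic_itv.
rewrite /Rintegral integral_indic//= setIT lebesgue_measure_itv/= lte_fin /overlap.
case: ltP => h /=; first by rewrite [RHS]max_r// subr_ge0 ltW.
by rewrite [RHS]max_l// subr_le0.
Qed.

(** The isometry in polarised form and with two horizons, as [E[J_t J_r]] requires: both sides
    expand into the same double sum of overlaps times [E[x_i y_j]]. *)
Lemma simple_cov S S' t t' : 0 <= t -> 0 <= t' ->
  [/\ Rintegrable P (fun w => simple_integral W S t w * simple_integral W S' t' w),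
      Rintegrable PL (fun z => cutvalue S t z * cutvalue S' t' z) &
      \int[P]_w (simple_integral W S t w * simple_integral W S' t' w) =
      \int[PL]_z (cutvalue S t z * cutvalue S' t' z)].
Proof.
move=> t0 t'0.
pose x i := simple_coef S i; pose y j := simple_coef S' j.
pose fij i j w := (x i w * incr W (cut S t i) (cut S t i.+1) w) *
  (y j w * incr W (cut S' t' j) (cut S' t' j.+1) w).
pose gij i j (z : Omega * R) := (x i z.1 * y j z.1) * (\1_(`]cut S t i, cut S t i.+1]) z.2 *
    \1_(`]cut S' t' j, cut S' t' j.+1]) z.2).
have hf i j : Rintegrable P (fij i j) /\ \int[P]_w (fij i j w) =
    overlap (cut S t i) (cut S t i.+1) (cut S' t' j) (cut S' t' j.+1) *
    \int[P]_w (x i w * y j w).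
  by apply: (elementary_cov hF hW); exact: simple_elementary.
have hg i j : Rintegrable PL (gij i j) /\ \int[PL]_z (gij i j z) =
    overlap (cut S t i) (cut S t i.+1) (cut S' t' j) (cut S' t' j.+1) *
    \int[P]_w (x i w * y j w).
  have Ixy : Rintegrable P (fun w => x i w * y j w).
    apply: Rintegrable_boundedM; [exact: simple_coef_measurable|exact: Defs.simple_bounded|].
    by apply: Rintegrable_bounded; [exact: simple_coef_measurable|exact: Defs.simple_bounded].
  have [Iov Eov] := integral_overlap (cut_le S t i) (cut_le S' t' j).
  split; first exact: (Rintegrable_tensor Ixy Iov).
  by rewrite (Rintegral_tensor Ixy Iov) Eov mulrC.
have ef w : simple_integral W S t w * simple_integral W S' t' w =
    \sum_(i < simple_size S) \sum_(j < simple_size S') fij i j w.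
  by rewrite !simple_integralE big_distrlr.
have eg z : cutvalue S t z * cutvalue S' t' z =
    \sum_(i < simple_size S) \sum_(j < simple_size S') gij i j z.
  rewrite !cutvalueE// big_distrlr/=; apply: eq_bigr => i _; apply: eq_bigr => j _.
  by rewrite /gij mulrACA.
have Ifi (i : 'I_(simple_size S)) : Rintegrable P (fun w => \sum_(j < simple_size S') fij i j w).
  by apply: Rintegrable_sum => j; case: (hf i j).
have Igi (i : 'I_(simple_size S)) : Rintegrable PL (fun z => \sum_(j < simple_size S') gij i j z).
  by apply: Rintegrable_sum => j; case: (hg i j).
rewrite (funext ef) (funext eg); split; [exact: Rintegrable_sum|exact: Rintegrable_sum|].
rewrite !Rintegral_sum//; apply: eq_bigr => i _.
rewrite !Rintegral_sum.
- by apply: eq_bigr => j _; rewrite (hf i j).2 (hg i j).2.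
- by move=> j; case: (hg i j).
- by move=> j; case: (hf i j).
Qed.

(** An [F 0]-measurable factor can be merged into every coefficient without losing adaptedness, and
    each increment has conditional mean 0. *)
Lemma simple_orth S t Z : 0 <= t -> measurable_wrt (F 0) Z -> Rintegrable P Z ->
  Rintegrable P (fun w => Z w * simple_integral W S t w) /\
  \int[P]_w (Z w * simple_integral W S t w) = 0.
Proof.
move=> t0 mZ IZ.
pose g i w := simple_coef S i w * Z w * incr W (cut S t i) (cut S t i.+1) w.
have hg i : Rintegrable P (g i) /\ \int[P]_w g i w = 0.
  have [c0 ccS mc ac bc] := simple_elementary S i t0.
  apply: (incr_mean hF hW) => //.
    move=> ab; apply: measurable_wrtM; first exact: ac.
    by apply: (measurable_wrt_le hF (lexx 0) c0).
  exact: Rintegrable_boundedM.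
have e w : Z w * simple_integral W S t w = \sum_(i < simple_size S) g i w.
  by rewrite simple_integralE mulr_sumr; apply: eq_bigr => i _; rewrite /g; ring.
rewrite (funext e); split; first by apply: Rintegrable_sum => i; case: (hg i).
rewrite Rintegral_sum; first by rewrite big1// => i _; case: (hg i).
by move=> i; case: (hg i).
Qed.

Lemma measurable_simple_integral S t : 0 <= t ->
  measurable_fun [set: Omega] (simple_integral W S t).
Proof.
move=> t0; have [+ _] := @simple_orth S t (fun=> 1) t0 (measurable_cst _) (finite_measure_integrable_cst P 1 measurableT).
by move=> /Rintegrable_measurable; under eq_fun do rewrite mul1r.
Qed.

Lemma measurable_cutvalue S t : 0 <= t ->
  measurable_fun [set: Omega * R] (cutvalue S t).
Proof.
move=> t0; rewrite (_ : cutvalue S t = fun z => \sum_(i < simple_size S) simple_coef S i z.1 *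
    \1_(`]cut S t i, cut S t i.+1]) z.2); last by apply/funext => z; exact: cutvalueE.
apply: measurable_sum => i; apply: measurable_funM.
  exact: measurableT_comp (simple_coef_measurable S i) _.
by apply: (measurableT_comp (measurable_indic _)).
Qed.

Lemma simple_isometry S S' t : 0 <= t ->
  \int[P]_w (simple_integral W S t w - simple_integral W S' t w) ^+ 2 =
  \int[PL]_z (cutvalue S t z - cutvalue S' t z) ^+ 2.
Proof.
move=> t0.
have [I1 J1 E1] := simple_cov S S t0 t0.
have [I2 J2 E2] := simple_cov S S' t0 t0.
have [I3 J3 E3] := simple_cov S' S' t0 t0.
have e (T : Type) (a b : T -> R) : (fun w => (a w - b w) ^+ 2) =
  (fun w => (a w * a w - 2 * (a w * b w)) + b w * b w) by apply/funext => w; ring.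
rewrite !e.
rewrite (RintegralTD (RintegrableB I1 (RintegrableZ 2 I2)) I3).
rewrite (RintegralTD (RintegrableB J1 (RintegrableZ 2 J2)) J3).
rewrite (RintegralTB I1 (RintegrableZ 2 I2)) (RintegralTB J1 (RintegrableZ 2 J2)).
by rewrite (RintegralTZ 2 I2) (RintegralTZ 2 J2) E1 E2 E3.
Qed.

(** Disjointness of the intervals makes the pathwise energy a finite sum whose partial sums are
    adapted; this is what allows stopping in [lenglart]. *)
Lemma cutvalue_sqr S t w : 0 <= t ->
  Rintegrable leb (fun s => cutvalue S t (w, s) ^+ 2) /\
  \int[leb]_s (cutvalue S t (w, s) ^+ 2) =
    \sum_(i < simple_size S) simple_coef S i w ^+ 2 * cutlen S t i.
Proof.
move=> t0.
have e s : cutvalue S t (w, s) ^+ 2 = \sum_(i < simple_size S)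
    simple_coef S i w ^+ 2 * \1_(`]cut S t i, cut S t i.+1]) s.
  rewrite -(step_value_patch S (fun i => simple_coef S i w ^+ 2) s t0) /cutvalue/=.
  have [st|st] := boolP (0 <= s <= t); last by rewrite !patch_itv_out// expr0n.
  rewrite !patch_itv_in//.
  by apply: (@step_value_map S (fun r => r ^+ 2) (fun i => simple_coef S i w)); rewrite expr0n.
have Ii i : Rintegrable leb (fun s => \1_(`]cut S t i, cut S t i.+1]) s : R).
  exact: integrable_indic_itv.
rewrite (funext e); split.
  by apply: Rintegrable_sum => i; exact: RintegrableZ.
rewrite Rintegral_sum; last by move=> i; exact: RintegrableZ.
apply: eq_bigr => i _; rewrite RintegralTZ//; congr (_ * _).
rewrite /Rintegral integral_indic//= setIT lebesgue_measure_itv/= lte_fin /cutlen.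
by have := cut_le S t i; rewrite le_eqVlt => /predU1P[->|->] //=; rewrite ltxx subrr.
Qed.

(** Stopping, clipping and taking residues all keep the time grid and change the coefficients
    only. *)
Definition recoef S (c : nat -> Omega -> R)
    (mc : forall i, measurable_wrt (F (simple_time S i)) (c i))
    (bc : forall i, exists M, forall w, `|c i w| <= M) : simple_process F :=
  SimpleProcess (simple_size S) (simple_time0 S) (@simple_time_le _ _ _ _ S) mc bc.

End simple.

(** * Clipping, and a stopping inequality for simple integrals *)

Section clip.
Context {R : realType}.
Implicit Types M x y : R.

Definition clip M x := Num.max (- M) (Num.min M x).

Lemma clipP M x : 0 <= M ->
  [\/ x <= - M /\ clip M x = - M, - M <= x <= M /\ clip M x = x | M <= x /\ clip M x = M].
Proof.
move=> M0; have [xM|] := boolP (M <= x).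
  by constructor 3; split => //; rewrite /clip (min_l xM) max_r//; lra.
rewrite -ltNge => /ltW xM; have [Mx|] := boolP (x <= - M).
  by constructor 1; split => //; rewrite /clip (min_r xM) max_l.
rewrite -ltNge => /ltW Mx; constructor 2; split; first by rewrite Mx.
by rewrite /clip (min_r xM) max_r.
Qed.

Lemma clip0 M : 0 <= M -> clip M 0 = 0.
Proof. by move=> M0; have [[]|[]|[]] := clipP 0 M0; lra. Qed.

Lemma norm_clip M x : 0 <= M -> `|clip M x| <= M.
Proof. by move=> M0; rewrite ler_norml; have [[? ->]|[? ->]|[? ->]] := clipP x M0; lra. Qed.

Lemma clip_id M x : `|x| <= M -> clip M x = x.
Proof.
move=> xM; have M0 : 0 <= M by exact: le_trans xM.
by move: xM; rewrite ler_norml; have [[? ->]|[? ->]|[? ->]] := clipP x M0; lra.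
Qed.

Lemma norm_clipE M x : 0 <= M -> `|clip M x| = Num.min `|x| M.
Proof.
move=> M0; have [[h ->]|[h ->]|[h ->]] := clipP x M0.
- by rewrite normrN (ger0_norm M0) min_r// ler0_norm; lra.
- by rewrite min_l// ler_norml.
- by rewrite (ger0_norm M0) min_r// ger0_norm; lra.
Qed.

Lemma clip_lip M x y : 0 <= M -> `|clip M x - clip M y| <= `|x - y|.
Proof.
move=> M0; have h1 := ler_norm (x - y); have h2 := lerNnormlW (lexx `|x - y|).
by rewrite ler_norml; have [[? ->]|[? ->]|[? ->]] := clipP x M0;
  have [[? ->]|[? ->]|[? ->]] := clipP y M0; lra.
Qed.

(** Like [clip M], its complement is piecewise linear with slopes 0 and 1. Hence closeness of an
    approximation passes both to the clipped part and to the residue. *)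
Lemma clip_res_lip M x y : 0 <= M ->
  `|(x - clip M x) - (y - clip M y)| <= `|x - y|.
Proof.
move=> M0; have h1 := ler_norm (x - y); have h2 := lerNnormlW (lexx `|x - y|).
by rewrite ler_norml; have [[? ->]|[? ->]|[? ->]] := clipP x M0;
  have [[? ->]|[? ->]|[? ->]] := clipP y M0; lra.
Qed.

Lemma measurable_clip M : measurable_fun [set: R] (clip M).
Proof. by apply: measurable_maxr => //; exact: measurable_minr. Qed.

End clip.

Section markov.
Context d (Omega : measurableType d) (R : realType) (P : probability Omega R).

Lemma measurable_gtr (f : Omega -> R) (a : R) : measurable_fun [set: Omega] f ->
  measurable [set w | a < f w].
Proof.
move=> mf; rewrite -[X in measurable X]setTI.
have := mf measurableT `]a, +oo[%classic (measurable_itv _).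
by congr measurable; apply/seteqP; split => w /=; rewrite in_itv/= andbT.
Qed.

Lemma markov_ineq (Y : Omega -> R) (a : R) : 0 < a -> (forall w, 0 <= Y w) ->
  Rintegrable P Y -> (P [set w | (a < Y w)%R] <= (\int[P]_w Y w / a)%:E)%E.
Proof.
move=> a0 Y0 IY; have mY := Rintegrable_measurable IY.
have mA := measurable_gtr a mY.
rewrite -(setIT [set w | a < Y w]) -integral_indic//.
have IA : Rintegrable P (\1_[set w | a < Y w] : Omega -> R) by exact: integrable_indic.
rewrite (Rintegral_EFin IA) lee_fin ler_pdivlMr// mulrC -RintegralTZ//.
apply: le_RintegralT => //; first exact: RintegrableZ.
move=> w; rewrite indicE; have [/set_mem/= aY|_] := boolP (w \in _).
  by rewrite mulr1 ltW.
by rewrite mulr0.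
Qed.

End markov.

Section lenglart.
Context {d : measure_display} {Omega : measurableType d} {R : realType}.
Variables (P : probability Omega R) (F : R -> set (set Omega)) (W : R -> Omega -> R).
Hypotheses (hF : usual_filtration P F) (hW : brownian_motion P F W).
Local Notation leb := (@lebesgue_measure R).
Local Notation PL := (P \x leb)%E.
Implicit Types (S : simple_process F) (t s : R).

(** The induction carries a second bound by the full partial sum: when the last term is kept, that
    partial sum is at most [e]. *)
Lemma sum_stopped (a : nat -> R) (e : R) n : 0 <= e -> (forall i, 0 <= a i) ->
  \sum_(i < n) (if \sum_(j < i.+1) a j <= e then a i else 0) <= e.
Proof.
move=> e0 a0.
suff [] : \sum_(i < n) (if \sum_(j < i.+1) a j <= e then a i else 0) <= e /\
  \sum_(i < n) (if \sum_(j < i.+1) a j <= e then a i else 0) <= \sum_(j < n) a j by [].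
elim: n => [|n [IH1 IH2]]; first by rewrite !big_ord0.
rewrite !big_ord_recr/=; case: ifPn => h.
  by split; [apply: le_trans h; rewrite lerD2r|rewrite lerD2r].
by rewrite addr0; split => //; rewrite (le_trans IH2)// lerDl.
Qed.

Let energy S t i w : R := \sum_(j < i) simple_coef S j w ^+ 2 * cutlen S t j.

(** The test counts interval [i] itself. It is still decided at time [t_i], since the energy
    involves the coefficients up to [i] and deterministic lengths. *)
Let stop_coef S t (e : R) i w : R :=
  simple_coef S i w * (energy S t i.+1 w <= e)%R%:R.

Let measurable_energy S t i : measurable_wrt (F (simple_time S i)) (energy S t i.+1).
Proof.
rewrite /measurable_wrt; apply: measurable_sum => j.
apply: measurable_funM => //; apply: measurable_funX.
apply: (measurable_wrt_le hF (simple_time_ge0 S j)); last exact: simple_measurable.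
by apply: simple_time_le; rewrite -ltnS.
Qed.

Let stop_coef_measurable S t e i :
  measurable_wrt (F (simple_time S i)) (stop_coef S t e i).
Proof.
apply: measurable_wrtM; first exact: simple_measurable.
rewrite /measurable_wrt.
have -> : (fun w => (energy S t i.+1 w <= e)%R%:R) =
    (fun r : R => \1_(`]-oo, e]) r) \o energy S t i.+1 :> (g_sigma_algebraType (F (simple_time S i)) -> R).
  apply/funext => w /=; rewrite indicE; congr (nat_of_bool _)%:R.
  by apply/idP/idP; rewrite inE/= in_itv.
apply: measurableT_comp; last exact: measurable_energy.
exact: measurable_indic.
Qed.

Let stop_coef_bounded S t e i : exists M, forall w, `|stop_coef S t e i w| <= M.
Proof.
have [M xM] := Defs.simple_bounded S i; exists M => w; rewrite /stop_coef.
by case: (_ <= e); rewrite ?mulr1 ?mulr0// normr0 (le_trans _ (xM w)).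
Qed.

Let stopped S t (e : R) : simple_process F :=
  recoef (@stop_coef_measurable S t e) (@stop_coef_bounded S t e).

(* Stopping each coefficient once the accumulated energy exceeds [e] leaves a
   simple process with energy at most [e], to which the isometry applies. *)
Lemma lenglart S t (e a : R) : 0 <= t -> 0 <= e -> 0 < a ->
  (P [set w | (a < `|simple_integral W S t w|)%R] <=
   P [set w | (e < \int[leb]_s (cutvalue S t (w, s) ^+ 2))%R] + (e / a ^+ 2)%:E)%E.
Proof.
move=> t0 e0 a0.
have mI (S' : simple_process F) := measurable_simple_integral hF hW S' t0.
have mB (S' : simple_process F) : measurable [set w | a < `|simple_integral W S' t w|].
  by apply: measurable_gtr; exact: measurableT_comp.
have mE : measurable_fun [set: Omega] (energy S t (simple_size S)).
  apply: measurable_sum => j; apply: measurable_funM => //; apply: measurable_funX.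
  exact: (simple_coef_measurable hF).
have mA := measurable_gtr e mE.
have -> : [set w | e < \int[leb]_s (cutvalue S t (w, s) ^+ 2)] =
    [set w | e < energy S t (simple_size S) w].
  by apply/seteqP; split => w /=; rewrite (cutvalue_sqr S w t0).2.
(* Where the total energy is at most [e], all tests succeed and the stopped integral equals the
   original one. *)
apply: (@le_trans _ _ (P ([set w | e < energy S t (simple_size S) w] `|`
    [set w | a < `|simple_integral W (stopped S t e) t w|]))).
  apply: le_measure; rewrite ?inE//; first exact: measurableU.
  move=> w /= aw; have [h|h] := ltP e (energy S t (simple_size S) w); [by left|right].
  suff -> : simple_integral W (stopped S t e) t w = simple_integral W S t w by [].
  rewrite !simple_integralE; apply: eq_bigr => i _; congr (_ * _).
  rewrite /= /stop_coef (_ : _ <= e) ?mulr1//; apply: le_trans h.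
  rewrite /energy (big_ord_widen (simple_size S) (fun j => simple_coef S j w ^+ 2 * cutlen S t j))//.
  rewrite [leRHS](bigID (fun j : 'I_(simple_size S) => (j < i.+1)%N))/= lerDl.
  by apply: sumr_ge0 => j _; rewrite mulr_ge0 ?sqr_ge0 ?cutlen_ge0.
apply: (le_trans (measureU2 P mA (mB _))); apply: leeD => //.
have [I1 J1 E1] := simple_cov hF hW (stopped S t e) (stopped S t e) t0 t0.
have eB : [set w | a < `|simple_integral W (stopped S t e) t w|] =
    [set w | a ^+ 2 < simple_integral W (stopped S t e) t w * simple_integral W (stopped S t e) t w].
  apply/seteqP; split => w /=; rewrite -expr2 -[X in _ ^+ 2 < X]real_normK ?num_real//;
    by rewrite ltr_pXn2r ?nnegrE// ltW.
rewrite eB; apply: (le_trans (markov_ineq _ _ I1)).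
- by rewrite exprn_gt0.
- by move=> w; rewrite -expr2 sqr_ge0.
rewrite lee_fin ler_wpM2r ?invr_ge0 ?sqr_ge0// E1 -(Rfubini1 J1)/=.
have IC : Rintegrable P (fun=> e) by exact: (finite_measure_integrable_cst P e).
apply: (@le_trans _ _ (\int[P]_w e)); last first.
  by rewrite Rintegral_cst//= probability_setT mulr1.
apply: le_RintegralT => //; first exact: (Rintegrable_fubini1 J1).
move=> w; under eq_Rintegral do rewrite -expr2.
rewrite (cutvalue_sqr (stopped S t e) w t0).2.
pose c i := simple_coef S i w ^+ 2 * cutlen S t i.
have c0 i : 0 <= c i by rewrite mulr_ge0 ?sqr_ge0 ?cutlen_ge0.
apply: le_trans (sum_stopped (simple_size S) e0 c0).
apply: eq_implies_le; apply: eq_bigr => i _.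
by rewrite /= /stop_coef /c; case: ifPn => h; rewrite ?mulr1 // mulr0 expr0n/= mul0r.
Qed.

End lenglart.

(** * The Ito integral of square integrable processes *)

Lemma cvge0_lt {R : realType} (u : nat -> \bar R) (e : R) : u @ \oo --> 0%E -> 0 < e ->
  exists N, forall n, (N <= n)%N -> (u n < e%:E)%E.
Proof.
move=> /fine_cvgP[ufin u0] e0.
have [N _ HN] : \forall n \near \oo, (u n < e%:E)%E.
  have ue := cvgr_lt 0 u0 _ e0.
  near=> n; have un : u n \is a fin_num by near: n.
  by rewrite -(fineK un) lte_fin; near: n; exact: ue.
by exists N => n Nn; exact: HN.
Unshelve. all: by end_near. Qed.

Section square_integrable.
Context {d : measure_display} {T : measurableType d} {R : realType}.
Variable mu : {measure set T -> \bar R}.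
Implicit Types a b : T -> R.

Definition L2 a := measurable_fun [set: T] a /\ Rintegrable mu (fun x => a x ^+ 2).

Lemma L2M a b : L2 a -> L2 b -> Rintegrable mu (fun x => a x * b x).
Proof. by move=> [ma Ia] [mb Ib]; exact: RintegrableM. Qed.

Lemma L2B a b : L2 a -> L2 b -> L2 (fun x => a x - b x).
Proof.
move=> La Lb; split; first exact: measurable_funB La.1 Lb.1.
have e x : (a x - b x) ^+ 2 = a x ^+ 2 - 2 * (a x * b x) + b x ^+ 2 by ring.
rewrite (funext e); apply: RintegrableD; last exact: Lb.2.
by apply: RintegrableB; [exact: La.2|apply: RintegrableZ; exact: L2M].
Qed.

Lemma le_L2 a b : measurable_fun [set: T] a -> (forall x, `|a x| <= `|b x|) ->
  L2 b -> L2 a.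
Proof.
move=> ma ab [mb Ib]; split => //; apply: (le_Rintegrable _ _ Ib).
  exact: measurable_funX.
move=> x; rewrite normrX -(real_normK (num_real (b x))) ler_pXn2r ?nnegrE//.
Qed.

Lemma L2_sqrB_le a b c (e e' : R) : L2 a -> L2 b -> L2 c ->
  \int[mu]_x (a x - b x) ^+ 2 <= e -> \int[mu]_x (b x - c x) ^+ 2 <= e' ->
  \int[mu]_x (a x - c x) ^+ 2 <= 2 * (e + e').
Proof.
move=> La Lb Lc he he'.
have Iab := (L2B La Lb).2; have Ibc := (L2B Lb Lc).2; have Iac := (L2B La Lc).2.
apply: (@le_trans _ _ (\int[mu]_x (2 * ((a x - b x) ^+ 2 + (b x - c x) ^+ 2)))).
  apply: le_RintegralT => //; first by apply: RintegrableZ; exact: RintegrableD.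
  by move=> x; have := sqr_ge0 ((a x - b x) - (b x - c x)); nra.
rewrite RintegralTZ; last exact: RintegrableD.
by rewrite RintegralTD// ler_wpM2l// lerD.
Qed.

(** With [p = a - a'] and [q = b - b'], the difference is [a q + b p - p q]. Young's inequality puts
    weight [r] on [a^2], [b^2] and [1 / r] on [p^2], [q^2]; as the latter have integrals at most
    [r^2], every term is of order [r]. *)
Lemma L2_inner_close a a' b b' (r : R) : L2 a -> L2 a' -> L2 b -> L2 b' ->
  0 < r -> r <= 1 ->
  \int[mu]_x (a x - a' x) ^+ 2 <= r ^+ 2 -> \int[mu]_x (b x - b' x) ^+ 2 <= r ^+ 2 ->
  `|\int[mu]_x (a x * b x) - \int[mu]_x (a' x * b' x)| <=
    r * (2 + \int[mu]_x (a x ^+ 2) + \int[mu]_x (b x ^+ 2)).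
Proof.
move=> La La' Lb Lb' r0 r1 ha hb.
have Iab := L2M La Lb; have Iab' := L2M La' Lb'.
have Iaa := (L2B La La').2; have Ibb := (L2B Lb Lb').2.
have ID := RintegrableB Iab Iab'.
rewrite -RintegralTB//; apply: (le_trans (le_normr_Rintegral measurableT ID)).
pose G x := r * (a x ^+ 2 + b x ^+ 2) + r^-1 * ((a x - a' x) ^+ 2 + (b x - b' x) ^+ 2).
have IG1 : Rintegrable mu (fun x => a x ^+ 2 + b x ^+ 2) by apply: RintegrableD; [case: La|case: Lb].
have IG2 : Rintegrable mu (fun x => (a x - a' x) ^+ 2 + (b x - b' x) ^+ 2) by exact: RintegrableD.
have IG : Rintegrable mu G by apply: RintegrableD; exact: RintegrableZ.
have ri : 1 <= r^-1 by rewrite invf_ge1.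
apply: (@le_trans _ _ (\int[mu]_x G x)).
  apply: le_RintegralT => //; first exact: Rintegrable_norm.
  move=> x; rewrite /G; set p := a x - a' x; set q := b x - b' x.
  have -> : a x * b x - a' x * b' x = a x * q + b x * p - p * q by rewrite /p /q; ring.
  have am (u v : R) : `|u * v| <= 2^-1 * (r * u ^+ 2 + r^-1 * v ^+ 2).
    rewrite normrM -(real_normK (num_real u)) -(real_normK (num_real v)).
    have h : 0 <= (r * `|u| - `|v|) ^+ 2 / r by rewrite divr_ge0 ?sqr_ge0// ltW.
    have e : (r * `|u| - `|v|) ^+ 2 / r = r * `|u| ^+ 2 + r^-1 * `|v| ^+ 2 - 2 * (`|u| * `|v|).
      by field; rewrite gt_eqF.
    by rewrite e in h; lra.
  have pq : `|p * q| <= 2^-1 * (r^-1 * p ^+ 2 + r^-1 * q ^+ 2).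
    apply: (@le_trans _ _ (2^-1 * (p ^+ 2 + q ^+ 2))).
      rewrite normrM -(real_normK (num_real p)) -(real_normK (num_real q)).
      by have := sqr_ge0 (`|p| - `|q|); nra.
    by rewrite ler_wpM2l// lerD// -[leLHS]mul1r ler_wpM2r ?sqr_ge0.
  have := am (a x) q; have := am (b x) p.
  apply: (fun h1 h2 => le_trans (le_trans (ler_normB _ _) (lerD (ler_normD _ _) pq)) _) => h1 h2.
  have ha0 : 0 <= r * a x ^+ 2 by rewrite mulr_ge0 ?sqr_ge0// ltW.
  have hb0 : 0 <= r * b x ^+ 2 by rewrite mulr_ge0 ?sqr_ge0// ltW.
  by lra.
rewrite (RintegralTD (RintegrableZ r IG1) (RintegrableZ r^-1 IG2)).
rewrite (RintegralTZ r IG1) (RintegralTZ r^-1 IG2).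
rewrite (RintegralTD La.2 Lb.2) (RintegralTD Iaa Ibb).
have : r^-1 * (\int[mu]_x (a x - a' x) ^+ 2 + \int[mu]_x (b x - b' x) ^+ 2) <= r^-1 * (r ^+ 2 + r ^+ 2).
  by rewrite ler_wpM2l ?invr_ge0 ?(ltW r0)// lerD.
have -> : r^-1 * (r ^+ 2 + r ^+ 2) = 2 * r by field; rewrite gt_eqF.
by lra.
Qed.

(* Dominated convergence, as [(a - clip n a)^2 <= a^2] vanishes for large [n]. *)
Lemma L2_clip a (e : R) : L2 a -> 0 < e ->
  exists2 M : R, 0 <= M & \int[mu]_x (a x - clip M (a x)) ^+ 2 <= e.
Proof.
move=> [ma Ia] e0.
pose f_ n x : R := (a x - clip n%:R (a x)) ^+ 2.
have mf n : measurable_fun [set: T] (f_ n).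
  apply: measurable_funX; apply: measurable_funB => //.
  exact: measurableT_comp (measurable_clip _) ma.
have le n x : `|f_ n x| <= a x ^+ 2.
  rewrite /f_ normrX -(real_normK (num_real (a x))) ler_pXn2r ?nnegrE//.
  have := @clip_res_lip _ n%:R (a x) 0 (ler0n _ _).
  by rewrite clip0// !subr0.
have If n : Rintegrable mu (f_ n) by apply: (le_Rintegrable (mf n) (le n) Ia).
have h1 : {ae mu, forall x, [set: T] x -> (fun n => (EFin \o f_ n) x) @ \oo --> 0%E}.
  apply: aeW => x _; apply: cvg_near_cst.
  near=> n; rewrite /= /f_ clip_id ?subrr ?expr0n//.
  by near: n; exact: nbhs_infty_ger.
have h2 : {ae mu, forall x n, [set: T] x -> (`|(EFin \o f_ n) x| <= (a x ^+ 2)%:E)%E}.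
  by apply: aeW => x n _; rewrite /= lee_fin.
have mfE n : measurable_fun [set: T] (EFin \o f_ n) by exact/measurable_EFinP.
have [_ _ cv] := dominated_convergence measurableT mfE (measurable_cst _) h1 Ia h2.
rewrite integral0 in cv.
have [N HN] := cvge0_lt cv e0.
exists N%:R => //; have := HN N (leqnn N).
by rewrite /= (Rintegral_EFin (If N)) lte_fin => /ltW.
Unshelve. all: by end_near. Qed.

(** The squared clips increase to [a^2], so monotone convergence applies. Square integrability is a
    conclusion, as it must be for an Ito integral known only as a limit in probability. *)
Lemma L2_clip_bound a (e : R) : measurable_fun [set: T] a ->
  (forall n : nat, (\int[mu]_x ((clip n%:R (a x)) ^+ 2)%:E <= e%:E)%E) ->
  L2 a /\ \int[mu]_x (a x ^+ 2) <= e.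
Proof.
move=> ma h.
pose g n x : \bar R := ((clip n%:R (a x)) ^+ 2)%:E.
have mg n : measurable_fun [set: T] (g n).
  apply/measurable_EFinP; apply: measurable_funX.
  exact: (measurableT_comp (measurable_clip _) ma).
have g0 n x : [set: T] x -> (0 <= g n x)%E by rewrite lee_fin sqr_ge0.
have ndg x : [set: T] x -> nondecreasing_seq (g ^~ x).
  move=> _ m n mn; rewrite lee_fin -real_normK ?num_real// -[leRHS]real_normK ?num_real//.
  rewrite ler_pXn2r ?nnegrE// !norm_clipE// le_min ge_min lexx/=.
  by rewrite ge_min ler_nat mn orbT.
have limg x : limn (g ^~ x) = (a x ^+ 2)%:E.
  apply/cvg_lim => //; apply: cvg_near_cst.
  near=> n; rewrite /g clip_id//.
  by near: n; exact: nbhs_infty_ger.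
have El : (\int[mu]_x limn (g ^~ x) = \int[mu]_x (a x ^+ 2)%:E)%E.
  by apply: eq_integral => x _; exact: limg.
have cv : (\int[mu]_x g n x)%E @[n --> \oo] --> (\int[mu]_x (a x ^+ 2)%:E)%E.
  by rewrite -El; exact: cvg_monotone_convergence.
have le : (\int[mu]_x (a x ^+ 2)%:E <= e%:E)%E.
  by apply: (cvge_to_le cv); apply: nearW => n; exact: h.
have Ia : Rintegrable mu (fun x => a x ^+ 2).
  apply: Rintegrable_lty; [exact: measurable_funX|by move=> x; rewrite sqr_ge0|].
  by apply: le_lt_trans le _; rewrite ltry.
by split => //; rewrite -lee_fin -Rintegral_EFin.
Unshelve. all: by end_near. Qed.

(** With [m = |clip N u|], the excess [m^2 - v^2 = (m - |v|) (m + |v|)], if positive, has first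
    factor at most [r] and second at most [2 N]. *)
Lemma clip_sqr_le (N u v r : R) : 0 <= N -> `|u - v| <= r ->
  (clip N u) ^+ 2 <= v ^+ 2 + 2 * N * r.
Proof.
move=> N0 uv; rewrite -real_normK ?num_real// -[v ^+ 2]real_normK ?num_real//.
have h1 := norm_clip u N0.
have h2 : `|clip N u| <= `|v| + r.
  have := clip_lip u 0 N0; rewrite clip0// !subr0 => h.
  by have := ler_normD (u - v) v; rewrite subrK; lra.
have r0 : 0 <= r by apply: le_trans uv.
have Nr : 0 <= 2 * N * r by rewrite !mulr_ge0.
set m := `|clip N u| in h1 h2 *; have m0 : 0 <= m by rewrite /m.
have v0 := normr_ge0 v; have [mv|mv] := leP m `|v|.
  have : m ^+ 2 <= `|v| ^+ 2 by rewrite ler_pXn2r ?nnegrE.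
  by lra.
have -> : m ^+ 2 = `|v| ^+ 2 + (m - `|v|) * (m + `|v|) by ring.
rewrite lerD2l mulrC; apply: ler_pM; lra.
Qed.

End square_integrable.

Section ito.
Context {d : measure_display} {Omega : measurableType d} {R : realType}.
Variables (P : probability Omega R) (F : R -> set (set Omega)) (W : R -> Omega -> R).
Hypotheses (hF : usual_filtration P F) (hW : brownian_motion P F W).
Local Notation leb := (@lebesgue_measure R).
Local Notation PL := (P \x leb)%E.
Implicit Types (S : simple_process F) (t s : R).

Lemma measurable_gte (f : Omega -> \bar R) (a : \bar R) : measurable_fun [set: Omega] f ->
  measurable [set w | (a < f w)%E].
Proof.
move=> mf; rewrite -[X in measurable X]setTI.
exact: (emeasurable_fun_o_infty measurableT mf a).
Qed.

Lemma measurable_section (f : Omega * R -> R) w : measurable_fun [set: Omega * R] f ->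
  measurable_fun [set: R] (fun s => f (w, s)).
Proof. by move=> mf; apply: (measurableT_comp mf); exact: measurable_fun_pair. Qed.

Lemma simple_integral_L2 S t : 0 <= t -> L2 P (simple_integral W S t).
Proof.
move=> t0; split; first exact: (measurable_simple_integral hF hW).
by have [] := simple_cov hF hW S S t0 t0.
Qed.

Lemma cutvalue_L2 S t : 0 <= t -> L2 PL (cutvalue S t).
Proof.
move=> t0; split; first exact: (measurable_cutvalue hF).
by have [] := simple_cov hF hW S S t0 t0.
Qed.

Variables (H : R -> Omega -> R) (t : R) (I : Omega -> R).
Hypotheses (t0 : 0 <= t) (hI : ito_integral P F W H t I).

Definition cutproc (z : Omega * R) : R := ((fun s => H s z.1) \_ `[0, t]) z.2.

Hypothesis LH : L2 PL cutproc.

Let mH : measurable_fun [set: Omega * R] cutproc := LH.1.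
Let mI : measurable_fun [set: Omega] I. Proof. by case: hI. Qed.

Let err S w : \bar R := (\int[leb]_s ((cutvalue S t (w, s) - cutproc (w, s)) ^+ 2)%:E)%E.

Let mdiff S : measurable_fun [set: Omega * R] (fun z => cutvalue S t z - cutproc z).
Proof. by apply: measurable_funB => //; exact: (measurable_cutvalue hF). Qed.

Let measurable_err S : measurable_fun [set: Omega] (err S).
Proof.
apply: (@measurable_fun_fubini_tonelli_F _ _ _ _ _ leb
  (fun z : Omega * R => ((cutvalue S t z - cutproc z) ^+ 2)%:E)) => //.
  by apply/measurable_EFinP; apply: measurable_funX; exact: mdiff.
by move=> z; rewrite lee_fin sqr_ge0.
Qed.

Let err_ge0 S w : (0 <= err S w)%E.
Proof. by apply: integral_ge0 => s _; rewrite lee_fin sqr_ge0. Qed.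

Let errE S w : (\int[leb]_(s in `[0%R, t]) ((simple_value S s w - H s w) ^+ 2)%:E)%E = err S w.
Proof.
rewrite integral_mkcond; apply: eq_integral => s _; rewrite /cutvalue /cutproc/= !patchE.
by case: ifP => // _; rewrite subrr expr0n.
Qed.

Let err_le S w (e : R) : (err S w <= e%:E)%E ->
  Rintegrable leb (fun s => (cutvalue S t (w, s) - cutproc (w, s)) ^+ 2) /\
  \int[leb]_s ((cutvalue S t (w, s) - cutproc (w, s)) ^+ 2) <= e.
Proof.
move=> he; have I1 : Rintegrable leb (fun s => (cutvalue S t (w, s) - cutproc (w, s)) ^+ 2).
  apply: Rintegrable_lty.
  - by apply: measurable_funX; exact: (measurable_section w (mdiff S)).
  - by move=> s; rewrite sqr_ge0.
  - by apply: le_lt_trans he _; rewrite ltry.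
by split => //; rewrite -lee_fin -Rintegral_EFin.
Qed.

Section clipped.
Variable M : R.
Hypothesis M0 : 0 <= M.

Let clip_coef_measurable S i :
  measurable_wrt (F (simple_time S i)) (fun w => clip M (simple_coef S i w)).
Proof.
rewrite /measurable_wrt; apply: (measurableT_comp (measurable_clip M)).
exact: simple_measurable.
Qed.

Let clip_coef_bounded S i : exists N, forall w, `|clip M (simple_coef S i w)| <= N.
Proof. by exists M => w; exact: norm_clip. Qed.

Let res_coef_measurable S i : measurable_wrt (F (simple_time S i))
  (fun w => simple_coef S i w - clip M (simple_coef S i w)).
Proof. by apply: measurable_wrtB; [exact: simple_measurable|exact: clip_coef_measurable]. Qed.

Let res_coef_bounded S i : exists N, forall w,
  `|simple_coef S i w - clip M (simple_coef S i w)| <= N.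
Proof.
have [N xN] := Defs.simple_bounded S i; exists (N + M) => w.
by rewrite (le_trans (ler_normB _ _))// lerD// norm_clip.
Qed.

Definition clipS S : simple_process F :=
  recoef (@clip_coef_measurable S) (@clip_coef_bounded S).

Definition resS S : simple_process F :=
  recoef (@res_coef_measurable S) (@res_coef_bounded S).

Lemma cutvalue_clipS S z : cutvalue (clipS S) t z = clip M (cutvalue S t z).
Proof.
rewrite /cutvalue !patchE; case: ifP => _; last by rewrite clip0.
apply/esym; apply: (@step_value_map _ _ _ _ S (clip M) (fun i => simple_coef S i z.1)).
exact: clip0.
Qed.

Lemma cutvalue_resS S z : cutvalue (resS S) t z = cutvalue S t z - clip M (cutvalue S t z).
Proof.
rewrite /cutvalue !patchE; case: ifP => _; last by rewrite clip0 ?subr0.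
apply/esym; apply: (@step_value_map _ _ _ _ S (fun x => x - clip M x) (fun i => simple_coef S i z.1)).
by rewrite clip0// subrr.
Qed.

Lemma simple_integral_clipS S w :
  simple_integral W (clipS S) t w = simple_integral W S t w - simple_integral W (resS S) t w.
Proof.
by rewrite /simple_integral/= -sumrB; apply: eq_bigr => i _; ring.
Qed.

Let clipH z := clip M (cutproc z).

Let LclipH : L2 PL clipH.
Proof.
apply: le_L2 LH; first exact: measurableT_comp (measurable_clip M) mH.
by move=> z; have := clip_lip (cutproc z) 0 M0; rewrite clip0// !subr0.
Qed.

Let cut_supp S z : ~~ (0 <= z.2 <= t) -> clip M (cutvalue S t z) - clipH z = 0.
Proof. by move=> zt; rewrite /clipH /cutvalue /cutproc !patch_itv_out// subrr. Qed.

(** Two clipped values differ by at most [2 M], so a path contributes at most [4 M^2 t] on the event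
    where [err] exceeds [e], and at most [e] elsewhere. *)
Lemma clipped_energy S (e : R) : 0 <= e ->
  \int[PL]_z (cutvalue (clipS S) t z - clipH z) ^+ 2 <=
    e + 4 * M ^+ 2 * t * fine (P [set w | (e%:E < err S w)%E]).
Proof.
move=> e0; pose A := [set w | (e%:E < err S w)%E].
have mA : measurable A by exact: measurable_gte.
have LD : L2 PL (fun z => cutvalue (clipS S) t z - clipH z).
  by apply: L2B => //; exact: cutvalue_L2.
have IA : Rintegrable P (\1_A : Omega -> R) by exact: integrable_indic.
have Ie : Rintegrable P (fun=> e) by exact: (finite_measure_integrable_cst P e).
have -> : e + 4 * M ^+ 2 * t * fine (P A) = \int[P]_w (e + 4 * M ^+ 2 * t * \1_A w).
  rewrite RintegralTD//; last exact: RintegrableZ.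
  rewrite RintegralTZ// Rintegral_cst//= probability_setT mulr1.
  by rewrite /Rintegral integral_indic// setIT.
rewrite -(Rfubini1 LD.2)/=; apply: le_RintegralT.
- exact: (Rintegrable_fubini1 LD.2).
- by apply: RintegrableD => //; exact: RintegrableZ.
move=> w.
have De s : (cutvalue (clipS S) t (w, s) - clipH (w, s)) ^+ 2 <= 4 * M ^+ 2 * \1_(`[0, t]) s.
  rewrite cutvalue_clipS; have [st|st] := boolP (0 <= s <= t).
    rewrite indicE mem_set/= ?in_itv// mulr1 -real_normK ?num_real//.
    have -> : 4 * M ^+ 2 = (2 * M) ^+ 2 by ring.
    rewrite ler_pXn2r ?nnegrE// ?mulr_ge0//.
    rewrite (le_trans (ler_normB _ _))// mulr_natl mulr2n lerD//; exact: norm_clip.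
  by rewrite cut_supp// expr0n/= mulr_ge0 ?mulr_ge0 ?sqr_ge0.
have Iind : Rintegrable leb (fun s => 4 * M ^+ 2 * (\1_(`[0, t]) s : R)).
  by apply: RintegrableZ; exact: integrable_indic_itv.
have ID : Rintegrable leb (fun s => (cutvalue (clipS S) t (w, s) - clipH (w, s)) ^+ 2).
  apply: (le_Rintegrable _ _ Iind).
    by apply: measurable_funX; exact: (measurable_section w LD.1).
  by move=> s; rewrite ger0_norm ?sqr_ge0.
rewrite indicE; have [wA|wA] := boolP (w \in A).
  rewrite mulr1; apply: (@le_trans _ _ (4 * M ^+ 2 * t)); last by rewrite lerDr.
  apply: (le_trans (le_RintegralT ID Iind De)).
  rewrite RintegralTZ; last exact: integrable_indic_itv.
  rewrite /Rintegral integral_indic//= setIT lebesgue_measure_itv/= lte_fin.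
  by case: ltP => _ /=; rewrite ?subr0// mulr0 mulr_ge0 ?mulr_ge0 ?sqr_ge0.
rewrite mulr0 addr0.
have : (err S w <= e%:E)%E by rewrite leNgt; apply: contra wA => h; rewrite inE.
move=> /err_le[I1]; apply: le_trans; apply: le_RintegralT => // s.
rewrite cutvalue_clipS -real_normK ?num_real// -[leRHS]real_normK ?num_real//.
by rewrite ler_pXn2r ?nnegrE//; exact: clip_lip.
Qed.

(** If the energy of the residue exceeds [e], then [err] or the energy of [cutproc - clipH] exceeds
    [e / 4], by [x^2 <= 2 ((x - y)^2 + y^2)]. [lenglart] passes from the integral to this energy,
    and Markov's inequality handles the second event. *)
Lemma residual_prob S (e a : R) : 0 < e -> 0 < a ->
  (P [set w | (a < `|simple_integral W (resS S) t w|)%R] <=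
   P [set w | ((e / 4)%:E < err S w)%E] +
   (\int[PL]_z (cutproc z - clipH z) ^+ 2 / (e / 4) + e / a ^+ 2)%:E)%E.
Proof.
move=> e0 a0; have e40 : 0 < e / 4 by rewrite divr_gt0.
apply: (le_trans (lenglart hF hW (resS S) t0 (ltW e0) a0)).
rewrite EFinD addeA; apply: leeD => //.
have LR : L2 PL (fun z => cutproc z - clipH z) by exact: L2B.
pose Kc w := \int[leb]_s (cutproc (w, s) - clipH (w, s)) ^+ 2.
have IK : Rintegrable P Kc := Rintegrable_fubini1 LR.2.
have K0 w : 0 <= Kc w by apply: Rintegral_ge0 => s _; rewrite sqr_ge0.
have mA : measurable [set w | ((e / 4)%:E < err S w)%E] by exact: measurable_gte.
have mB : measurable [set w | e / 4 < Kc w].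
  by apply: measurable_gtr; exact: (Rintegrable_measurable IK).
have mV : measurable_fun [set: Omega * R] (fun z => cutvalue (resS S) t z ^+ 2).
  by apply: measurable_funX; exact: (measurable_cutvalue hF).
apply: (@le_trans _ _ (P ([set w | ((e / 4)%:E < err S w)%E] `|` [set w | e / 4 < Kc w]))).
  apply: le_measure; rewrite ?inE//; [|exact: measurableU|].
    apply: measurable_gtr; exact: (measurable_fun_Rintegral leb mV).
  move=> w /= ew; apply: contrapT => /not_orP[/negP + /negP].
  rewrite -!leNgt => /err_le[I1 B1] B2.
  have [IV _] := cutvalue_sqr S w t0.
  (* [LH] gives square integrability along almost every path only; on this path it follows from the
     finite distance to the simple process. *)
  have IH2 : Rintegrable leb (fun s => cutproc (w, s) ^+ 2).
    apply: (le_Rintegrable _ _ (RintegrableZ 2 (RintegrableD I1 IV))).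
      by apply: measurable_funX; exact: (measurable_section w mH).
    move=> s; rewrite ger0_norm ?sqr_ge0//.
    by have := sqr_ge0 (cutproc (w, s) - 2 * cutvalue S t (w, s)); nra.
  have cc z : (cutproc z - clipH z) ^+ 2 <= cutproc z ^+ 2.
    rewrite -real_normK ?num_real// -[leRHS]real_normK ?num_real// ler_pXn2r ?nnegrE//.
    by have := clip_res_lip (cutproc z) 0 M0; rewrite clip0// !subr0.
  have IKw : Rintegrable leb (fun s => (cutproc (w, s) - clipH (w, s)) ^+ 2).
    apply: (le_Rintegrable _ _ IH2).
      by apply: measurable_funX; exact: (measurable_section w LR.1).
    by move=> s; rewrite ger0_norm ?sqr_ge0.
  move: ew; rewrite ltNge => /negP; apply.
  apply: (@le_trans _ _ (\int[leb]_s (2 * ((cutvalue S t (w, s) - cutproc (w, s)) ^+ 2 +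
      (cutproc (w, s) - clipH (w, s)) ^+ 2)))).
    apply: le_RintegralT.
    - by have [] := cutvalue_sqr (resS S) w t0.
    - by apply: RintegrableZ; exact: RintegrableD.
    move=> s; rewrite cutvalue_resS /clipH; set v := cutvalue _ _ _; set h := cutproc _.
    have L := clip_res_lip v h M0.
    have {}L : ((v - clip M v) - (h - clip M h)) ^+ 2 <= (v - h) ^+ 2.
      by rewrite -real_normK ?num_real// -[leRHS]real_normK ?num_real// ler_pXn2r ?nnegrE.
    have := sqr_ge0 ((v - clip M v) - 2 * (h - clip M h)).
    by move: L; set p := v - clip M v; set q := h - clip M h; nra.
  rewrite RintegralTZ; last exact: RintegrableD.
  rewrite RintegralTD// [leRHS](_ : e = 2 * (e / 4 + e / 4)); last by field.
  by rewrite ler_wpM2l// lerD.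
apply: (le_trans (measureU2 P mA mB)); apply: leeD => //.
by apply: (le_trans (markov_ineq e40 K0 IK)); rewrite /Kc (Rfubini1 LR.2).
Qed.

End clipped.

Lemma measureU3_le (A B C : set Omega) (a b : \bar R) : measurable A -> measurable B ->
  measurable C -> A `<=` B `|` C -> (P B <= a)%E -> (P C <= b)%E -> (P A <= a + b)%E.
Proof.
move=> mA mB mC ABC Ba Cb; apply: (@le_trans _ _ (P (B `|` C))).
  by apply: le_measure; rewrite ?inE//; exact: measurableU.
by apply: (le_trans (measureU2 P mB mC)); exact: leeD.
Qed.

(* Clipping the coefficients of the given approximations at level [M] makes them
   converge in mean square; the clipped-off part is controlled by [lenglart]. *)
Lemma ito_approx_prob (e : R) : 0 < e -> exists S : simple_process F,
  \int[PL]_z (cutvalue S t z - cutproc z) ^+ 2 <= e /\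
  (P [set w | (e < `|simple_integral W S t w - I w|)%R] <= e%:E)%E.
Proof.
move=> e0; have [_ _ [S [S1 S2]]] := hI.
(* [residual_prob] will be used with energy [b] and level [e / 2], and [b / (e / 2)^2 = e / 4]. The
   bound [r <= b * e / 16] makes [r / (b / 4)] at most [e / 4], while [r <= e / 4] serves the mean
   square estimate. *)
pose b := e ^+ 3 / 16.
have b0 : 0 < b by rewrite divr_gt0// exprn_gt0.
pose r := Num.min (e / 4) (b * e / 16).
have r0 : 0 < r by rewrite lt_min !divr_gt0// mulr_gt0.
have [M M0 HM] := L2_clip LH r0.
(* Chosen for [4 M^2 t * q <= e / 8]; the [+ 1] keeps the denominator positive when [M] or [t] is
   0. *)
pose q := e / (8 * (4 * M ^+ 2 * t + 1)).
have c0 : 0 <= 4 * M ^+ 2 * t by rewrite mulr_ge0// mulr_ge0// sqr_ge0.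
have q0 : 0 < q by rewrite divr_gt0// mulr_gt0// ltr_wpDl.
have Serr (a : R) : 0 < a -> P [set w | (a%:E < err (S n) w)%E] @[n --> \oo] --> 0%E.
  move=> a0; have := S1 a a0; apply: cvg_trans; apply: near_eq_cvg; apply: nearW => n.
  by congr (P _); apply/seteqP; split => w /=; rewrite errE gee0_abs.
have e8 : 0 < e / 8 by rewrite divr_gt0.
have e4 : 0 < e / 4 by rewrite divr_gt0.
have e2 : 0 < e / 2 by rewrite divr_gt0.
have b4 : 0 < b / 4 by rewrite divr_gt0.
have [N1 H1] := cvge0_lt (Serr _ e8) q0.
have [N2 H2] := cvge0_lt (Serr _ b4) e4.
have [N3 H3] := cvge0_lt (S2 _ e2) e4.
pose n := maxn N1 (maxn N2 N3).
have {}H1 : (P [set w | ((e / 8)%:E < err (S n) w)%E] < q%:E)%E.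
  by apply: H1; rewrite leq_maxl.
have {}H2 : (P [set w | ((b / 4)%:E < err (S n) w)%E] < (e / 4)%:E)%E.
  by apply: H2; rewrite /n maxnCA leq_maxl.
have {}H3 : (P [set w | (e / 2 < `|simple_integral W (S n) t w - I w|)%R] < (e / 4)%:E)%E.
  have -> : [set w | (e / 2 < `|simple_integral W (S n) t w - I w|)%R] =
    [set w | ((e / 2)%:E < `|(simple_integral W (S n) t w - I w)%:E|)%E] by [].
  by apply: H3; rewrite /n !leq_max leqnn !orbT.
have LM : L2 PL (fun z => clip M (cutproc z)).
  apply: le_L2 LH; first exact: measurableT_comp (measurable_clip M) mH.
  by move=> z; have := clip_lip (cutproc z) 0 M0; rewrite clip0// !subr0.
exists (clipS M0 (S n)); split.
  have h1 := clipped_energy M0 (S n) (ltW e8).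
  have h2 : \int[PL]_z (clip M (cutproc z) - cutproc z) ^+ 2 <= e / 4.
    apply: (@le_trans _ _ r); last by rewrite ge_min lexx.
    rewrite (_ : \int[PL]_z _ = \int[PL]_z (cutproc z - clip M (cutproc z)) ^+ 2)//.
    by apply: eq_Rintegral => z _; rewrite -sqrrN opprB.
  apply: (le_trans (L2_sqrB_le (cutvalue_L2 _ t0) LM LH h1 h2)).
  have Pfin : fine (P [set w | ((e / 8)%:E < err (S n) w)%E]) <= q.
    by rewrite -lee_fin fineK ?fin_num_measure//; [exact: ltW|exact: measurable_gte].
  have : 4 * M ^+ 2 * t * fine (P [set w | ((e / 8)%:E < err (S n) w)%E]) <= e / 8.
    apply: (le_trans (ler_wpM2l c0 Pfin)).
    rewrite /q mulrCA ler_wpM2l ?(ltW e0)// ler_pdivrMr; last by rewrite mulr_gt0// ltr_wpDl.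
    by rewrite mulKf ?pnatr_eq0// lerDl.
  by move=> h3; apply: (@le_trans _ _ (2 * ((e / 8 + e / 8) + e / 4))); [rewrite ler_wpM2l// !lerD|apply: eq_implies_le; field].
have mS S' : measurable_fun [set: Omega] (simple_integral W S' t).
  exact: (measurable_simple_integral hF hW).
have R1 := residual_prob M0 (S n) b0 e2.
have mset (f : Omega -> R) (a : R) : measurable_fun [set: Omega] f -> measurable [set w | a < `|f w|].
  by move=> mf; apply: measurable_gtr; exact: measurableT_comp.
have m1 : measurable [set w | e < `|simple_integral W (clipS M0 (S n)) t w - I w|].
  by apply: mset; apply: measurable_funB.
have m2 : measurable [set w | e / 2 < `|simple_integral W (S n) t w - I w|].
  by apply: mset; apply: measurable_funB.
have m3 := mset _ (e / 2) (mS (resS M0 (S n))).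
apply: (@le_trans _ _ ((e / 4)%:E + ((e / 4) + (e / 4 + e / 4))%:E)%E); last first.
  by rewrite -EFinD lee_fin; apply: eq_implies_le; field.
apply: (measureU3_le m1 m2 m3); last 2 first.
- exact: ltW.
- apply: (le_trans R1); rewrite [leRHS]EFinD; apply: leeD; first exact: ltW.
  rewrite lee_fin lerD//.
    have : r <= b * e / 16 by rewrite ge_min lexx orbT.
    move=> rb; rewrite ler_pdivrMr//; apply: (le_trans HM); apply: (le_trans rb).
    by apply: eq_implies_le; field.
  rewrite /b; apply: eq_implies_le; field.
  by rewrite gt_eqF.
move=> w /=; rewrite simple_integral_clipS => h; apply: contrapT => /not_orP[/negP + /negP].
rewrite -!leNgt => A B; move: h; rewrite ltNge => /negP; apply.
rewrite (_ : _ - _ - _ = (simple_integral W (S n) t w - I w) - simple_integral W (resS M0 (S n)) t w); last by ring.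
apply: (le_trans (ler_normB _ _)).
by rewrite [leRHS](_ : e = e / 2 + e / 2); [rewrite lerD|field].
Qed.

(** Convergence in probability is upgraded by comparing [S] with a much finer approximation [S']:
    the isometry bounds the distance of the two integrals, and [I] is near the integral of [S'] off
    a small event. Clipping [S - I] at a fixed [n] makes that event harmless, and [n] is released by
    [L2_clip_bound]. *)
Lemma ito_approx (e : R) : 0 < e -> exists S : simple_process F,
  [/\ \int[PL]_z (cutvalue S t z - cutproc z) ^+ 2 <= e,
      L2 P (fun w => simple_integral W S t w - I w) &
      \int[P]_w (simple_integral W S t w - I w) ^+ 2 <= e].
Proof.
move=> e0; have e4 : 0 < e / 4 by rewrite divr_gt0.
have [S [S1 _]] := ito_approx_prob e4.
have mS S' : measurable_fun [set: Omega] (simple_integral W S' t).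
  exact: (measurable_simple_integral hF hW).
pose U w := simple_integral W S t w - I w.
have mU : measurable_fun [set: Omega] U by exact: measurable_funB.
suff [] : L2 P U /\ \int[P]_w (U w ^+ 2) <= e.
  by move=> LU Ue; exists S; split => //; apply: (le_trans S1); lra.
apply: L2_clip_bound => // n.
have IN : Rintegrable P (fun w => (clip n%:R (U w)) ^+ 2).
  apply: Rintegrable_bounded.
    by apply: measurable_funX; exact: (measurableT_comp (measurable_clip _) mU).
  exists (n%:R ^+ 2) => w; rewrite normrX ler_pXn2r ?nnegrE//; exact: norm_clip.
rewrite (Rintegral_EFin IN) lee_fin; apply/ler_addgt0Pl => c c0.
(* [2 n r] is the loss in [clip_sqr_le], and [n^2 r] bounds the contribution of the event, of
   probability at most [r], where [S'] is not close to [I]. *)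
pose C : R := 2 * n%:R + n%:R ^+ 2 + 1.
have C0 : 0 < C by rewrite ltr_wpDl// addr_ge0 ?mulr_ge0 ?sqr_ge0.
pose r := Num.min (e / 4) (c / C).
have r0 : 0 < r by rewrite lt_min e4 divr_gt0.
have re : r <= e / 4 by rewrite ge_min lexx.
have rc : r <= c / C by rewrite ge_min lexx orbT.
have [S' [T1 T2]] := ito_approx_prob r0.
pose A := [set w | r < `|simple_integral W S' t w - I w|].
have mA : measurable A by apply: measurable_gtr; apply: measurableT_comp => //; exact: measurable_funB.
pose V w := simple_integral W S t w - simple_integral W S' t w.
have LV : L2 P V by apply: L2B; exact: simple_integral_L2.
have EV : \int[P]_w (V w ^+ 2) <= e.
  rewrite /V (simple_isometry hF hW)//.
  have T1' : \int[PL]_z (cutproc z - cutvalue S' t z) ^+ 2 <= e / 4.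
    apply: le_trans re; apply: le_trans T1.
    by apply: eq_implies_le; apply: eq_Rintegral => z _; rewrite -sqrrN opprB.
  apply: (le_trans (L2_sqrB_le (cutvalue_L2 S t0) LH (cutvalue_L2 S' t0) S1 T1')).
  by lra.
have IA : Rintegrable P (\1_A : Omega -> R) by exact: integrable_indic.
have Ic : Rintegrable P (fun=> 2 * n%:R * r) by exact: (finite_measure_integrable_cst P _).
have IB : Rintegrable P (fun w => V w ^+ 2 + (2 * n%:R * r + n%:R ^+ 2 * \1_A w)).
  apply: RintegrableD; first exact: LV.2.
  by apply: RintegrableD => //; exact: RintegrableZ.
apply: (@le_trans _ _ (\int[P]_w (V w ^+ 2 + (2 * n%:R * r + n%:R ^+ 2 * \1_A w)))).
  apply: le_RintegralT => // w; rewrite indicE; have [wA|wA] := boolP (w \in A).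
    rewrite mulr1 -real_normK ?num_real//.
    have h : `|clip n%:R (U w)| ^+ 2 <= n%:R ^+ 2.
      by rewrite ler_pXn2r ?nnegrE//; exact: norm_clip.
    by rewrite addrA (le_trans h)// lerDr addr_ge0 ?sqr_ge0// !mulr_ge0// ltW.
  rewrite mulr0 addr0; apply: clip_sqr_le => //.
  have -> : U w - V w = simple_integral W S' t w - I w by rewrite /U /V; ring.
  by rewrite leNgt; apply: contra wA => h; rewrite inE.
rewrite (RintegralTD LV.2 (RintegrableD Ic (RintegrableZ _ IA))).
rewrite (RintegralTD Ic (RintegrableZ _ IA)) (RintegralTZ _ IA).
rewrite Rintegral_cst//= probability_setT mulr1.
have PA : \int[P]_w \1_A w <= r.
  rewrite /Rintegral integral_indic// setIT -lee_fin fineK//.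
  exact: fin_num_measure.
rewrite addrC lerD// (le_trans (lerD (lexx _) (ler_wpM2l (sqr_ge0 _) PA)))//.
rewrite -mulrDl; apply: (@le_trans _ _ (C * r)).
  by rewrite ler_wpM2r ?(ltW r0)// /C lerDl.
by rewrite mulrC -ler_pdivlMr.
Qed.

Lemma ito_L2 : L2 P I.
Proof.
have [S [_ L1 _]] := ito_approx ltr01.
have := L2B (simple_integral_L2 S t0) L1.
by have e w : simple_integral W S t w - (simple_integral W S t w - I w) = I w by [ring|]; rewrite (funext e).
Qed.

(** The exact identity [simple_orth] passes to the limit by [L2_inner_close], with error [r * B] for
    arbitrarily small [r]. *)
Lemma ito_orth Z : measurable_wrt (F 0) Z -> L2 P Z -> \int[P]_w (Z w * I w) = 0.
Proof.
move=> mZ LZ.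
have IZ : Rintegrable P Z.
  have I1 : Rintegrable P (fun=> 1) by exact: (finite_measure_integrable_cst P 1).
  apply: (le_Rintegrable LZ.1 _ (RintegrableD I1 LZ.2)) => w.
  by rewrite -[X in _ + X]real_normK ?num_real//; have := normr_ge0 (Z w); nra.
pose B := 2 + \int[P]_w (Z w ^+ 2) + \int[P]_w (I w ^+ 2).
have B0 : 0 < B.
  by rewrite /B -addrA ltr_wpDr// addr_ge0//; apply: Rintegral_ge0 => w _; rewrite sqr_ge0.
apply/eqP; rewrite -normr_le0; apply/ler_addgt0Pl => c c0; rewrite addr0.
pose r := Num.min 1 (c / B).
have r0 : 0 < r by rewrite lt_min ltr01 divr_gt0.
have r1 : r <= 1 by rewrite ge_min lexx.
have rc : r <= c / B by rewrite ge_min lexx orbT.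
have [S [_ L1 S1]] := ito_approx (exprn_gt0 2 r0).
have [_ ZS] := simple_orth hF hW S t0 mZ IZ.
have S1' : \int[P]_w (I w - simple_integral W S t w) ^+ 2 <= r ^+ 2.
  apply: le_trans S1; apply: eq_implies_le.
  by apply: eq_Rintegral => w _; rewrite -sqrrN opprB.
have ZZ : \int[P]_w (Z w - Z w) ^+ 2 <= r ^+ 2.
  rewrite /Rintegral; under eq_integral do rewrite subrr expr0n/=.
  by rewrite integral0 sqr_ge0.
have := L2_inner_close LZ LZ ito_L2 (simple_integral_L2 S t0) r0 r1 ZZ S1'.
rewrite ZS subr0 => h; apply: (le_trans h); rewrite -/B.
by rewrite -ler_pdivlMr.
Qed.

End ito.

Section ito_isometry.
Context {d : measure_display} {Omega : measurableType d} {R : realType}.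
Variables (P : probability Omega R) (F : R -> set (set Omega)) (W : R -> Omega -> R).
Hypotheses (hF : usual_filtration P F) (hW : brownian_motion P F W).
Local Notation leb := (@lebesgue_measure R).
Local Notation PL := (P \x leb)%E.

Lemma ito_cov (H H' : R -> Omega -> R) (t t' : R) (I I' : Omega -> R) :
  0 <= t -> 0 <= t' -> ito_integral P F W H t I -> ito_integral P F W H' t' I' ->
  L2 PL (cutproc H t) -> L2 PL (cutproc H' t') ->
  \int[P]_w (I w * I' w) = \int[PL]_z (cutproc H t z * cutproc H' t' z).
Proof.
move=> t0 t'0 hI hI' LH LH'.
have LI := ito_L2 hF hW t0 hI LH; have LI' := ito_L2 hF hW t'0 hI' LH'.
pose B := (2 + \int[P]_w (I w ^+ 2) + \int[P]_w (I' w ^+ 2)) +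
  (2 + \int[PL]_z (cutproc H t z ^+ 2) + \int[PL]_z (cutproc H' t' z ^+ 2)).
have B0 : 0 < B.
  rewrite /B -!addrA ltr_wpDr// !addr_ge0//;
    by apply: Rintegral_ge0 => w _; rewrite sqr_ge0.
apply/eqP; rewrite -subr_eq0 -normr_le0; apply/ler_addgt0Pl => c c0; rewrite addr0.
pose r := Num.min 1 (c / B).
have r0 : 0 < r by rewrite lt_min ltr01 divr_gt0.
have r1 : r <= 1 by rewrite ge_min lexx.
have rc : r <= c / B by rewrite ge_min lexx orbT.
have [S [S1 L1 S2]] := ito_approx hF hW t0 hI LH (exprn_gt0 2 r0).
have [S' [S1' L1' S2']] := ito_approx hF hW t'0 hI' LH' (exprn_gt0 2 r0).
have [_ _ E] := simple_cov hF hW S S' t0 t'0.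
have sym (d1 : measure_display) (T : measurableType d1) (m : {measure set T -> \bar R})
    (a b : T -> R) (x : R) : \int[m]_z (a z - b z) ^+ 2 <= x -> \int[m]_z (b z - a z) ^+ 2 <= x.
  apply: le_trans; apply: eq_implies_le.
  by apply: eq_Rintegral => z _; rewrite -sqrrN opprB.
have h1 := L2_inner_close LI (simple_integral_L2 hF hW S t0) LI'
  (simple_integral_L2 hF hW S' t'0) r0 r1 (sym _ _ _ _ _ _ S2) (sym _ _ _ _ _ _ S2').
have h2 := L2_inner_close LH (cutvalue_L2 hF hW S t0) LH'
  (cutvalue_L2 hF hW S' t'0) r0 r1 (sym _ _ _ _ _ _ S1) (sym _ _ _ _ _ _ S1').
rewrite E in h1; apply: (@le_trans _ _ (r * B)); last by rewrite -ler_pdivlMr.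
rewrite [r * B]mulrDr; apply: le_trans (lerD h1 h2).
rewrite [X in _ <= _ + X]distrC; apply: le_trans (ler_normD _ _).
by rewrite addrA subrK.
Qed.

End ito_isometry.

(** * The functional equation *)

Section paths.
Context {d : measure_display} {Omega : measurableType d} {R : realType}.
Implicit Types X : R -> Omega -> R.

Lemma half_line_path_dist X w t (e : R) : {within `[0, +oo[, continuous (X ^~ w)} ->
  0 <= t -> 0 < e -> exists2 r : R, 0 < r &
    forall y, 0 <= y -> `|t - y| < r -> `|X t w - X y w| < e.
Proof.
move=> /subspace_continuousP cX t0 e0.
have tI : (`[0, +oo[%classic : set R) t by rewrite /= in_itv /= t0.
have /cvgrPdist_lt /(_ _ e0) := cX t tI.
move=> /nbhs_ballP [r /= r0 Hr]; exists r => // y y0 yr.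
by apply: Hr; rewrite ?/ball //= in_itv /= y0.
Qed.

(** Sampling the path at the grid points of mesh [1 / (n + 1)] below [t] gives a countable gluing of
    random variables, and continuity gives the pointwise limit. [Num.max 0] extends the paths to
    negative times, so that joint measurability holds on the whole product. *)
Lemma measurable_path_process X : (forall t, 0 <= t -> measurable_fun [set: Omega] (X t)) ->
  (forall w, {within `[0, +oo[, continuous (X ^~ w)}) ->
  measurable_fun [set: Omega * R] (fun z => X (Num.max 0 z.2) z.1).
Proof.
move=> mX cX.
pose k n (t : R) : nat := Num.truncn (n.+1%:R * Num.max 0 t).
pose Y n (z : Omega * R) := X ((k n z.2)%:R / n.+1%:R) z.1.
have tr0 n t : 0 <= n.+1%:R * Num.max 0 t :> R.
  by rewrite mulr_ge0 // le_max lexx.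
apply: (@measurable_fun_cvg _ _ _ _ Y) => [n|[w t] _].
- move=> _ B mB; rewrite setTI.
  have -> : Y n @^-1` B = \bigcup_j
      ((X (j%:R / n.+1%:R) @^-1` B) `*` [set t : R | k n t = j]).
    apply/seteqP; split => [[w t] /= h|[w t] [j _] [/= h1 h2]].
    - by exists (k n t).
    - by rewrite /Y /= h2.
  apply: bigcup_measurable => j _; apply: measurableX.
  - rewrite -[X in measurable X]setTI; apply: (mX _ _ measurableT _ mB).
    by rewrite divr_ge0.
  - have mg : measurable_fun [set: R] (fun t : R => n.+1%:R * Num.max 0 t).
      apply: measurable_funM => //.
      by apply: measurable_maxr => //; exact: measurable_id.
    have -> : [set t : R | k n t = j] =
        [set: R] `&` (fun t : R => n.+1%:R * Num.max 0 t) @^-1` `[j%:R, j.+1%:R[.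
      apply/seteqP; split => t /=.
      - by move=> <-; rewrite in_itv /=; split => //; exact: Num.Theory.truncn_itv.
      - by rewrite in_itv /= => -[_ h]; apply: Num.Theory.truncn_def.
    exact: (mg measurableT _ (measurable_itv _)).
- pose u := Num.max 0 t.
  have u0 : 0 <= u by rewrite le_max lexx.
  apply/cvgrPdist_lt => e e0 /=.
  have [r r0 Hr] := half_line_path_dist (cX w) u0 e0.
  near=> n.
  apply: Hr; first by rewrite divr_ge0.
  have /andP[h1 h2] := Num.Theory.truncn_itv (tr0 n t).
  have n0 : 0 < n.+1%:R :> R by rewrite ltr0n.
  rewrite -/(k n t) -/u in h1 h2.
  have e1 : u - (k n t)%:R / n.+1%:R = (n.+1%:R * u - (k n t)%:R) / n.+1%:R.
    by rewrite mulrBl (mulrC n.+1%:R) mulfK // lt0r_neq0.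
  rewrite e1 ger0_norm; last by rewrite divr_ge0 // subr_ge0.
  rewrite ltr_pdivrMr //.
  apply: (@lt_trans _ _ 1); first by rewrite ltrBlDr addrC natr1.
  rewrite -ltr_pdivrMl // mulr1.
  apply: (@lt_le_trans _ _ n%:R); last by rewrite ler_nat.
  near: n; exact: nbhs_infty_gtr.
Unshelve. all: by end_near. Qed.

End paths.

Lemma lipschitz_continuous {R : realType} (g : R -> R) : lipschitz g -> continuous g.
Proof.
move=> hg x.
have [M [_ HM]] := hg.
pose k := `|M| + 1.
have k0 : 0 < k by rewrite ltr_pwDr.
have Mk : M < k by rewrite (le_lt_trans (ler_norm M)) // ltrDl.
have Hk := HM k Mk.
apply/cvgrPdist_lt => e e0; near=> y.
have Hy : `|g x - g y| <= k * `|x - y| by apply: (Hk (x, y)).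
apply: (le_lt_trans Hy); rewrite -ltr_pdivlMl //.
near: y; apply: (nbhsx_ballx x (k^-1 * e)).
by rewrite mulr_gt0 ?invr_gt0.
Unshelve. all: by end_near. Qed.

Section moments.
Context {d : measure_display} {Omega : measurableType d} {R : realType}.
Variable P : probability Omega R.

Lemma Rintegrable_fin f : measurable_fun [set: Omega] f ->
  (\int[P]_w (f w)%:E)%E \is a fin_num -> Rintegrable P f.
Proof.
move=> mf hf; apply/integrableP; split; first exact/measurable_EFinP.
by rewrite integral_fin_num_abs.
Qed.

(** The moment identities carry integrability: their right-hand sides are finite, whereas the
    extended integral of a measurable function that is not integrable is infinite. *)
Lemma centered_moments (Y : Omega -> R) (m v : R) : measurable_fun [set: Omega] Y ->
  ('E_P[Y] = m%:E)%E -> ('V_P[Y] = v%:E)%E ->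
  [/\ L2 P (fun w => Y w - m), \int[P]_w (Y w - m) = 0 &
      \int[P]_w ((Y w - m) ^+ 2) = v].
Proof.
move=> mY EY VY.
have mYm : measurable_fun [set: Omega] (fun w => Y w - m).
  by apply: measurable_funB => //; exact: measurable_cst.
have V2 : (\int[P]_w ((Y w - m) ^+ 2)%:E)%E = v%:E.
  rewrite -VY /variance covariance.unlock EY /= expectation.unlock.
  by apply: eq_integral => w _; rewrite /= expr2.
have IY : Rintegrable P Y.
  apply: Rintegrable_fin => //.
  by move: EY; rewrite expectation.unlock => ->.
have I2 : Rintegrable P (fun w => (Y w - m) ^+ 2).
  by apply: Rintegrable_fin; [exact: measurable_funX|rewrite V2].
have Ic : Rintegrable P (fun=> m) by exact: finite_measure_integrable_cst.
split; first by split.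
- rewrite RintegralTB // Rintegral_cst //= probability_setT /= mulr1.
  have : (\int[P]_w (Y w)%:E)%E = m%:E by move: EY; rewrite expectation.unlock.
  by rewrite (Rintegral_EFin IY) => -[->]; rewrite subrr.
- by move: V2; rewrite (Rintegral_EFin I2) => -[].
Qed.

End moments.

Lemma young_sqr {R : realType} (A x z : R) : 0 < A ->
  `|x * z| <= A / 2 * x ^+ 2 + A^-1 / 2 * z ^+ 2.
Proof.
move=> A0; have B0 : 0 < A^-1 by rewrite invr_gt0.
have AB : A * A^-1 = 1 by rewrite mulfV // lt0r_neq0.
move: A^-1 B0 AB => B B0 AB.
have h1 : 0 <= B * (A * x - z) ^+ 2 by rewrite mulr_ge0 ?sqr_ge0 // ltW.
have h2 : 0 <= B * (A * x + z) ^+ 2 by rewrite mulr_ge0 ?sqr_ge0 // ltW.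
have e1 : B * (A * x - z) ^+ 2 = A * x ^+ 2 + B * z ^+ 2 - 2 * (x * z).
  transitivity (A * B * A * x ^+ 2 + B * z ^+ 2 - 2 * (A * B) * (x * z)); first by ring.
  by rewrite AB mul1r mulr1.
have e2 : B * (A * x + z) ^+ 2 = A * x ^+ 2 + B * z ^+ 2 + 2 * (x * z).
  transitivity (A * B * A * x ^+ 2 + B * z ^+ 2 + 2 * (A * B) * (x * z)); first by ring.
  by rewrite AB mul1r mulr1.
rewrite e1 in h1; rewrite e2 in h2.
by rewrite ler_norml; apply/andP; split; lra.
Qed.

Lemma Rintegral_norm_convolE {R : realType} (g h : R -> R) (T s : R) : 0 <= s <= T ->
  \int[@lebesgue_measure R]_(u in `[0, s]) `|g (s - u) * h u| =
  \int[@lebesgue_measure R]_u `|(g \_ `[0, T]) (s - u) * (h \_ `[0, T]) u|.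
Proof.
move=> sT; rewrite Rintegral_mkcond; apply: eq_Rintegral => u _.
have /(congr1 (fun k => `|k u|)) := convol_integrandE g h sT.
by move=> /= <-; rewrite !patchE; case: ifP; rewrite ?normr0.
Qed.

(** * Moment equations for a solution with constant moments *)

Section stationary.
Context {d : measure_display} {Omega : measurableType d} {R : realType}.
Variables (P : probability Omega R) (F : R -> set (set Omega)) (W : R -> Omega -> R).
Variables (K mu varsigma sigma Rl : R -> R) (lambda m0 v0 sbar2 T : R).
Variables (X0 : Omega -> R) (X J : R -> Omega -> R).
Local Notation leb := (@lebesgue_measure R).
Local Notation PL := (P \x leb)%E.
Local Notation H t := (fun s w => K (t - s) * varsigma s * sigma (X s w)).
Hypotheses (hF : usual_filtration P F) (hW : brownian_motion P F W).
Hypotheses (hmu : loc_square_integrable mu) (hsigma : sigma_assumption sigma).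
Hypotheses (hvs : varsigma_assumption varsigma) (hK : kernel_assumption K).
Hypotheses (l0 : 0 < lambda) (m00 : m0 != 0).
Hypothesis hR : resolvent_assumption K lambda Rl.
Hypothesis aX : adapted F X.
Hypothesis cX : forall w, {within `[0, +oo[, continuous (X ^~ w)}.
Hypothesis X0E : {ae P, forall w, X 0 w = X0 w}.
Hypothesis hJ : forall t, 0 <= t -> ito_integral P F W (H t) t (J t).
Hypothesis eqX : forall t, 0 <= t -> {ae P, forall w, X t w =
  X0 w * volterra_phi K mu lambda m0 t + convol K (fun s => mu s - lambda * X s w) t + J t w}.
Hypothesis EX : forall t, 0 <= t -> ('E_P[X t] = m0%:E)%E.
Hypothesis VX : forall t, 0 <= t -> ('V_P[X t] = v0%:E)%E.
Hypothesis SX : forall t, 0 <= t ->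
  ('E_P[fun w => (sigma (X t w) ^+ 2)%R] = sbar2%:E)%E.
Hypothesis T0 : 0 < T.

Local Notation kT := (K \_ `[0, T]).
Local Notation vT := (varsigma \_ `[0, T]).
Let kap t u := kT (t - u) * vT u.

Let mX t : 0 <= t -> measurable_fun [set: Omega] (X t).
Proof. by move=> t0; exact: (measurable_wrt_measurable hF t0 (aX t0)). Qed.

Let mXj : measurable_fun [set: Omega * R] (fun z => X (Num.max 0 z.2) z.1).
Proof. exact: measurable_path_process. Qed.

Let msigma : measurable_fun [set: R] sigma.
Proof.
by case: hsigma => _ hs; apply: continuous_measurable_fun; exact: lipschitz_continuous.
Qed.

Let mkT : measurable_fun [set: R] kT.
Proof.
by have [m _ _] := loc_square_integrable_patch T0 (kernel_L2loc hK); exact: measurable_patch_itv.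
Qed.

Let mvT : measurable_fun [set: R] vT.
Proof.
case: hvs => _ h _.
by have [m _ _] := loc_square_integrable_patch T0 h; exact: measurable_patch_itv.
Qed.

Let mkap t : measurable_fun [set: R] (kap t).
Proof. exact: measurable_conv_integrand. Qed.

Let sigma_moment t : 0 <= t -> Rintegrable P (fun w => sigma (X t w) ^+ 2) /\
  \int[P]_w (sigma (X t w) ^+ 2) = sbar2.
Proof.
move=> t0.
have e : (\int[P]_w (sigma (X t w) ^+ 2)%:E)%E = sbar2%:E.
  by rewrite -(SX t0) expectation.unlock.
have I2 : Rintegrable P (fun w => sigma (X t w) ^+ 2).
  apply: Rintegrable_fin; last by rewrite e.
  by apply: measurable_funX; exact: (measurableT_comp msigma (mX t0)).
by split => //; move: e; rewrite (Rintegral_EFin I2) => -[].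
Qed.

(** Were it 0, the strictly positive [sigma (X 0)] would vanish almost surely, against total mass 1.
    Division by [sbar2] is thereby genuine. *)
Let sbar2_gt0 : 0 < sbar2.
Proof.
have [I2 e] := sigma_moment (lexx 0).
have h0 : 0 <= sbar2 by rewrite -e; apply: Rintegral_ge0 => w _; exact: sqr_ge0.
rewrite lt_neqAle h0 andbT eq_sym; apply/negP => /eqP s0.
have hz : (\int[P]_w `|(sigma (X 0 w) ^+ 2)%:E|)%E = 0%E.
  under eq_integral do rewrite abse_EFin ger0_norm ?sqr_ge0 //.
  by rewrite (Rintegral_EFin I2) e s0.
have mg : measurable_fun [set: Omega] (EFin \o (fun w => sigma (X 0 w) ^+ 2)).
  exact/measurable_EFinP/Rintegrable_measurable/I2.
have /integral_abs_eq0 /= hq := mg.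
have [N [mN N0 HN]] : ae_eq P setT (EFin \o (fun w => sigma (X 0 w) ^+ 2)) (cst 0%E).
  by apply/ae_eq_integral_abs.
have NT : N = setT.
  apply/seteqP; split => // w _; apply: HN => /= /(_ I) [] /eqP.
  by rewrite sqrf_eq0; apply/negP; rewrite lt0r_neq0 //; apply: (proj1 hsigma).
by move: (probability_setT P); rewrite -NT N0 => /esym/eqP; rewrite onee_eq0.
Qed.

Let cutprocE t z : 0 <= t <= T ->
  cutproc (H t) t z = kap t z.2 * sigma (X (Num.max 0 z.2) z.1).
Proof.
case: z => w s /andP[t0 tT]; rewrite /cutproc /kap /=.
have [s0|s0] := ltP s 0.
  by rewrite patch_itv_lt0 // (patch_itv_lt0 varsigma) // mulr0 mul0r.
have [st|st] := leP s t.
  rewrite (patch_itv_in _ (T := t)) ?s0 // (patch_itv_in varsigma) ?s0 ?(le_trans st) //.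
  rewrite (patch_itv_in K) ?max_r // subr_ge0 st /=.
  by rewrite (le_trans _ tT) // gerBl.
rewrite patch_itv_out; last by rewrite negb_and -!ltNge st orbT.
by rewrite patch_itv_lt0 ?mul0r // subr_lt0.
Qed.

Let measurable_cutproc t : 0 <= t <= T -> measurable_fun [set: Omega * R] (cutproc (H t) t).
Proof.
move=> tT; apply: (@eq_measurable_fun _ _ _ _ _
  (fun z => kap t z.2 * sigma (X (Num.max 0 z.2) z.1))) => [z _|]; first by rewrite cutprocE.
apply: measurable_funM; last exact: (measurableT_comp msigma mXj).
exact: (measurableT_comp (mkap t) measurable_snd).
Qed.

(* The energy of the integrand is finite along some path, on which [sigma] stays
   away from 0. *)
Let kernel_finite t : 0 <= t <= T -> Rintegrable leb (fun u => kap t u ^+ 2).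
Proof.
move=> tT; have /andP[t0 _] := tT.
have [_ _ [S [S0 _]]] := hJ t0.
have [n Hn] := cvge0_lt (S0 1 ltr01) ltr01.
have {}Hn := Hn n (leqnn n).
have [w Hw] : exists w, ~ (1%:E < `|\int[leb]_(s in `[0%R, t])
    ((simple_value (S n) s w - H t s w) ^+ 2)%:E|)%E.
  apply/existsNP => h.
  move: Hn; rewrite (_ : [set w | _] = setT); last by apply/seteqP; split => // w _; exact: h.
  by rewrite probability_setT ltxx.
set c := fun s => cutvalue (S n) t (w, s).
set h := fun s => cutproc (H t) t (w, s).
have mc : measurable_fun [set: R] c.
  exact: (measurable_section w (measurable_cutvalue hF (S n) t0)).
have mh : measurable_fun [set: R] h.
  exact: (measurable_section w (measurable_cutproc tT)).
have Lc : L2 leb c by split => //; case: (cutvalue_sqr (S n) w t0).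
have Ld : L2 leb (fun s => c s - h s).
  have md : measurable_fun [set: R] (fun s => c s - h s) by exact: measurable_funB.
  split => //; apply: Rintegrable_lty => [|s|]; first exact: measurable_funX.
    exact: sqr_ge0.
  have /negP := Hw; rewrite -leNgt => Hw1.
  apply: (@le_lt_trans _ _ 1%:E); last exact: ltry.
  apply: le_trans Hw1; rewrite gee0_abs; last first.
    by apply: integral_ge0 => s _; rewrite lee_fin sqr_ge0.
  rewrite [leRHS]integral_mkcond (_ : patch _ _ _ = fun s => ((c s - h s) ^+ 2)%:E) //.
  apply/funext => s; rewrite /c /h /cutvalue /cutproc /= !patchE.
  by case: ifP => // _; rewrite subrr expr0n.
have Lh : L2 leb h.
  have := L2B Lc Ld; rewrite (_ : (fun s => c s - (c s - h s)) = h) //.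
  by apply/funext => s; rewrite opprB addrCA subrr addr0.
have cs : {within `[0, t], continuous (fun s => sigma (X s w))}.
  apply: (@within_continuous_comp _ _ _ _ (X ^~ w) sigma).
    by move=> x _; exact: (lipschitz_continuous (proj2 hsigma)).
  apply: (continuous_subspaceW _ (@cX w)) => s /=.
  by rewrite !in_itv /= => /andP[->].
have [x xt Hx] := EVT_min t0 cs.
have b0 : 0 < sigma (X x w) ^+ 2 by rewrite exprn_gt0 //; apply: (proj1 hsigma).
have Ih := RintegrableZ (sigma (X x w) ^+ 2)^-1 Lh.2.
apply: (le_Rintegrable _ _ Ih).
- by apply: measurable_funX; exact: mkap.
- move=> s; rewrite ger0_norm ?sqr_ge0 // -ler_pdivrMl ?invr_gt0 // invrK.
  rewrite /h cutprocE //= [leRHS]exprMn [leLHS]mulrC.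
  have [st|st] := boolP (0 <= s <= t); last first.
    suff -> : kap t s = 0 by rewrite expr0n /= !mul0r.
    rewrite /kap; move: st; rewrite negb_and -!ltNge => /orP[st|st].
      by rewrite (patch_itv_lt0 varsigma) // mulr0.
    by rewrite patch_itv_lt0 ?mul0r // subr_lt0.
  have /andP[s0 _] := st; rewrite max_r //.
  rewrite ler_wpM2l ?sqr_ge0 // ler_sqr ?nnegrE; last 2 first.
  - exact: ltW (proj1 hsigma _).
  - exact: ltW (proj1 hsigma _).
  by apply: Hx; rewrite in_itv.
Qed.

(** For each fixed time the random factor contributes the constant [sbar2], so the energy reduces to
    [sbar2] times the deterministic integral of [kap^2]. *)
Let L2_cutproc t : 0 <= t <= T -> L2 PL (cutproc (H t)  t).
Proof.
move=> tT; have mc := measurable_cutproc tT; split=> //.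
apply: Rintegrable_prod2; first exact: measurable_funX.
rewrite (_ : (\int[leb]_y _)%E = (\int[leb]_s (sbar2 * kap t s ^+ 2)%:E)%E).
  rewrite Rintegral_EFin ?ltry //.
  by apply: RintegrableZ; exact: kernel_finite.
apply: eq_integral => s _.
have s0 : 0 <= Num.max 0 s by rewrite le_max lexx.
have [I2 e2] := sigma_moment s0.
under eq_integral do rewrite cutprocE //= ger0_norm ?sqr_ge0 // exprMn.
rewrite Rintegral_EFin; last exact: RintegrableZ.
by rewrite RintegralTZ // e2 mulrC.
Qed.

Let J_cov t r : 0 <= t <= T -> 0 <= r <= T ->
  \int[P]_w (J t w * J r w) = sbar2 * \int[leb]_s (kap t s * kap r s).
Proof.
move=> tT rT; have /andP[t0 _] := tT; have /andP[r0 _] := rT.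
rewrite (ito_cov hF hW t0 r0 (hJ t0) (hJ r0) (L2_cutproc tT) (L2_cutproc rT)).
rewrite -Rfubini2; last exact: L2M (L2_cutproc tT) (L2_cutproc rT).
rewrite -RintegralTZ; last first.
  by apply: RintegrableM; [exact: mkap|exact: mkap|exact: kernel_finite|exact: kernel_finite].
apply: eq_Rintegral => s _.
have s0 : 0 <= Num.max 0 s by rewrite le_max lexx.
have [I2 e2] := sigma_moment s0.
under eq_Rintegral do rewrite !cutprocE //= mulrACA -expr2.
by rewrite RintegralTZ // e2 mulrC.
Qed.

Let Xc s w := X (Num.max 0 s) w - m0.

Let mXc : measurable_fun [set: Omega * R] (fun z => Xc z.2 z.1).
Proof. by apply: measurable_funB => //; exact: measurable_cst. Qed.

Let Xc_moments s : [/\ L2 P (Xc s), \int[P]_w Xc s w = 0 & \int[P]_w (Xc s w ^+ 2) = v0].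
Proof.
have s0 : 0 <= Num.max 0 s by rewrite le_max lexx.
exact: (centered_moments (mX s0) (EX s0) (VX s0)).
Qed.

Let p Z s := \int[P]_w (Xc s w * Z w).

Let measurable_p Z : L2 P Z -> measurable_fun [set: R] (p Z).
Proof.
move=> LZ; apply: (@measurable_fun_Rintegral _ _ _ _ _ P (fun z : R * Omega => Xc z.1 z.2 * Z z.2)).
apply: measurable_funM; last exact: (measurableT_comp LZ.1 measurable_snd).
apply: (measurableT_comp mXc (g := fun z : R * Omega => (z.2, z.1))).
by apply: measurable_fun_pair; [exact: measurable_snd|exact: measurable_fst].
Qed.

(** The weight [A] stays free because [energy_le] must balance the two terms. *)
Let abs_p_le Z s (A : R) : L2 P Z -> 0 < A ->
  \int[P]_w `|Xc s w * Z w| <= (A * v0 + A^-1 * \int[P]_w (Z w ^+ 2)) / 2.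
Proof.
move=> LZ A0; have [LX _ V] := Xc_moments s.
have IA : Rintegrable P (fun w => (A / 2) * Xc s w ^+ 2) by exact: RintegrableZ LX.2.
have IZ : Rintegrable P (fun w => (A^-1 / 2) * Z w ^+ 2) by exact: RintegrableZ LZ.2.
apply: (@le_trans _ _ (\int[P]_w ((A / 2) * Xc s w ^+ 2 + (A^-1 / 2) * Z w ^+ 2))).
  apply: le_RintegralT.
  - exact: Rintegrable_norm (L2M LX LZ).
  - exact: RintegrableD.
  - by move=> w; exact: young_sqr.
rewrite RintegralTD // !RintegralTZ ?V; [|exact: LZ.2|exact: LX.2].
by apply: eq_implies_le; ring.
Qed.

Let p_le Z s (A : R) : L2 P Z -> 0 < A ->
  `|p Z s| <= (A * v0 + A^-1 * \int[P]_w (Z w ^+ 2)) / 2.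
Proof.
move=> LZ A0; have [LX _ V] := Xc_moments s.
apply: le_trans (abs_p_le s LZ A0).
by apply: le_normr_Rintegral => //; exact: L2M.
Qed.

Local Notation muT := (mu \_ `[0, T]).
Local Notation oneT := ((fun=> 1 : R) \_ `[0, T]).
Let XT w := (Xc ^~ w) \_ `[0, T].

Let IkT : Rintegrable leb kT.
Proof. by case: (loc_square_integrable_patch T0 (kernel_L2loc hK)). Qed.

Let measurable_XT w : measurable_fun [set: R] (XT w).
Proof.
apply: measurable_patch_itv; apply: measurable_funTS.
exact: (measurable_section w mXc).
Qed.

Let conv_XT w s : Rintegrable leb (fun u => kT (s - u) * XT w u).
Proof.
have cw : {within `[0, T], continuous (X ^~ w)}.
  apply: (continuous_subspaceW _ (@cX w)) => u /=.
  by rewrite !in_itv /= => /andP[->].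
have [a _ Ha] := EVT_min (ltW T0) cw.
have [b _ Hb] := EVT_max (ltW T0) cw.
apply: (@Rintegrable_bounded_conv _ _ _ _ (`|X a w| + `|X b w| + `|m0|)) => // u _.
rewrite /XT; have [uT|uT] := boolP (0 <= u <= T); last first.
  by rewrite patch_itv_out // normr0 !addr_ge0.
rewrite patch_itv_in // /Xc; have /andP[u0 _] := uT; rewrite max_r //.
apply: le_trans (ler_normB _ _) _; rewrite lerD2r.
have hu : u \in `[0, T] by rewrite in_itv.
have h1 := Ha u hu; have h2 := Hb u hu; rewrite ler_norml.
have := ler_norm (X b w); have := ler_norm (- X a w); rewrite normrN.
have := normr_ge0 (X a w); have := normr_ge0 (X b w).
by move=> *; apply/andP; split; lra.
Qed.

Let conv_muT s : Rintegrable leb (fun u => kT (s - u) * muT u).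
Proof.
have [_ _ k2] := loc_square_integrable_patch T0 (kernel_L2loc hK).
have [mm _ m2] := loc_square_integrable_patch T0 hmu.
apply: RintegrableM => //.
- exact: (measurableT_comp mkT (measurable_subr s)).
- exact: measurable_patch_itv.
- exact: (Rintegrable_subr s k2).
Qed.

Let conv_oneT s : Rintegrable leb (fun u => kT (s - u) * oneT u).
Proof.
apply: (@Rintegrable_bounded_conv _ _ _ _ 1) => // [|u _].
  by apply: measurable_patch_itv; exact: measurable_cst.
rewrite patchE; by case: ifP; rewrite ?normr1 ?normr0 ?ler01.
Qed.

(** Read as [m0 = m0 * phi + K * (mu - lambda m0)]: the function [phi] is designed so that the
    constant [m0] solves the equation without noise. Centring therefore removes [mu]. *)
Let phiE s : 0 <= s <= T -> m0 * volterra_phi K mu lambda m0 s =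
  m0 - conv kT muT s + lambda * m0 * conv kT oneT s.
Proof.
move=> sT; rewrite /volterra_phi (convolE _ _ sT).
have -> : conv kT ((fun u => mu u / (lambda * m0) - 1) \_ `[0, T]) s =
    (lambda * m0)^-1 * conv kT muT s - conv kT oneT s.
  rewrite -Rintegral_scale; last exact: RintegrableZ.
  rewrite /conv -RintegralTB //; last exact: RintegrableZ.
  apply: eq_Rintegral => u _; have [uT|uT] := boolP (0 <= u <= T).
    by rewrite !(patch_itv_in _ uT); ring.
  by rewrite !(patch_itv_out _ uT) !mulr0 subrr.
by field; rewrite m00 lt0r_neq0.
Qed.

Let path_eq s : 0 <= s <= T -> {ae P, forall w, Xc s w =
  volterra_phi K mu lambda m0 s * Xc 0 w - lambda * conv kT (XT w) s + J s w}.
Proof.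
move=> sT; have /andP[s0 _] := sT.
have h := eqX s0; near=> w.
have hw : X s w = X0 w * volterra_phi K mu lambda m0 s +
  convol K (fun s => mu s - lambda * X s w) s + J s w by near: w.
have h0 : X 0 w = X0 w by near: w.
rewrite /Xc max_r // (max_r (lexx 0)) hw -h0.
have -> : convol K (fun s => mu s - lambda * X s w) s =
    conv kT muT s - lambda * (conv kT (XT w) s + m0 * conv kT oneT s).
  rewrite (convolE _ _ sT) -[in m0 * _]Rintegral_scale; last exact: RintegrableZ.
  rewrite -RintegralTD //; last exact: RintegrableZ.
  rewrite -Rintegral_scale; last by apply: RintegrableZ; apply: RintegrableD => //; exact: RintegrableZ.
  rewrite /conv -RintegralTB //; last by apply: RintegrableZ; apply: RintegrableD => //; exact: RintegrableZ.
  apply: eq_Rintegral => u _; rewrite /XT /Xc; have [uT|uT] := boolP (0 <= u <= T).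
    by rewrite !(patch_itv_in _ uT) max_r; [ring|case/andP: uT].
  by rewrite !(patch_itv_out _ uT) !mulr0 addr0 mulr0 subr0.
have := phiE sT; set ph := volterra_phi _ _ _ _ _.
move: (conv kT muT s) (conv kT oneT s) (conv kT (XT w) s) => A B C e.
transitivity ((X 0 w - m0) * ph + (m0 * ph) + (A - lambda * (C + m0 * B)) + J s w - m0).
  by ring.
by rewrite e; ring.
Unshelve. all: by end_near. Qed.

Let L2_J s : 0 <= s <= T -> L2 P (J s).
Proof.
by move=> sT; have /andP[s0 _] := sT; exact: (ito_L2 hF hW s0 (hJ s0) (L2_cutproc sT)).
Qed.

(** Fubini between the expectation and the time integral, licensed by the bound on [E|Y_u Z|]
    uniform in [u]. Continuity of the paths makes the inner time integral meaningful for every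
    [w]. *)
Let moment_conv Z s : L2 P Z ->
  Rintegrable P (fun w => conv kT (XT w) s * Z w) /\
  \int[P]_w (conv kT (XT w) s * Z w) = conv kT (p Z \_ `[0, T]) s.
Proof.
move=> LZ.
pose g (z : Omega * R) := kT (s - z.2) * oneT z.2 * (Xc z.2 z.1 * Z z.1).
have mg : measurable_fun [set: Omega * R] g.
  apply: measurable_funM.
    apply: (measurableT_comp (Rintegrable_measurable (conv_oneT s)) measurable_snd).
  by apply: measurable_funM => //; exact: (measurableT_comp LZ.1 measurable_fst).
pose C := (1 * v0 + 1^-1 * \int[P]_w (Z w ^+ 2)) / 2.
have Ig : Rintegrable PL g.
  apply: Rintegrable_prod2 => //.
  apply: (@le_lt_trans _ _ (\int[leb]_u (C * `|kT (s - u) * oneT u|)%:E)%E).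
    apply: ge0_le_integral => //.
    - by move=> u _; apply: integral_ge0.
    - apply: (@measurable_fun_fubini_tonelli_G _ _ _ _ _ P (fun z => (`|g z|)%:E)) => //.
      by apply/measurable_EFinP; exact: measurableT_comp.
    - apply/measurable_EFinP; apply: measurable_funM; first exact: measurable_cst.
      exact: Rintegrable_measurable (Rintegrable_norm (conv_oneT s)).
    - move=> u _; have [LX _ _] := Xc_moments u.
      have IZ := Rintegrable_norm (L2M LX LZ).
      under eq_integral do rewrite /g /= normrM.
      rewrite Rintegral_EFin; last exact: RintegrableZ.
      by rewrite RintegralTZ // lee_fin mulrC ler_wpM2r //; exact: abs_p_le.
  rewrite Rintegral_EFin ?ltry //; apply: RintegrableZ.
  exact: Rintegrable_norm.
have gE w u : g (w, u) = Z w * (kT (s - u) * XT w u).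
  rewrite /g /XT /=; have [uT|uT] := boolP (0 <= u <= T).
    by rewrite !(patch_itv_in _ uT); ring.
  by rewrite !(patch_itv_out _ uT) !mulr0 mul0r.
have e w : \int[leb]_u g (w, u) = conv kT (XT w) s * Z w.
  under eq_Rintegral do rewrite gE.
  by rewrite RintegralTZ // mulrC.
split.
  have := Rintegrable_fubini1 Ig.
  by rewrite (_ : (fun w => _) = (fun w => conv kT (XT w) s * Z w)) //; apply/funext => w.
under eq_Rintegral do rewrite -e.
rewrite (Rfubini Ig); apply: eq_Rintegral => u _.
have [LX _ _] := Xc_moments u.
rewrite /g /= RintegralTZ; last exact: L2M.
have [uT|uT] := boolP (0 <= u <= T); first by rewrite !(patch_itv_in _ uT) mulr1.
by rewrite !(patch_itv_out _ uT) !mulr0 mul0r.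
Qed.

(** Multiply [path_eq] by [Z] and take expectations. *)
Let main_equation Z s : L2 P Z -> 0 <= s <= T ->
  p Z s + lambda * convol K (p Z) s =
  volterra_phi K mu lambda m0 s * p Z 0 + \int[P]_w (J s w * Z w).
Proof.
move=> LZ sT; have [IC eC] := moment_conv s LZ.
have [L0 _ _] := Xc_moments 0; have [Ls _ _] := Xc_moments s.
have LJ := L2_J sT.
set ph := volterra_phi K mu lambda m0 s.
have I0 := L2M L0 LZ; have IJ := L2M LJ LZ.
have I1 : Rintegrable P (fun w => ph * (Xc 0 w * Z w)) by exact: RintegrableZ.
have I2 : Rintegrable P (fun w => lambda * (conv kT (XT w) s * Z w)) by exact: RintegrableZ.
have I3 := RintegrableB I1 I2.
have e : p Z s = \int[P]_w (ph * (Xc 0 w * Z w) - lambda * (conv kT (XT w) s * Z w) + J s w * Z w).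
  apply: ae_eq_Rintegral.
  - exact: Rintegrable_measurable (L2M Ls LZ).
  - exact: Rintegrable_measurable (RintegrableD I3 IJ).
  - apply: filterS (path_eq sT) => w ->; rewrite /ph; ring.
rewrite e RintegralTD // RintegralTB // !RintegralTZ // eC (convolE _ _ sT) /p.
ring.
Qed.

Let p_J0 r : 0 <= r <= T -> p (J r) 0 = 0.
Proof.
move=> rT; have /andP[r0 _] := rT; have [LX _ _] := Xc_moments 0.
apply: (ito_orth hF hW r0 (hJ r0) (L2_cutproc rT) _ LX).
rewrite /Xc maxxx; apply: (measurable_wrtB (aX (lexx 0))).
exact: measurable_cst.
Qed.

Let nK := \int[leb]_s `|kT s|.
Let A := 1 + lambda * nK.

Let nK_ge0 : 0 <= nK.
Proof. by apply: Rintegral_ge0 => s _; exact: normr_ge0. Qed.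

Let A_gt0 : 0 < A.
Proof. by rewrite ltr_pwDl // mulr_ge0 // ltW. Qed.

Let convol_p_le Z s B : L2 P Z -> 0 <= s <= T -> (forall u, `|p Z u| <= B) ->
  `|convol K (p Z) s| <= B * nK.
Proof.
move=> LZ sT pB; rewrite (convolE _ _ sT).
have mpT : measurable_fun [set: R] (p Z \_ `[0, T]).
  by apply: measurable_patch_itv; apply: measurable_funTS; exact: measurable_p.
have pTB u : `|(p Z \_ `[0, T]) u| <= B.
  rewrite patchE; case: ifP => // _.
  by rewrite normr0; exact: le_trans (normr_ge0 _) (pB 0).
have Ip : Rintegrable leb (fun u => kT (s - u) * (p Z \_ `[0, T]) u).
  by apply: (@Rintegrable_bounded_conv _ _ _ _ B).
have Ik := Rintegrable_subr s (Rintegrable_norm IkT).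
apply: le_trans (le_normr_Rintegral _ Ip) _ => //.
rewrite /nK -(Rintegral_subr s (Rintegrable_norm IkT)) -Rintegral_scale; last exact: RintegrableZ.
apply: le_RintegralT; [exact: Rintegrable_norm|exact: RintegrableZ|].
by move=> u; rewrite normrM mulrC ler_wpM2r.
Qed.

(* With [e = E[J_r^2]], the equation for [Z = J_r] at time [r] gives
   [e <= A * sup |p|], and [sup |p| <= (A * v0 + e / A) / 2]. *)
Let energy_le r : 0 <= r <= T -> \int[P]_w (J r w ^+ 2) <= A ^+ 2 * v0.
Proof.
move=> rT; have LJ := L2_J rT; have := main_equation LJ rT.
rewrite p_J0 // mulr0 add0r; under eq_Rintegral do rewrite -expr2.
set e := Rintegral _ _ _ => He.
pose B := (A * v0 + A^-1 * e) / 2.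
have pB u : `|p (J r) u| <= B by exact: p_le.
have cB := convol_p_le LJ rT pB.
have eB : e <= A * B.
  rewrite -He /A mulrDl mul1r; apply: lerD.
    exact: le_trans (ler_norm _) (pB r).
  rewrite -mulrA ler_wpM2l ?(ltW l0) // mulrC.
  exact: le_trans (ler_norm _) cB.
(* The weight [A] in Young's inequality makes [e] reappear with the coefficient [1 / 2], so it is
   absorbed by the left-hand side. *)
have AB : A * B = (A ^+ 2 * v0 + e) / 2.
  by rewrite /B; field; rewrite lt0r_neq0.
move: eB; rewrite AB ler_pdivlMr // => h; lra.
Qed.

Let D := A ^+ 2 * v0 / sbar2.

(** The isometry is read backwards: [E[J_r^2]] is [sbar2] times this integral. [kernel_finite] gives
    finiteness for each [r]; [energy_le] makes the bound uniform. *)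
Let kap_le r : 0 <= r <= T -> \int[leb]_u (kap r u ^+ 2) <= D.
Proof.
move=> rT; rewrite /D ler_pdivlMr // mulrC.
under eq_Rintegral do rewrite expr2.
rewrite -J_cov //; under eq_Rintegral do rewrite -expr2.
exact: energy_le.
Qed.

Local Notation f := (resolvent_density Rl).
Let psi := 1 - convol f mu T / (lambda * m0).

Let solve_p Z (a C : R) (nu : R -> R) : L2 P Z -> measurable_fun (`[0, T] : set R) nu ->
  (forall s, 0 <= s <= T -> leb.-integrable `[0, s] (fun u => (K (s - u) * nu u)%:E) /\
     \int[leb]_(u in `[0, s]) `|K (s - u) * nu u| <= C) ->
  p Z 0 = a ->
  (forall s, 0 <= s <= T -> \int[P]_w (J s w * Z w) = convol K nu s) ->
  leb.-integrable `[0, T] (fun u => (f (T - u) * nu u)%:E) /\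
  p Z T = a * psi + convol f nu T / lambda.
Proof.
move=> LZ mnu nuC pa JZ.
apply: (volterra_equation_solution (lt0r_neq0 l0) hK hR T0 m00 hmu
  (M := (1 * v0 + 1^-1 * \int[P]_w (Z w ^+ 2)) / 2) (C := C)) => //.
- by apply: measurable_funTS; exact: measurable_p.
- by move=> s _; exact: p_le.
- by move=> s sT; rewrite main_equation // pa JZ // mulrC.
Qed.

Let p_X0 : p (Xc 0) T = v0 * psi.
Proof.
have [LX _ V] := Xc_moments 0.
have K0 s : convol K (fun=> 0) s = 0.
  by rewrite /convol; under eq_Rintegral do rewrite /= mulr0; rewrite Rintegral_cst // mul0r.
have f0 : convol f (fun=> 0) T = 0.
  by rewrite /convol; under eq_Rintegral do rewrite /= mulr0; rewrite Rintegral_cst // mul0r.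
have [||||_ ->] := @solve_p (Xc 0) v0 0 (fun=> 0) LX.
- exact: measurable_cst.
- move=> s sT; split.
    by rewrite (_ : (fun _ => _) = cst 0%E); [exact: integrable0|apply/funext => u; rewrite mulr0].
  by under eq_Rintegral do rewrite mulr0 normr0; rewrite Rintegral_cst // mul0r.
- by rewrite /p -V; apply: eq_Rintegral => w _; rewrite expr2.
- move=> s sT; rewrite K0; transitivity (p (J s) 0); last exact: p_J0.
  by apply: eq_Rintegral => w _; rewrite mulrC.
by rewrite f0 mul0r addr0.
Qed.

(** The source for [Z = J_r]: with it the covariance of [J_s] and [J_r] is [(K * nu r)(s)]. The
    truncated kernel in it vanishes for [u > r]. *)
Let nu r u := sbar2 * (kT (r - u) * varsigma u ^+ 2).

Let nu_patch r s u : kT (s - u) * (nu r \_ `[0, T]) u = sbar2 * (kap s u * kap r u).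
Proof.
rewrite /nu /kap; have [uT|uT] := boolP (0 <= u <= T); first by rewrite !(patch_itv_in _ uT); ring.
by rewrite !(patch_itv_out _ uT) !mulr0.
Qed.

Let vs_T : measurable_fun (`[0, T] : set R) varsigma.
Proof. by case: hvs => _ h _; have [] := loc_square_integrable_patch T0 h. Qed.

Let kapM s r : 0 <= s <= T -> 0 <= r <= T -> Rintegrable leb (fun u => kap s u * kap r u).
Proof.
by move=> sT rT; apply: RintegrableM; [exact: mkap|exact: mkap|exact: kernel_finite|exact: kernel_finite].
Qed.

Let p_J r : 0 <= r <= T -> p (J r) T = convol f (nu r) T / lambda.
Proof.
move=> rT; have LJ := L2_J rT.
have [||||_ ->] := @solve_p (J r) 0 (sbar2 * D) (nu r) LJ.
- apply: measurable_funM; first exact: measurable_cst.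
  apply: measurable_funM; last exact: measurable_funX.
  by apply: measurable_funTS; exact: (measurableT_comp mkT (measurable_subr r)).
- move=> s sT; have Ikk := kapM sT rT; split.
    apply/(integrable_convolE _ _ sT).
    by under eq_fun do rewrite nu_patch; exact: RintegrableZ.
  rewrite (Rintegral_norm_convolE _ _ sT).
  under eq_Rintegral do rewrite nu_patch normrM (gtr0_norm sbar2_gt0).
  rewrite Rintegral_scale; last by apply: RintegrableZ; exact: Rintegrable_norm.
  rewrite ler_wpM2l ?(ltW sbar2_gt0) //.
  have I1 : Rintegrable leb (fun u => 1 / 2 * kap s u ^+ 2) by apply: RintegrableZ; exact: kernel_finite.
  have I2 : Rintegrable leb (fun u => 1^-1 / 2 * kap r u ^+ 2) by apply: RintegrableZ; exact: kernel_finite.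
  apply: (@le_trans _ _ (\int[leb]_u (1 / 2 * kap s u ^+ 2 + 1^-1 / 2 * kap r u ^+ 2))).
    apply: le_RintegralT; [exact: Rintegrable_norm|exact: RintegrableD|].
    by move=> u; exact: young_sqr.
  rewrite RintegralTD // !Rintegral_scale //.
  have := kap_le sT; have := kap_le rT; rewrite invr1.
  by move: (Rintegral _ _ _) (Rintegral _ _ _) => x y h1 h2; lra.
- exact: p_J0.
- move=> s sT; rewrite (convolE _ _ sT) /conv.
  under [RHS]eq_Rintegral do rewrite nu_patch.
  rewrite Rintegral_scale; first exact: J_cov.
  by apply: RintegrableZ; exact: kapM.
by rewrite mul0r add0r.
Qed.

(** Up to the factor in [nu'], this is the source for [Z = Y_T]. It appears when [E[J_s Y_T] = (f *
    nu s)(T) / lambda] is regrouped as a convolution of [K] at time [s]. *)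
Let weight u := f (T - u) * varsigma u ^+ 2.
Let nu' u := sbar2 / lambda * weight u.

Let weight_bounded : exists C : R, forall s, 0 <= s <= T ->
  leb.-integrable `[0, s] (fun u => (K (s - u) * weight u)%:E) /\
  \int[leb]_(u in `[0, s]) `|K (s - u) * weight u| <= C.
Proof.
case: hvs => _ h _; apply: (density_weight_bounded hK hR (D := D)) => // s sT.
by split; [exact: kernel_finite|exact: kap_le].
Qed.

(** A second factor [psi] enters through the initial value [v0 * psi], and a second factor
    [f (T - u)] through the source, which already contains one. Integrability of [f^2 varsigma^2]
    comes with the solution formula. *)
Let variance_identity : leb.-integrable `[0, T] (fun u => (f (T - u) ^+ 2 * varsigma u ^+ 2)%:E) /\
  v0 = v0 * psi ^+ 2 + sbar2 / lambda ^+ 2 * \int[leb]_(u in `[0, T]) (f (T - u) ^+ 2 * varsigma u ^+ 2).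
Proof.
have [LX _ V] := Xc_moments T.
have [C HC] := weight_bounded.
have c0 : 0 < sbar2 / lambda by rewrite divr_gt0.
have nuE s u : K (s - u) * nu' u = sbar2 / lambda * (K (s - u) * weight u).
  by rewrite /nu'; ring.
have [||||I e] := @solve_p (Xc T) (v0 * psi) (sbar2 / lambda * C) nu' LX.
- apply: measurable_funM; first exact: measurable_cst.
  apply: measurable_funM; last exact: measurable_funX.
  have [mf _ _] := resolvent_density_patch hR T0.
  have mfT : measurable_fun (`[0, T] : set R) (fun u => (f \_ `[0, T]) (T - u)).
    apply: measurable_funTS.
    by apply: (measurableT_comp _ (measurable_subr T)); exact: measurable_patch_itv.
  apply: eq_measurable_fun mfT.
  move=> u /set_mem /=; rewrite in_itv /= => /andP[u0 uT].
  by rewrite patch_itv_in // subr_ge0 uT gerBl.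
- move=> s sT; have [I1 e1] := HC s sT; split.
    rewrite (_ : (fun _ => _) = fun u => ((sbar2 / lambda)%:E * (K (s - u) * weight u)%:E)%E).
      exact: integrableZl.
    by apply/funext => u; rewrite nuE EFinM.
  under eq_Rintegral do rewrite nuE normrM (gtr0_norm c0).
  rewrite RintegralZl //; last exact: integrable_norm.
  by rewrite ler_wpM2l // ltW.
- by rewrite -p_X0 /p; apply: eq_Rintegral => w _; rewrite mulrC.
(* By symmetry of the covariance the source is the value found in [p_J]; the integrands of
   [f * nu s] at [T] and of [K * nu'] at [s] agree up to the factor [lambda]. *)
- move=> s sT; transitivity (p (J s) T).
    by apply: eq_Rintegral => w _; rewrite mulrC.
  have TT : 0 <= T <= T by rewrite ltW // lexx.
  rewrite p_J // (convolE _ _ TT) (convolE _ _ sT).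
  have [/(integrable_convolE _ _ sT) I1 _] := HC s sT.
  have I2 : Rintegrable leb (fun u => kT (s - u) * (nu' \_ `[0, T]) u).
    rewrite (_ : (fun _ => _) = fun u => sbar2 / lambda * (kT (s - u) * (weight \_ `[0, T]) u)).
      exact: RintegrableZ.
    apply/funext => u; rewrite /nu'; have [uT|uT] := boolP (0 <= u <= T).
      by rewrite !(patch_itv_in _ uT); ring.
    by rewrite !(patch_itv_out _ uT) !mulr0.
  have lz : lambda != 0 by rewrite lt0r_neq0.
  apply: (mulIf lz); rewrite divfK // mulrC -Rintegral_scale; last exact: RintegrableZ.
  apply: eq_Rintegral => u _; rewrite /nu' /nu /weight; have [uT|uT] := boolP (0 <= u <= T).
    rewrite !(patch_itv_in _ uT) patch_itv_in; first by field.
    by case/andP: uT => u0 uT; rewrite subr_ge0 uT gerBl.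
  by rewrite !(patch_itv_out _ uT) !mulr0.
have QE u : f (T - u) ^+ 2 * varsigma u ^+ 2 = (sbar2 / lambda)^-1 * (f (T - u) * nu' u).
  by rewrite /nu' /weight; field; rewrite !lt0r_neq0.
have -> : (fun u => (f (T - u) ^+ 2 * varsigma u ^+ 2)%:E) =
    (fun u => ((sbar2 / lambda)^-1%:E * (f (T - u) * nu' u)%:E)%E).
  by apply/funext => u; rewrite QE EFinM.
split; first exact: integrableZl.
under eq_Rintegral do rewrite QE.
rewrite RintegralZl // -/(convol f nu' T).
have pV : p (Xc T) T = v0 by rewrite /p -V; apply: eq_Rintegral => w _; rewrite expr2.
move: e; rewrite pV => {1}->.
by field; rewrite !lt0r_neq0.
Qed.

Lemma functional_equation_pos :
  (v0 / sbar2 * lambda ^+ 2 * (1 - (1 - convol f mu T / (lambda * m0)) ^+ 2))%:E =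
  econvol (fun s => f s ^+ 2) (fun s => varsigma s ^+ 2) T.
Proof.
have [I e] := variance_identity.
(* The integrability in [variance_identity] makes the extended convolution finite, so it equals its
   real counterpart. *)
rewrite /econvol -[RHS](@fineK _ _) ?integrable_fin_num //.
rewrite -/(Rintegral _ _ _) -/psi; congr EFin.
have -> : v0 / sbar2 * lambda ^+ 2 * (1 - psi ^+ 2) = (v0 - v0 * psi ^+ 2) / sbar2 * lambda ^+ 2 by ring.
rewrite [X in X - _]e; move: (Rintegral _ _ _) => x.
by field; rewrite !lt0r_neq0.
Qed.

End stationary.

Theorem theorem3p6 (R : realType) (d : measure_display)
    (Omega : measurableType d) (P : probability Omega R)
    (F : R -> set (set Omega)) (W : R -> Omega -> R)
    (K mu varsigma sigma Rl : R -> R) (lambda m0 v0 sbar2 : R)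
    (X0 : Omega -> R) (X : R -> Omega -> R) :
  usual_filtration P F ->
  brownian_motion P F W ->
  measurable_wrt (F 0) X0 ->
  independent P (sigma_rv X0) (sigma_process W) ->
  loc_square_integrable mu ->
  sigma_assumption sigma ->
  varsigma_assumption varsigma ->
  kernel_assumption K ->
  0 < lambda ->
  m0 != 0 ->
  resolvent_assumption K lambda Rl ->
  X0 \in Lfun P 2%:E ->
  volterra_solution P F W K (volterra_phi K mu lambda m0) mu varsigma sigma
    lambda X0 X ->
  0 <= v0 ->
  0 <= sbar2 ->
  (forall t : R, 0 <= t ->
    [/\ 'E_P[X t] = m0%:E,
        'V_P[X t] = v0%:E &
        'E_P[fun w => (sigma (X t w) ^+ 2)%R] = sbar2%:E]%E) ->
  let f := resolvent_density Rl in
  let c := v0 / sbar2 in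
  ('E_P[X0] = m0%:E)%E /\ m0 != 0 /\
  (forall t : R, 0 <= t ->
    (c * lambda ^+ 2 *
       (1 - (1 - convol f mu t / (lambda * m0)) ^+ 2))%:E =
    econvol (fun s => f s ^+ 2) (fun s => varsigma s ^+ 2) t).

Proof.
move=> hF hW mX0 _ hmu hsigma hvs hK l0 m00 hR _ [aX cX X0E eqX] _ _ hmom f c.
split.
  have [<- _ _] := hmom 0 (lexx 0).
  rewrite !expectation.unlock; apply: ae_eq_integral => //.
  - by apply/measurable_EFinP; exact: (measurable_wrt_measurable hF (lexx 0)).
  - by apply/measurable_EFinP; exact: (measurable_wrt_measurable hF (lexx 0) (aX _ (lexx 0))).
  - by apply: filterS X0E => w /= ->.
(* At [t = 0] both convolutions are integrals over a point and both sides are 0; the section on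
   moments works with a horizon [T > 0]. *)
split=> // t; rewrite le_eqVlt => /orP[/eqP<-|t0].
  rewrite /convol /econvol set_itv1 integral_set1 /Rintegral integral_set1 /= mul0r subr0.
  by rewrite expr1n subrr mulr0.
(* The solution provides a stochastic integral for each time separately; choice makes them a family.
   Negative times get a dummy value, their premise being false. *)
have /choice [J hJ] : forall s, exists I : Omega -> R, 0 <= s ->
    ito_integral P F W (fun u w => K (s - u) * varsigma u * sigma (X u w)) s I /\
    {ae P, forall w, X s w = X0 w * volterra_phi K mu lambda m0 s +
      convol K (fun u => mu u - lambda * X u w) s + I w}.
  move=> s; have [s0|s0] := leP 0 s; last by exists (fun=> 0).
  by have [I hI] := eqX s s0; exists I.
apply: (@functional_equation_pos _ _ _ P F W K mu varsigma sigma Rl lambda m0 v0 sbar2 t X0 X J) => //.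
- by move=> s s0; have [] := hJ s s0.
- by move=> s s0; have [] := hJ s s0.
- by move=> s s0; have [] := hmom s s0.
- by move=> s s0; have [] := hmom s s0.
- by move=> s s0; have [] := hmom s s0.
Qed.
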